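(* Let $(X,\mathbb P_x)_{x\in D}$ be a stochastically continuous affine process on $D=\mathbb R_+^m\times\mathbb R^n$ with admissible parameters $(\alpha,\beta,\gamma,\kappa)$. The following are equivalent: (i) $(X,\mathbb P_x)_{x\in D}$ is conservative, i.e. $p_t(x,D)=1$ for all $t\ge0$, $x\in D$; (ii) $R_0(0)=0$ and there is no non-trivial $\mathbb R_-^m$-valued local solution $g$ (on some interval $[0,T)$, $T>0$) of $\partial_t g(t)=R_{\mathcal I}(g(t),0)$ with $g(0)=0$. Moreover, each of these statements implies $R(0)=0$ (equivalently, together with $R_0(0)=0$, $\gamma=0$).
   Context: Setting: $m,n\ge0$, $d=m+n\ge1$, $D=\mathbb R_+^m\times\mathbb R^n$. $(X,\mathbb P_x)_{x\in D}$ is a time-homogeneous Markov process with values in the one-point compactification $D_\Delta$ and transition function $p_t(x,d\xi)$. It is stochastically continuous if $p_s(x,\cdot)\to p_t(x,\cdot)$ weakly as $s\to t$ for all $(t,x)$, and affine if for all $t\ge0$, $u\in i\mathbb R^d$ there are $\psi_0(t,u)\in\mathbb C$, $\psi(t,u)\in\mathbb C^d$ with $\int_D e^{\langle u,\xi\rangle}p_t(x,d\xi)=\exp(\psi_0(t,u)+\langle\psi(t,u),x\rangle)$ for all $x\in D$. Truncation function $h=(h_1,\dots,h_d)$: $h_k(\xi)=0$ if $\xi_k=0$, else $(1\wedge|\xi_k|)\xi_k/|\xi_k|$. Parameters $(\alpha,\beta,\gamma,\kappa)$ are admissible if: $\alpha=(\alpha_0,\dots,\alpha_d)$ are symmetric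 positive semidefinite $d\times d$ matrices with $\alpha_j=0$ for $j\ge m+1$ and $\alpha_j^{kl}=0$ for $0\le j\le m$, $1\le k,l\le m$ unless $k=l=j$; $\kappa=(\kappa_0,\dots,\kappa_d)$ are Borel measures on $D\setminus\{0\}$ with $\kappa_j=0$ for $j\ge m+1$, $\int\|h(\xi)\|^2\kappa_j(d\xi)<\infty$ for $0\le j\le m$ and $\int|h_k(\xi)|\kappa_j(d\xi)<\infty$ for $0\le j\le m$, $1\le k\le m$, $k\ne j$; $\beta=(\beta_0,\dots,\beta_d)$, $\beta_j\in\mathbb R^d$, with $\beta_j^k=0$ for $j\ge m+1$, $1\le k\le m$, and $\beta_j^k-\int h_k(\xi)\kappa_j(d\xi)\ge0$ for $0\le j\le m$, $1\le k\le m$, $k\ne j$; $\gamma=(\gamma_0,\dots,\gamma_d)$ with $\gamma_j\ge0$ and $\gamma_j=0$ for $j\ge m+1$. For $0\le i\le d$, $$R_i(u)=\tfrac12\langle\alpha_iu,u\rangle+\langle\beta_i,u\rangle-\gamma_i+\int_{D\setminus\{0\}}\big(e^{\langle u,\xi\rangle}-1-\langle u,h(\xi)\rangle\big)\kappa_i(d\xi),$$ $R=(R_1,\dots,R_d)$. Every stochastically continuous affine process has unique admissible parameters such that $\partial_t\psi=R(\psi)$, $\psi(0,u)=u$, $\partial_t\psi_0=R_0(\psi)$, $\psi_0(0,u)=0$; conversely each admissible parameter set determines a unique stochastically continuous affine process. Notation: $\mathcal I=\{1,\dots,m\}$, $R_{\mathcal I}=(R_1,\dots,R_m)$, and $R_{\mathcal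 I}(v,0)$ means $R_{\mathcal I}$ evaluated at $(v_1,\dots,v_m,0,\dots,0)$, well defined for $v\in\mathbb R_-^m$. *)

(* Defs.v *)
From HB Require Import structures.
From mathcomp Require Import all_boot all_order all_algebra.
From mathcomp Require Import all_classical all_reals all_analysis.
From mathcomp Require Import measurable_realfun complex.

Set Implicit Arguments.
Unset Strict Implicit.
Unset Printing Implicit Defensive.

Import Order.TTheory GRing.Theory Num.Theory.
Import numFieldNormedType.Exports.

Local Open Scope classical_set_scope.
Local Open Scope ring_scope.
Local Open Scope complex_scope.

Section AffineDefs.
Variables (R : realType) (m n : nat).

Notation vec := 'rV[R]_(m + n).

Definition Bvec : Type := g_sigma_algebraType (@open vec).
HB.instance Definition _ := Pointed.on Bvec.
HB.instance Definition _ :=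
  Measurable.copy Bvec (g_sigma_algebraType (@open vec)).

Definition stateD : set vec :=
  [set x | forall k : 'I_(m + n), (k < m)%N -> 0 <= x ord0 k].

Definition stateDB : set Bvec := stateD.

Definition stateD0 : set vec := stateD `\ 0.

Definition trunc (xi : vec) : vec :=
  \row_k (if xi ord0 k == 0 then 0
          else Num.min 1 `|xi ord0 k| * (xi ord0 k / `|xi ord0 k|)).

Definition cdot (u : 'I_(m + n) -> R[i]) (xi : vec) : R[i] :=
  \sum_(k < m + n) u k * (xi ord0 k)%:C.

Definition cexp (z : R[i]) : R[i] :=
  (expR (complex.Re z) * cos (complex.Im z)) +i* (expR (complex.Re z) * sin (complex.Im z)).

Definition cint (mu : {measure set Bvec -> \bar R}) (A : set vec)
  (f : vec -> R[i]) : R[i] :=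
  (Rintegral mu A (fun xi => complex.Re (f xi))) +i* (Rintegral mu A (fun xi => complex.Im (f xi))).

(* The functions R_j, j = 0..d (index j : 'I_(d+1)); coordinate k : 'I_d of
   the paper's R = (R_1,...,R_d) is R_(lift ord0 k). *)
Definition Rfun (alpha : 'I_(m + n).+1 -> 'M[R]_(m + n))
  (beta : 'I_(m + n).+1 -> vec) (gamma : 'I_(m + n).+1 -> R)
  (kappa : 'I_(m + n).+1 -> {measure set Bvec -> \bar R})
  (j : 'I_(m + n).+1) (u : 'I_(m + n) -> R[i]) : R[i] :=
  (2^-1 : R)%:C * (\sum_(k < m + n) \sum_(l < m + n) (alpha j k l)%:C * u k * u l)
  + (\sum_(k < m + n) (beta j ord0 k)%:C * u k) - (gamma j)%:C
  + cint (kappa j) stateD0 (fun xi => cexp (cdot u xi) - 1 - cdot u (trunc xi)).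

(* admissibility of (alpha, beta, gamma, kappa); paper index j in {0..d}
   is j : 'I_(d+1); paper coordinate k in {1..d} is k' : 'I_d with k = k'+1 *)
Definition admissible (alpha : 'I_(m + n).+1 -> 'M[R]_(m + n))
  (beta : 'I_(m + n).+1 -> vec) (gamma : 'I_(m + n).+1 -> R)
  (kappa : 'I_(m + n).+1 -> {measure set Bvec -> \bar R}) : Prop :=
  (forall j, (alpha j)^T = alpha j) /\
  (forall j (v : vec), 0 <= (v *m alpha j *m v^T) ord0 ord0) /\
  (forall j : 'I_(m + n).+1, (m < j)%N -> alpha j = 0) /\
  (forall j : 'I_(m + n).+1, (j <= m)%N ->
     forall k l : 'I_(m + n), (k < m)%N -> (l < m)%N ->
       ~ (k.+1 = j /\ l.+1 = j) -> alpha j k l = 0) /\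
  (forall j, kappa j (~` stateD0) = 0%E) /\
  (forall j : 'I_(m + n).+1, (m < j)%N -> forall A, measurable A -> kappa j A = 0%E) /\
  (forall j : 'I_(m + n).+1, (j <= m)%N ->
     (\int[kappa j]_(xi in stateD0)
         (\sum_(k < m + n) (trunc xi ord0 k) ^+ 2)%:E < +oo)%E) /\
  (forall j : 'I_(m + n).+1, (j <= m)%N ->
     forall k : 'I_(m + n), (k < m)%N -> k.+1 != j ->
     (\int[kappa j]_(xi in stateD0) (`|trunc xi ord0 k|)%:E < +oo)%E) /\
  (forall j : 'I_(m + n).+1, (m < j)%N ->
     forall k : 'I_(m + n), (k < m)%N -> beta j ord0 k = 0) /\
  (forall j : 'I_(m + n).+1, (j <= m)%N ->
     forall k : 'I_(m + n), (k < m)%N -> k.+1 != j ->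
     0 <= beta j ord0 k - Rintegral (kappa j) stateD0 (fun xi => trunc xi ord0 k)) /\
  (forall j, 0 <= gamma j) /\
  (forall j : 'I_(m + n).+1, (m < j)%N -> gamma j = 0).

(* transition function of a time-homogeneous Markov process on D_Delta,
   encoded by its restriction to D: p t x is a sub-probability on D
   (the defect 1 - p t x D is the mass of the cemetery Delta, which is
   absorbing). *)
Definition transition_function
  (p : R -> vec -> {measure set Bvec -> \bar R}) : Prop :=
  (forall t x, 0 <= t -> stateD x -> (p t x setT <= 1)%E) /\
  (forall t x, 0 <= t -> stateD x -> p t x (~` stateD) = 0%E) /\
  (forall x, stateD x -> forall A : set Bvec, measurable A -> p 0 x A = @dirac _ Bvec x R A) /\
  (forall (t : R) (A : set Bvec), 0 <= t -> measurable A ->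
     measurable_fun stateDB (fun x : Bvec => p t x A)) /\
  (forall s t x (A : set Bvec), 0 <= s -> 0 <= t -> stateD x -> measurable A ->
     p (s + t) x A = (\int[p s x]_(y in stateD) p t y A)%E).

Definition C0D (h : vec -> R) : Prop :=
  {within stateD, continuous h} /\
  (forall e : R, 0 < e -> exists r : R, forall xi, stateD xi -> r < `|xi| -> `|h xi| < e).

(* stochastic continuity: weak convergence on the one-point compactification
   D_Delta, i.e. convergence of integrals of every continuous function on
   D_Delta = constants + C_0(D); since the total mass on D_Delta is 1, this
   amounts to convergence of the integrals over D of every h in C_0(D). *)
Definition stoch_continuous
  (p : R -> vec -> {measure set Bvec -> \bar R}) : Prop :=
  forall t x, 0 <= t -> stateD x -> forall h, C0D h ->
  forall e : R, 0 < e -> exists2 delta : R, 0 < delta &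
    forall s, 0 <= s -> `|s - t| < delta ->
      `|Rintegral (p s x) stateD h - Rintegral (p t x) stateD h| < e.

Definition imag_vec (u : 'I_(m + n) -> R[i]) : Prop := forall k, complex.Re (u k) = 0.

Definition affine_with (p : R -> vec -> {measure set Bvec -> \bar R})
  (psi0 : R -> ('I_(m + n) -> R[i]) -> R[i])
  (psi : R -> ('I_(m + n) -> R[i]) -> 'I_(m + n) -> R[i]) : Prop :=
  forall t u x, 0 <= t -> imag_vec u -> stateD x ->
    cint (p t x) stateD (fun xi => cexp (cdot u xi))
    = cexp (psi0 t u + cdot (psi t u) x).

(* derivative of a real function at t, relative to the set S (one-sided
   at boundary points of intervals) *)
Definition deriv_within (S : set R) (f : R -> R) (t l : R) : Prop :=
  forall e : R, 0 < e -> exists2 delta : R, 0 < delta &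
    forall h : R, h != 0 -> S (t + h) -> `|h| < delta ->
      `|(f (t + h) - f t) / h - l| < e.

Definition cderiv_within (S : set R) (f : R -> R[i]) (t : R) (z : R[i]) : Prop :=
  deriv_within S (fun s => complex.Re (f s)) t (complex.Re z) /\
  deriv_within S (fun s => complex.Im (f s)) t (complex.Im z).

Definition riccati alpha beta gamma kappa
  (psi0 : R -> ('I_(m + n) -> R[i]) -> R[i])
  (psi : R -> ('I_(m + n) -> R[i]) -> 'I_(m + n) -> R[i]) : Prop :=
  forall u, imag_vec u ->
    (forall k, psi 0 u k = u k) /\ psi0 0 u = 0 /\
    forall t, 0 <= t ->
      (forall k, cderiv_within [set s | 0 <= s] (fun s => psi s u k) t
                   (Rfun alpha beta gamma kappa (lift ord0 k) (psi t u))) /\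
      cderiv_within [set s | 0 <= s] (fun s => psi0 s u) t
                   (Rfun alpha beta gamma kappa ord0 (psi t u)).

Definition conservative (p : R -> vec -> {measure set Bvec -> \bar R}) : Prop :=
  forall t x, 0 <= t -> stateD x -> p t x stateD = 1%E.

Definition ext0 (v : 'I_m -> R) : 'I_(m + n) -> R[i] :=
  fun k => match fintype.split k with inl i => (v i)%:C | inr _ => 0 end.

Definition nontrivial_local_solution alpha beta gamma kappa : Prop :=
  exists (T : R) (g : R -> 'I_m -> R),
    0 < T /\
    (forall t, 0 <= t < T -> forall i, g t i <= 0) /\
    (forall i, g 0 i = 0) /\
    (forall t, 0 <= t < T -> forall i : 'I_m,
       cderiv_within [set s | 0 <= s < T] (fun s => (g s i)%:C) t
         (Rfun alpha beta gamma kappa (lift ord0 (lshift n i)) (ext0 (g t)))) /\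
    (exists t, 0 <= t < T /\ exists i, g t i != 0).

End AffineDefs.

(* Main.v *)
(** A conservative process has [psi(t,0) = 0], whence [R(0) = 0]. Solutions of the Riccati
    equations from real negative initial values are not given by the hypotheses, which only
    concern imaginary exponents; they are reached as follows. Integration against
    [k(w) = ((1+iw)(1-iw)^3)^-1] maps [e^{iwy}], [y >= 0], to [c e^{-y}] with [c > 0] (and the
    multiplier [iw] to [-1]), so it turns the characteristic function [w |-> E e^{iw<a,X_t>}]
    into the Laplace transform at [a]. Hence the Laplace transform of a conservative process is
    log-affine in the starting point, its exponent [- flow t a] is a semigroup in [t], and a
    dominated limit under the kernel identifies the right derivative at [t = 0] as [R_I(-a,0)].
    If [g <= 0] solves the Riccati equation from [0], then quasi-monotonicity of [R_I] and
    [R_I(l v) >= l R_I(v)] for [l >= 1] give [g t >= - (1 + t) flow t eps] by comparison, and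
    [eps -> 0] yields [g = 0]. Conversely [psi_I(t,0)] is real and nonpositive and solves the
    Riccati equation; if only the trivial solution exists it vanishes, then so does
    [psi_0(t,0)] because [R_0(0) = 0], and the total mass is one. *)

Require Import Defs.
From HB Require Import structures.
From mathcomp Require Import all_boot all_order all_algebra.
From mathcomp Require Import all_classical all_reals all_analysis.
From mathcomp Require Import measurable_realfun complex.
From mathcomp Require Import ring lra.

Import Order.TTheory GRing.Theory Num.Theory.
Import numFieldNormedType.Exports.

Local Open Scope classical_set_scope.
Local Open Scope ring_scope.
Local Open Scope complex_scope.

(** * The kernel *)

(** The kernel [k] answers two requirements. In the upper half plane, where [e^{iwy}] is bounded for
    [y >= 0], its only pole is the simple one at [w = i]; the integral against [e^{iwy}] is
    therefore a multiple of the value at [w = i], where [iw = -1], and this is why polynomials in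
    [iw] continue to real arguments. The Poisson kernel [1 / (1 + w^2)] has the same pole, but
    characteristic exponents grow like [w^2], and the further factor [(1 - iw)^-2] buys the decay
    that keeps them integrable. Residue calculus is replaced by linear differential equations in
    [y]. Two points are delicate. Differentiating at [t = 0] under the kernel needs a bound
    [C (1 + w^2) t] for all frequencies on one time interval, whereas the Riccati equation yields it
    only for bounded [w]. And [R_I] need not be Lipschitz at [0], which is why non-trivial solutions
    can start there; the comparison gets its strictness from the factor [1 + t], whose derivative
    contributes the positive term [flow t eps]. *)

Section RintegralComplements.
Context d (T : measurableType d) (R : realType) (mu : {measure set T -> \bar R}).

Lemma dominated_integrable_real (f g : T -> R) :
  measurable_fun setT f -> (forall x, `|f x| <= g x) ->
  mu.-integrable setT (EFin \o g) -> mu.-integrable setT (EFin \o f).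
Proof.
move=> mf fg ig; apply: le_integrable ig => //=; first exact/measurable_EFinP.
by move=> x _; rewrite lee_fin (le_trans (fg x))// ler_norm.
Qed.

Lemma Rintegral_dominated_cvg (f_ : nat -> T -> R) (f g : T -> R) :
  (forall n, measurable_fun setT (f_ n)) -> measurable_fun setT f ->
  (forall x, f_ n x @[n --> \oo] --> f x) ->
  (forall n x, `|f_ n x| <= g x) -> mu.-integrable setT (EFin \o g) ->
  Rintegral mu setT (f_ n) @[n --> \oo] --> Rintegral mu setT f.
Proof.
move=> mf_ mf cf fg ig.
have [||||intf _ cvf] := @dominated_convergence _ _ _ mu setT measurableT
  (fun n => EFin \o f_ n) (EFin \o f) (EFin \o g) _ _ _ ig.
- by move=> n; exact/measurable_EFinP.
- exact/measurable_EFinP.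
- by apply: aeW => x _; apply: cvg_EFin; [exact: nearW|exact: cf].
- by apply: aeW => x n _; rewrite lee_fin.
apply: fine_cvg; rewrite fineK//; exact: integrable_fin_num.
Qed.

Lemma measurable_fun_cos (f : T -> R) :
  measurable_fun setT f -> measurable_fun setT (fun t => cos (f t)).
Proof.
move=> mf; apply: measurableT_comp mf.
by apply: continuous_measurable_fun; exact: continuous_cos.
Qed.

Lemma measurable_fun_sin (f : T -> R) :
  measurable_fun setT f -> measurable_fun setT (fun t => sin (f t)).
Proof.
move=> mf; apply: measurableT_comp mf.
by apply: continuous_measurable_fun; exact: continuous_sin.
Qed.

End RintegralComplements.

(** * Oscillatory integrals of rational kernels *)

Section PoissonKernel.
Context {R : realType}.
Local Notation leb := (@lebesgue_measure R).
Implicit Types (w y : R) (A B : R -> R).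

(** The Cauchy density up to the factor [1 / pi]; the common integrable majorant on the line. *)
Definition qinv w : R := (1 + w ^+ 2)^-1.

Lemma oneDsq_gt0 w : 0 < 1 + w ^+ 2.
Proof. by rewrite ltr_pwDl// sqr_ge0. Qed.

Lemma oneDsq_neq0 w : 1 + w ^+ 2 != 0.
Proof. by rewrite gt_eqF// oneDsq_gt0. Qed.

Lemma qinv_gt0 w : 0 < qinv w.
Proof. by rewrite invr_gt0 oneDsq_gt0. Qed.

Lemma qinv_mul w : qinv w * (1 + w ^+ 2) = 1.
Proof. by rewrite mulVf// oneDsq_neq0. Qed.

Lemma is_derive_qinv w : is_derive w 1 qinv (- 2 * w * qinv w ^+ 2).
Proof.
apply: is_derive_eq.
  by apply: is_deriveV; exact: oneDsq_neq0.
by rewrite /qinv /GRing.scale/= -exprVn; ring.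
Qed.

Lemma continuous_qinv : continuous qinv.
Proof.
move=> w; apply: differentiable_continuous; apply/derivable1_diffP.
by have [] := is_derive_qinv w.
Qed.

Lemma continuous_qinvX n : continuous (fun w => qinv w ^+ n).
Proof.
move=> w; apply: (@continuous_comp _ _ _ qinv (fun x => x ^+ n)).
  exact: continuous_qinv.
exact: exprn_continuous.
Qed.

Lemma measurable_qinv : measurable_fun setT qinv.
Proof. exact: continuous_measurable_fun continuous_qinv. Qed.

Lemma integrable_qinv : leb.-integrable setT (EFin \o qinv).
Proof.
apply/integrableP; split; first by apply/measurable_EFinP; exact: measurable_qinv.
under eq_integral do rewrite /= ger0_norm ?(ltW (qinv_gt0 _))//.
rewrite ge0_symfun_integralT//.
- rewrite -set_itvcy integral0y_oneDsqr -EFinM; exact: ltry.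
- by move=> x; rewrite ltW// qinv_gt0.
- exact: continuous_qinv.
- by move=> x; rewrite /qinv /= sqrrN.
Qed.

(** By the fundamental theorem the integral over [[-N, N]] is [F N - F (-N)], which the bound on [F]
    sends to 0; the bound on [f] lets the intervals exhaust the line by dominated convergence. *)
Lemma Rintegral_deriv_eq0 (F f : R -> R) (C : R) :
  (forall w, is_derive w 1 F (f w)) -> continuous f ->
  (forall w, `|f w| <= C * qinv w) -> (forall w, `|F w| <= C * qinv w) ->
  Rintegral leb setT f = 0.
Proof.
move=> dF cf fb Fb.
have mf : measurable_fun setT f by exact: continuous_measurable_fun.
have iC : leb.-integrable setT (EFin \o (fun w => C * qinv w)).
  by apply: (integrableZl _ C integrable_qinv).
have C0 : 0 <= C.
  by have := le_trans (normr_ge0 _) (fb 0); rewrite pmulr_lge0// qinv_gt0.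
pose I (n : nat) := `[- n.+1%:R, n.+1%:R]%classic : set R.
have /= cvI := @Rintegral_dominated_cvg _ _ R leb (fun n => f \_ (I n)) f
   (fun w => C * qinv w) _ mf _ _ iC.
have E n : Rintegral leb setT (f \_ (I n)) = F n.+1%:R - F (- n.+1%:R).
  rewrite -Rintegral_mkcond /Rintegral (@continuous_FTC2 _ f F).
  - by rewrite -EFinB.
  - by rewrite gtrN// ltr0n.
  - exact: continuous_subspaceT.
  - have cF : continuous F.
      move=> w; apply: differentiable_continuous; apply/derivable1_diffP.
      by have [] := dF w.
    split.
    + by move=> w _; have [] := dF w.
    + by apply: cvg_at_right_filter; exact: cF.
    + by apply: cvg_at_left_filter; exact: cF.
  - by move=> w _; rewrite derive1E; have [_ ->] := dF w.
apply: (cvg_unique _ (cvI _ _ _)) => //.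
- move=> n; apply/(measurable_restrictT f); first exact: measurable_itv.
  exact: measurable_funTS.
- move=> w; apply: cvg_near_cst; near=> n.
  rewrite patchE ifT// inE /I/= in_itv/= -ler_norml.
  near: n; exists (Num.truncn `|w|) => //= n wn.
  apply/ltW/(lt_le_trans (truncnS_gt _)); rewrite ?ler_nat ?ltnS//.
- move=> n w; rewrite patchE; case: ifP => _ //; rewrite normr0.
  by rewrite mulr_ge0// ltW// qinv_gt0.
rewrite /mkset; under eq_fun do rewrite E.
apply: (@squeeze_cvgr _ _ _ _ (fun n => - (2 * C * n.+1%:R^-1)) (fun n => 2 * C * n.+1%:R^-1)).
- near=> n; rewrite -ler_norml (le_trans (ler_normB _ _))//.
  have Q (w : R) : w ^+ 2 = n.+1%:R ^+ 2 -> C * qinv w <= C * n.+1%:R^-1.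
    rewrite /qinv => ->; rewrite ler_wpM2l// lef_pV2 ?posrE ?ltr_pwDl ?sqr_ge0 ?ltr0n//.
    by rewrite (@le_trans _ _ (n.+1%:R ^+ 2))// ?lerDr// expr2 ler_peMl ?ler1n.
  have := lerD (le_trans (Fb n.+1%:R) (Q _ erefl)) (le_trans (Fb (- n.+1%:R)) (Q _ (sqrrN _))).
  by move/le_trans; apply; rewrite -[2 * C * _]mulrA mulr_natl mulr2n.
- rewrite -oppr0; apply: cvgN; rewrite -(mulr0 (2 * C)); apply: cvgMr => //.
  exact: cvg_harmonic.
- rewrite -(mulr0 (2 * C)); apply: cvgMr => //; exact: cvg_harmonic.
Unshelve. all: by end_near. Qed.

(** The real part of the integral of [(A + iB)(w) e^{iwy}] in [w]. *)
Definition osc A B y : R :=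
  Rintegral leb setT (fun w => A w * cos (w * y) - B w * sin (w * y)).

Lemma normr_trig_comb (a b x : R) : `|a * cos x - b * sin x| <= `|a| + `|b|.
Proof.
rewrite (le_trans (ler_normB _ _))// !normrM lerD//.
  by rewrite ler_piMr// ler_norml cos_geN1 cos_le1.
by rewrite ler_piMr// ler_norml sin_geN1 sin_le1.
Qed.

Lemma measurable_trig_comb A B y : measurable_fun setT A -> measurable_fun setT B ->
  measurable_fun setT (fun w => A w * cos (w * y) - B w * sin (w * y)).
Proof.
move=> mA mB; apply: measurable_funB; apply: measurable_funM => //.
  by apply: measurable_fun_cos; exact: measurable_funM.
by apply: measurable_fun_sin; exact: measurable_funM.
Qed.

Section Oscillatory.
Variables (A B : R -> R) (C : R).
Hypotheses (mA : measurable_fun setT A) (mB : measurable_fun setT B).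
Hypothesis AB : forall w, `|A w| + `|B w| <= C * qinv w.

Lemma integrable_Cqinv : leb.-integrable setT (EFin \o (fun w => C * qinv w)).
Proof. by apply: (integrableZl _ C integrable_qinv). Qed.

Lemma integrable_osc y :
  leb.-integrable setT (EFin \o (fun w => A w * cos (w * y) - B w * sin (w * y))).
Proof.
apply: dominated_integrable_real integrable_Cqinv; first exact: measurable_trig_comb.
by move=> w; apply: le_trans (normr_trig_comb _ _ _) (AB w).
Qed.

Lemma normr_osc_le y : `|osc A B y| <= C * Rintegral leb setT qinv.
Proof.
rewrite (le_trans (le_normr_Rintegral _ (integrable_osc y)))//.
rewrite -RintegralZl//; last exact: integrable_qinv.
apply: le_Rintegral => //; [|exact: integrable_Cqinv|].
- by have := integrable_norm (integrable_osc y); apply: eq_integrable => // w _.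
- by move=> w _; apply: le_trans (normr_trig_comb _ _ _) (AB w).
Qed.

Lemma continuous_osc : continuous (osc A B).
Proof.
move=> y; have := @continuity_under_integral R _ _ leb
  (fun y w => A w * cos (w * y) - B w * sin (w * y)) setT measurableT
  (y - 1) (y + 1) _ _ (fun w => C * qinv w) integrable_Cqinv _ y; apply.
- by move=> x _; exact: integrable_osc.
- apply: aeW => w _ x _; apply: cvgB; apply: cvgMr.
    by apply: continuous_comp; [exact: mulrl_continuous|exact: continuous_cos].
  by apply: continuous_comp; [exact: mulrl_continuous|exact: continuous_sin].
- by move=> x _; apply: aeW => w _; apply: le_trans (normr_trig_comb _ _ _) (AB w).
- by rewrite inE/= in_itv/= ltrDl ltrBlDr ltrDl ltr01.
Qed.

Lemma is_derive_trig_comb (a b w y : R) :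
  is_derive y 1 (fun y => a * cos (w * y) - b * sin (w * y))
    ((- w * b) * cos (w * y) - (w * a) * sin (w * y)).
Proof.
have dl : is_derive y (1 : R) (fun y => w * y) w.
  by apply: is_derive_eq; rewrite /GRing.scale/= mulr1.
have dc := is_derive1_comp (is_derive_cos (w * y)) dl.
have ds := is_derive1_comp (is_derive_sin (w * y)) dl.
rewrite (_ : (fun y => _) = a *: (cos \o *%R w) - b *: (sin \o *%R w))//.
by apply: is_derive_eq; rewrite /GRing.scale/=; ring.
Qed.

(** Differentiating under the integral multiplies the kernel by [iw], and
    [iw (A + iB) = - wB + i wA]; the hypothesis is the domination of the differentiated
    integrand. *)
Lemma is_derive_osc y : (forall w, `|w * A w| + `|w * B w| <= C * qinv w) ->
  is_derive y 1 (osc A B) (osc (fun w => - w * B w) (fun w => w * A w) y).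
Proof.
move=> wAB.
pose f y w := A w * cos (w * y) - B w * sin (w * y).
have df (x : R) w : is_derive x 1 (f ^~ w) ((- w * B w) * cos (w * x) - (w * A w) * sin (w * x)).
  exact: is_derive_trig_comb.
have Iy : `]y - 1, y + 1[%classic y.
  by rewrite /= in_itv/= ltrDl ltrBlDr ltrDl ltr01.
have If x : `]y - 1, y + 1[%classic x -> leb.-integrable setT (EFin \o f x).
  by move=> _; exact: integrable_osc.
have Df x w : `]y - 1, y + 1[%classic x -> setT w -> derivable (f ^~ w) x 1.
  by move=> _ _; have [] := df x w.
have C0 w : 0 <= C * qinv w by rewrite (le_trans _ (AB w))// addr_ge0.
have Ef x w : partial1of2 f x w = (- w * B w) * cos (w * x) - (w * A w) * sin (w * x).
  by rewrite partial1of2E; have [_ ->] := df x w.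
have Bf x w : `]y - 1, y + 1[%classic x -> setT w -> `|partial1of2 f x w| <= C * qinv w.
  move=> _ _; rewrite Ef (le_trans (normr_trig_comb _ _ _))// mulNr normrN.
  by rewrite addrC wAB.
have D := derivable_under_integral measurableT Iy If Df C0 integrable_Cqinv Bf.
have E := differentiation_under_integral measurableT Iy If Df C0 integrable_Cqinv Bf.
apply: DeriveDef; first exact: D.
by rewrite -derive1E E; apply: eq_Rintegral => w _; rewrite Ef.
Qed.

End Oscillatory.

(* [A2 + i B2 = (1 - i w)^-2], [A3 + i B3 = (1 - i w)^-3] and
   [Ak + i Bk = ((1 + i w) (1 - i w)^3)^-1]. *)
Definition A2 w : R := (1 - w ^+ 2) * qinv w ^+ 2.
Definition B2 w : R := 2 * w * qinv w ^+ 2.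
Definition A3 w : R := (1 - 3 * w ^+ 2) * qinv w ^+ 3.
Definition B3 w : R := (3 * w - w ^+ 3) * qinv w ^+ 3.
Definition Ak w : R := (1 - w ^+ 2) * qinv w ^+ 3.
Definition Bk w : R := 2 * w * qinv w ^+ 3.

(** The identity behind this lemma and the next is [d/dw (1 - iw)^-2 = 2i (1 - iw)^-3]. *)
Lemma is_derive_A2 w : is_derive w 1 A2 (- 2 * B3 w).
Proof.
have dq := is_derive_qinv w.
rewrite (_ : A2 = (cst 1 - (fun w : R => w ^+ 2)) * (fun w => qinv w ^+ 2)); last exact/funext.
apply: is_derive_eq; rewrite /GRing.scale/= /B3 /qinv.
rewrite !fctE; field; exact: oneDsq_neq0.
Qed.

Lemma is_derive_B2 w : is_derive w 1 B2 (2 * A3 w).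
Proof.
have dq := is_derive_qinv w.
rewrite (_ : B2 = (cst 2 * (@id R)) * (fun w => qinv w ^+ 2)); last exact/funext.
apply: is_derive_eq; rewrite /GRing.scale/= /A3 /qinv.
rewrite !fctE; field; exact: oneDsq_neq0.
Qed.

Lemma continuous_of_is_derive (f f' : R -> R) :
  (forall w, is_derive w 1 f (f' w)) -> continuous f.
Proof.
move=> df w; apply: differentiable_continuous; apply/derivable1_diffP.
by have [] := df w.
Qed.

Lemma measurable_kernels : [/\ measurable_fun setT A2, measurable_fun setT B2,
  measurable_fun setT A3, measurable_fun setT B3 &
  measurable_fun setT Ak /\ measurable_fun setT Bk].
Proof.
have mq k : measurable_fun setT (fun w => qinv w ^+ k).
  by apply: measurable_funX; exact: measurable_qinv.
have m0 k : measurable_fun setT (fun w : R => w ^+ k) by exact: measurable_funX.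
by split=> //; [| | | |split]; apply: measurable_funM => //;
  try (apply: measurable_funB => //); try exact: measurable_funM.
Qed.

(** With [q = qinv w] the three kernels have squared moduli [q^2], [q^3] and [q^4], and [|x| + |y|]
    is at most twice the modulus of [x + iy]. The modulus [q^2] of the third kernel is what later
    absorbs quadratic growth. *)
Lemma normr_kernel_le w : [/\ `|A2 w| + `|B2 w| <= 2 * qinv w,
  `|A3 w| + `|B3 w| <= 2 * qinv w, `|w * A3 w| + `|w * B3 w| <= 2 * qinv w,
  `|Ak w| + `|Bk w| <= 2 * qinv w ^+ 2 & `|w * Ak w| + `|w * Bk w| <= 2 * qinv w].
Proof.
have q0 := qinv_gt0 w; have qw := qinv_mul w.
have H (x y c : R) : 0 <= c -> x ^+ 2 <= c ^+ 2 -> y ^+ 2 <= c ^+ 2 -> `|x| + `|y| <= 2 * c.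
  move=> c0 xc yc; rewrite mulr_natl mulr2n lerD//.
    by rewrite -[leRHS]ger0_norm// -ler_sqr ?nnegrE// !real_normK ?num_real.
  by rewrite -[leRHS]ger0_norm// -ler_sqr ?nnegrE// !real_normK ?num_real.
have e1 : w ^+ 2 * qinv w = 1 - qinv w by rewrite -qw; ring.
set q := qinv w in q0 qw e1 *; set v := w ^+ 2 in e1.
have q1 : q <= 1 by rewrite invf_le1 ?oneDsq_gt0// lerDl sqr_ge0.
have v0 : 0 <= v by exact: sqr_ge0.
have E2 : A2 w ^+ 2 + B2 w ^+ 2 = q ^+ 2.
  by rewrite /A2 /B2 /q /qinv; field; exact: oneDsq_neq0.
have E3 : A3 w ^+ 2 + B3 w ^+ 2 = q ^+ 3.
  by rewrite /A3 /B3 /q /qinv; field; exact: oneDsq_neq0.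
have Ek : Ak w ^+ 2 + Bk w ^+ 2 = q ^+ 4.
  by rewrite /Ak /Bk /q /qinv; field; exact: oneDsq_neq0.
have q32 : q ^+ 3 <= q ^+ 2 by rewrite exprS ler_piMl// sqr_ge0.
have q43 : q ^+ 4 <= q ^+ 3 by rewrite exprS ler_piMl// exprn_ge0// ltW.
have vq3 : v * q ^+ 3 <= q ^+ 2.
  by rewrite exprS mulrA e1 ler_piMl ?sqr_ge0// gerBl ltW.
have vq4 : v * q ^+ 4 <= q ^+ 2.
  by apply: le_trans vq3; rewrite ler_wpM2l.
have qq : 0 <= q by exact: ltW.
split; apply: H; rewrite ?exprn_ge0//.
- by rewrite -E2 lerDl sqr_ge0.
- by rewrite -E2 lerDr sqr_ge0.
- by apply: le_trans q32; rewrite -E3 lerDl sqr_ge0.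
- by apply: le_trans q32; rewrite -E3 lerDr sqr_ge0.
- by rewrite exprMn; apply: le_trans vq3; rewrite -E3 ler_wpM2l// lerDl sqr_ge0.
- by rewrite exprMn; apply: le_trans vq3; rewrite -E3 ler_wpM2l// lerDr sqr_ge0.
- by rewrite -exprM -/q -Ek lerDl sqr_ge0.
- by rewrite -exprM -/q -Ek lerDr sqr_ge0.
- by rewrite exprMn; apply: le_trans vq4; rewrite -Ek ler_wpM2l// lerDl sqr_ge0.
- by rewrite exprMn; apply: le_trans vq4; rewrite -Ek ler_wpM2l// lerDr sqr_ge0.
Qed.

Lemma normr_kernel_lin w : `|Ak w| + `|Bk w| <= 2 * qinv w.
Proof.
have [_ _ _ /le_trans bk _] := normr_kernel_le w; apply: bk.
rewrite ler_wpM2l// expr2 ler_piMl ?(ltW (qinv_gt0 _))//.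
by rewrite invf_le1 ?oneDsq_gt0// lerDl sqr_ge0.
Qed.

Lemma oscD A B A' B' C y : measurable_fun setT A -> measurable_fun setT B ->
  measurable_fun setT A' -> measurable_fun setT B' ->
  (forall w, `|A w| + `|B w| <= C * qinv w) ->
  (forall w, `|A' w| + `|B' w| <= C * qinv w) -> forall a b : R,
  osc (fun w => a * A w + b * A' w) (fun w => a * B w + b * B' w) y =
  a * osc A B y + b * osc A' B' y.
Proof.
move=> mA mB mA' mB' AB AB' a b; rewrite /osc.
have I := @integrable_osc A B C mA mB AB y.
have I' := @integrable_osc A' B' C mA' mB' AB' y.
rewrite -!RintegralZl//.
rewrite -RintegralD//.
- by apply: eq_Rintegral => w _; ring.
- exact: (integrableZl _ a I).
- exact: (integrableZl _ b I').
Qed.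

(** Integration by parts: [(1 - iw)^-2 e^{iwy}] vanishes at infinity, so its derivative [i (y (1 -
    iw)^-2 + 2 (1 - iw)^-3) e^{iwy}] integrates to 0. In real form the primitive [F] is its
    imaginary part. *)
Lemma by_parts23 y : y * osc A2 B2 y + 2 * osc A3 B3 y = 0.
Proof.
have [mA2 mB2 mA3 mB3 _] := measurable_kernels.
rewrite -(@oscD _ _ _ _ 2)//; first last.
- by move=> w; have [] := normr_kernel_le w.
- by move=> w; have [] := normr_kernel_le w.
pose F w := A2 w * sin (w * y) + B2 w * cos (w * y).
rewrite /osc; apply: (@Rintegral_deriv_eq0 F _ ((`|y| + 2) * 2)).
- move=> w.
  have dl : is_derive w (1 : R) (fun w => w * y) y.
    rewrite (_ : (fun w => w * y) = (fun w => y * w)).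
      by apply: is_derive_eq; rewrite /GRing.scale/= mulr1.
    by apply/funext => z; rewrite mulrC.
  have dc := @is_derive1_comp _ cos ( *%R^~ y) w _ _ (is_derive_cos (w * y)) dl.
  have ds := @is_derive1_comp _ sin ( *%R^~ y) w _ _ (is_derive_sin (w * y)) dl.
  have dA := is_derive_A2 w; have dB := is_derive_B2 w.
  rewrite (_ : F = A2 * (sin \o *%R^~ y) + B2 * (cos \o *%R^~ y))//.
  by apply: is_derive_eq; rewrite /GRing.scale/=; ring.
- have c2 := continuous_of_is_derive _ _ is_derive_A2.
  have d2 := continuous_of_is_derive _ _ is_derive_B2.
  have cX n : continuous (fun w : R => w ^+ n) by exact: exprn_continuous.
  have cQ := continuous_qinvX.
  have c3 : continuous A3.
    move=> w; apply: cvgM; last exact: cQ.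
    by apply: cvgB; [exact: cvg_cst|apply: cvgMr; exact: cX].
  have d3 : continuous B3.
    move=> w; apply: cvgM; last exact: cQ.
    by apply: cvgB; [apply: cvgMr; exact: cvg_id|exact: cX].
  move=> w; apply: cvgB; apply: cvgM.
  + by apply: cvgD; apply: cvgMr; [exact: c2|exact: c3].
  + by apply: continuous_comp; [exact: mulrr_continuous|exact: continuous_cos].
  + by apply: cvgD; apply: cvgMr; [exact: d2|exact: d3].
  + by apply: continuous_comp; [exact: mulrr_continuous|exact: continuous_sin].
- move=> w; rewrite (le_trans (normr_trig_comb _ _ _))//.
  have [h2 h3 _ _ _] := normr_kernel_le w.
  rewrite (@le_trans _ _ (`|y| * (`|A2 w| + `|B2 w|) + 2 * (`|A3 w| + `|B3 w|)))//.
    have := ler_normD (y * A2 w) (2 * A3 w); have := ler_normD (y * B2 w) (2 * B3 w).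
    by rewrite !normrM (ger0_norm (ler0n R 2)); lra.
  rewrite [leRHS](_ : _ = `|y| * (2 * qinv w) + 2 * (2 * qinv w)); last by ring.
  by rewrite lerD// ler_wpM2l.
- move=> w; rewrite /F addrC -[A2 w]opprK mulNr (le_trans (normr_trig_comb _ _ _))//.
  rewrite normrN addrC; have [h2 _ _ _ _] := normr_kernel_le w.
  rewrite (le_trans h2)// ler_wpM2r ?(ltW (qinv_gt0 _))//.
  by have := normr_ge0 y; lra.
Qed.

Lemma osc_ext A B A' B' y : A =1 A' -> B =1 B' -> osc A B y = osc A' B' y.
Proof. by move=> AA BB; apply: eq_Rintegral => w _; rewrite AA BB. Qed.

(** Writing [iw = 1 - (1 - iw)] reduces [iw (1 - iw)^-3] to [(1 - iw)^-3 - (1 - iw)^-2], so the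
    derivative stays within the family of kernels. *)
Lemma is_derive_osc3 y :
  is_derive y 1 (osc A3 B3) (osc A3 B3 y - osc A2 B2 y).
Proof.
have [mA2 mB2 mA3 mB3 _] := measurable_kernels.
have b2 w : `|A2 w| + `|B2 w| <= 2 * qinv w by have [] := normr_kernel_le w.
have b3 w : `|A3 w| + `|B3 w| <= 2 * qinv w by have [] := normr_kernel_le w.
have := is_derive_osc A3 B3 2 mA3 mB3 b3 y.
have -> : osc (fun w => - w * B3 w) (fun w => w * A3 w) y = osc A3 B3 y - osc A2 B2 y.
  rewrite -[osc A3 B3 y]mul1r -mulN1r -(@oscD _ _ _ _ 2)//.
  by apply: osc_ext => w; rewrite /A2 /B2 /A3 /B3 /qinv; field; exact: oneDsq_neq0.
by apply=> w; have [] := normr_kernel_le w.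
Qed.

(** Writing [iw = (1 + iw) - 1] cancels the factor [1 + iw] of the kernel:
    [iw k = (1 - iw)^-3 - k]. *)
Lemma is_derive_osck y :
  is_derive y 1 (osc Ak Bk) (osc A3 B3 y - osc Ak Bk y).
Proof.
have [_ _ mA3 mB3 [mAk mBk]] := measurable_kernels.
have b3 w : `|A3 w| + `|B3 w| <= 2 * qinv w by have [] := normr_kernel_le w.
have bk := normr_kernel_lin.
have := is_derive_osc Ak Bk 2 mAk mBk bk y.
have -> : osc (fun w => - w * Bk w) (fun w => w * Ak w) y = osc A3 B3 y - osc Ak Bk y.
  rewrite -[osc A3 B3 y]mul1r -mulN1r -(@oscD _ _ _ _ 2)//.
  by apply: osc_ext => w; rewrite /Ak /Bk /A3 /B3 /qinv; field; exact: oneDsq_neq0.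
by apply=> w; have [] := normr_kernel_le w.
Qed.

(* For [y > 0] the two relations give [y J' = (y + 2) J] for [J = osc A3 B3], so
   [J y = c y^2 e^y]; boundedness leaves only [c = 0]. *)
Lemma osc3_eq0 y : 0 <= y -> osc A3 B3 y = 0.
Proof.
have [mA2 mB2 mA3 mB3 _] := measurable_kernels.
have b3 w : `|A3 w| + `|B3 w| <= 2 * qinv w by have [] := normr_kernel_le w.
pose J := osc A3 B3.
(* [G] is [y^-2 e^{-y} J y] at [y = e^s]; the substitution maps the whole line onto [y > 0], so that
   a vanishing derivative makes [G] constant. *)
pose G s := J (expR s) * expR (- expR s - 2 * s).
have dG (s : R) : is_derive s 1 G 0.
  have dJ := is_derive1_comp (is_derive_osc3 (expR s)) (is_derive_expR s).
  have dl : is_derive s (1 : R) (fun s => - expR s - 2 * s) (- expR s - 2).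
    by apply: is_derive_eq; rewrite /GRing.scale/= mulr1.
  have dE := @is_derive1_comp _ expR (fun s => - expR s - 2 * s) s _ _ (is_derive_expR _) dl.
  rewrite (_ : G = (J \o expR) * (expR \o (fun s => - expR s - 2 * s)))//.
  apply: is_derive_eq; rewrite /GRing.scale/= -/J.
  have := by_parts23 (expR s); rewrite -/J; set E2 := osc A2 B2 _ => h.
  rewrite [LHS](_ : _ = - expR (- expR s - 2 * s) * (expR s * E2 + 2 * J (expR s))).
    by rewrite h mulr0.
  by ring.
pose K := 2 * Rintegral leb setT qinv.
have J0 z : 0 < z -> J z = 0.
  move=> z0.
  have Gc s : G s = G 0 by exact: is_derive_0_is_cst.
  have Jb x : 0 < x -> `|G 0| * expR (x + 2 * ln x) <= K.
    move=> x0; rewrite -(Gc (ln x)) /G lnK ?posrE// normrM.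
    rewrite (ger0_norm (expR_ge0 _)) -mulrA -expRD.
    rewrite (_ : - x - 2 * ln x + (x + 2 * ln x) = 0); last by ring.
    by rewrite expR0 mulr1; exact: normr_osc_le.
  have G0 : G 0 = 0.
    apply/eqP/negP => /negP; rewrite -normr_gt0 => g0.
    have K0 : 0 <= K by rewrite (le_trans _ (Jb 1 ltr01))// mulr_ge0// expR_ge0.
    (* At this point [x], [|G 0| e^x >= |G 0| (1 + x) = K + 2 |G 0|] exceeds the bound [K]; [x >= 1]
       keeps [ln x] nonnegative. *)
    have x1 : 1 <= K / `|G 0| + 1 by rewrite lerDr divr_ge0// ltW.
    have := Jb (K / `|G 0| + 1) (lt_le_trans ltr01 x1).
    have := expR_ge1Dx (K / `|G 0| + 1 + 2 * ln (K / `|G 0| + 1)).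
    have := ln_ge0 x1; set l := ln _ => l0 h1 h2.
    have : `|G 0| * (K / `|G 0| + 2) <= K.
      apply: le_trans h2; rewrite ler_wpM2l// (le_trans _ h1)//; lra.
    rewrite mulrDr mulrCA divff ?gt_eqF// mulr1; lra.
  have := Gc (ln z); rewrite G0 /G lnK ?posrE// => /eqP.
  by rewrite mulf_eq0 (gt_eqF (expR_gt0 _)) orbF => /eqP.
rewrite le_eqVlt => /predU1P[<-|]; last exact: J0.
have cJ : continuous J := continuous_osc A3 B3 2 mA3 mB3 b3.
apply: (cvg_unique _ (cvg_at_right_filter (cJ 0))) => //.
apply: cvg_near_cst; near=> x; apply: J0; near: x; exact: nbhs_right_gt.
Unshelve. all: by end_near. Qed.

(** The relation from integration by parts settles [y > 0]; it degenerates at [y = 0], where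
    continuity takes over. *)
Lemma osc2_eq0 y : 0 <= y -> osc A2 B2 y = 0.
Proof.
have [mA2 mB2 mA3 mB3 _] := measurable_kernels.
have b2 w : `|A2 w| + `|B2 w| <= 2 * qinv w by have [] := normr_kernel_le w.
have J0 z : 0 < z -> osc A2 B2 z = 0.
  move=> z0; have := by_parts23 z; rewrite osc3_eq0 ?(ltW z0)// mulr0 addr0.
  by move/eqP; rewrite mulf_eq0 gt_eqF//= => /eqP.
rewrite le_eqVlt => /predU1P[<-|]; last exact: J0.
have cJ : continuous (osc A2 B2) := continuous_osc A2 B2 2 mA2 mB2 b2.
apply: (cvg_unique _ (cvg_at_right_filter (cJ 0))) => //.
apply: cvg_near_cst; near=> x; apply: J0; near: x; exact: nbhs_right_gt.
Unshelve. all: by end_near. Qed.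

(** Its value, by residues, is [pi / 4]. *)
Definition poisson_const : R := osc Ak Bk 0.

(** Since [osc A3 B3] vanishes on the half-line, the derivative formula for [H = osc Ak Bk] reads
    [H' = - H] there. *)
Lemma osck_eq y : 0 <= y -> osc Ak Bk y = poisson_const * expR (- y).
Proof.
have [_ _ _ _ [mAk mBk]] := measurable_kernels.
have cH := continuous_of_is_derive _ _ is_derive_osck.
pose G s := osc Ak Bk (expR s) * expR (expR s).
have dG (s : R) : is_derive s 1 G 0.
  have dJ := is_derive1_comp (is_derive_osck (expR s)) (is_derive_expR s).
  have dE := is_derive1_comp (is_derive_expR (expR s)) (is_derive_expR s).
  rewrite (_ : G = (osc Ak Bk \o expR) * (expR \o expR))//.
  apply: is_derive_eq; rewrite /GRing.scale/= osc3_eq0 ?expR_ge0//; ring.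
have Gc s : G s = G 0 by exact: is_derive_0_is_cst.
have H0 z : 0 < z -> osc Ak Bk z * expR z = G 0.
  by move=> z0; rewrite -(Gc (ln z)) /G lnK ?posrE.
have cE : osc Ak Bk z * expR z @[z --> 0^'+] --> poisson_const * expR 0.
  apply: cvgM; apply: cvg_at_right_filter; [exact: cH|exact: continuous_expR].
have E : poisson_const = G 0.
  rewrite -[LHS]mulr1 -expR0; apply: (cvg_unique _ cE) => //.
  by apply: cvg_near_cst; near=> x; apply: H0; near: x; exact: nbhs_right_gt.
rewrite le_eqVlt => /predU1P[<-|y0]; first by rewrite oppr0 expR0 mulr1.
by rewrite E -(H0 y y0) -mulrA -expRD subrr expR0 mulr1.
Unshelve. all: by end_near. Qed.

(** [Ak] changes sign, so positivity is not pointwise. But [2 Ak = A3 + qinv^2], and [A3] is the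
    derivative of [w qinv^2], hence has integral 0; what remains is half the integral of
    [qinv^2]. *)
Lemma poisson_const_gt0 : 0 < poisson_const.
Proof.
have [_ _ _ _ [mAk mBk]] := measurable_kernels.
have mq k : measurable_fun setT (fun w => qinv w ^+ k).
  by apply: measurable_funX; exact: measurable_qinv.
have q1 w : qinv w <= 1 by rewrite invf_le1 ?oneDsq_gt0// lerDl sqr_ge0.
have q0 w : 0 <= qinv w := ltW (qinv_gt0 w).
pose f w : R := (1 - 3 * w ^+ 2) * qinv w ^+ 3.
have fb w : `|f w| <= 2 * qinv w.
  rewrite -[f w]/(A3 w); have [_ h _ _ _] := normr_kernel_le w.
  by apply: le_trans h; rewrite lerDl.
have If : Rintegral leb setT f = 0.
  apply: (@Rintegral_deriv_eq0 (fun w => w * qinv w ^+ 2) _ 2) => //.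
  - move=> w; have dq := is_derive_qinv w.
    rewrite (_ : (fun w => _) = (@id R) * (fun w => qinv w ^+ 2))//.
    apply: is_derive_eq; rewrite /GRing.scale/= /f /qinv; field; exact: oneDsq_neq0.
  - move=> w; apply: cvgM.
      by apply: cvgB; [exact: cvg_cst|apply: cvgMr; exact: exprn_continuous].
    exact: continuous_qinvX.
  - move=> w; have [h _ _ _ _] := normr_kernel_le w.
    apply: le_trans h; apply: (@le_trans _ _ (`|B2 w|)); last by rewrite lerDr.
    by rewrite /B2 -mulrA [leRHS]normrM ler_peMl// ger0_norm// ler1n.
have iq2 : leb.-integrable setT (EFin \o (fun w => qinv w ^+ 2)).
  apply: dominated_integrable_real integrable_qinv; first exact: (mq 2).
  move=> w.
  by rewrite ger0_norm ?exprn_ge0// expr2 ler_piMl.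
have iF : leb.-integrable setT (EFin \o f).
  apply: dominated_integrable_real (integrable_Cqinv 2) => //.
  by have [] := measurable_kernels.
have -> : poisson_const = 2^-1 * Rintegral leb setT (fun w => qinv w ^+ 2).
  rewrite -[RHS]add0r -[X in X + _](mulr0 2^-1) -{1}If -!RintegralZl//.
  rewrite -RintegralD//.
  - apply: eq_Rintegral => w _; rewrite !mulr0 cos0 sin0 mulr0 subr0 mulr1.
    by rewrite /Ak /f /qinv; field; exact: oneDsq_neq0.
  - exact: (integrableZl _ 2^-1 iF).
  - exact: (integrableZl _ 2^-1 iq2).
rewrite mulr_gt0//.
pose g := (cst (2^-1 ^+ 2 : R)) \_ `[(0:R), 1].
have gm : measurable_fun setT g.
  by apply/(measurable_restrictT (cst _)); [exact: measurable_itv|exact: measurable_cst].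
have g0 w : 0 <= g w.
  by rewrite /g patchE; case: ifP => _ //; rewrite exprn_ge0.
have gq w : g w <= qinv w ^+ 2.
  rewrite /g patchE; case: ifP; rewrite ?exprn_ge0// inE/= in_itv/= => /andP[w0 w1].
  rewrite ler_sqr ?nnegrE// lef_pV2 ?posrE ?oneDsq_gt0//.
  by rewrite -[leRHS]/(1 + 1) lerD2l expr_le1.
apply: (@lt_le_trans _ _ (Rintegral leb setT g)); last first.
  have ig : leb.-integrable setT (EFin \o g).
    apply: dominated_integrable_real iq2; first exact: gm.
    by move=> w; rewrite (ger0_norm (g0 w)).
  by apply: (le_Rintegral measurableT ig iq2).
rewrite -Rintegral_mkcond Rintegral_cst//= lebesgue_measure_itv/= lte_fin ltr01/=.
by rewrite subr0 mulr1 exprn_gt0.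
Qed.

End PoissonKernel.

#[global] Opaque poisson_const.

(** * Laplace transforms from characteristic functions *)

(** The infimum of the failures satisfies [P] by the limit clause, and the step clause then moves
    all failures strictly beyond it. It serves comparisons whose differential estimate is valid only
    while the compared bound holds. *)
Lemma real_induction (R : realType) (T : R) (P : R -> Prop) :
  P 0 ->
  (forall t, 0 < t < T -> (forall s, 0 <= s < t -> P s) -> P t) ->
  (forall t, 0 <= t < T -> (forall s, 0 <= s <= t -> P s) ->
    exists2 d, 0 < d & forall s, t < s < t + d -> s < T -> P s) ->
  forall t, 0 <= t < T -> P t.
Proof.
move=> P0 Plim Pstep t0 t0T; apply: contrapT => nP.
pose S := [set t | 0 <= t < T /\ ~ P t].
have S0 : S !=set0 by exists t0.
have hS : has_inf S by split=> //; exists 0 => t -[/andP[]].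
set tau := inf S.
have tau0 : 0 <= tau by apply: lb_le_inf => // t -[/andP[]].
have tauT : tau < T.
  apply: le_lt_trans (_ : tau <= t0) _; last by case/andP: t0T.
  by apply: ge_inf => //; exact: hS.2.
have Pb s : 0 <= s < tau -> P s.
  move=> /andP[s0 st]; apply: contrapT => nPs.
  have : S s by split=> //; rewrite s0 (lt_trans st).
  by move/(ge_inf hS.2); rewrite leNgt st.
have Pt : P tau.
  move: tau0; rewrite le_eqVlt => /predU1P[<-//|tau0].
  by apply: Plim => //; rewrite tau0.
have [||d d0 Pd] := Pstep tau; first by rewrite tau0.
  by move=> s /andP[s0]; rewrite le_eqVlt => /predU1P[->//|st]; apply: Pb; rewrite s0.
have : tau + d <= inf S.
  apply: lb_le_inf => // t St; rewrite leNgt; apply/negP => td.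
  have tt : tau <= t by apply: ge_inf => //; exact: hS.2.
  case: St => /andP[t1 tT]; apply.
  move: tt; rewrite le_eqVlt => /predU1P[<-//|tt].
  by apply: Pd => //; rewrite tt.
by rewrite leNgt ltrDl d0.
Qed.

(** * Fubini under a product bound *)

Section Fubini.
Context d1 d2 (T1 : measurableType d1) (T2 : measurableType d2) (R : realType).

(** The product bound supplies every integrability that Fubini asks for. The second conclusion is
    also the source of measurability for integrals depending on a parameter. *)
Lemma fubini_dominated_sigma_finite (m1 : {sigma_finite_measure set T1 -> \bar R})
    (m2 : {sigma_finite_measure set T2 -> \bar R}) (f : T1 * T2 -> R)
    (A : T1 -> R) (B : T2 -> R) :
  measurable_fun setT f -> (forall x y, `|f (x, y)| <= A x * B y) ->
  m1.-integrable setT (EFin \o A) -> m2.-integrable setT (EFin \o B) ->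
  (Rintegral m1 setT (fun x => Rintegral m2 setT (fun y => f (x, y))) =
   Rintegral m2 setT (fun y => Rintegral m1 setT (fun x => f (x, y)))) /\
  m2.-integrable setT (EFin \o (fun y => Rintegral m1 setT (fun x => f (x, y)))).
Proof.
move=> mf fAB iA iB.
have mef : measurable_fun setT (EFin \o f) by exact/measurable_EFinP.
have iB1 y : m1.-integrable setT (EFin \o (fun x => f (x, y))).
  apply: (@dominated_integrable_real _ _ _ _ _ (fun x => A x * B y)).
  - by apply: measurableT_comp mf _; exact: pair2_measurable.
  - by move=> x.
  - apply: eq_integrable (integrableZl _ (B y) iA) => // x _.
    by rewrite /= mulrC EFinM.
have iA2 x : m2.-integrable setT (EFin \o (fun y => f (x, y))).
  apply: (@dominated_integrable_real _ _ _ _ _ (fun y => A x * B y)).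
  - by apply: measurableT_comp mf _; exact: pair1_measurable.
  - by move=> y.
  - exact: (integrableZl _ (A x) iB).
pose K := Rintegral m1 setT (fun x => `|A x|).
have mA : measurable_fun setT A by apply/measurable_EFinP; exact: measurable_int iA.
have mB : measurable_fun setT B by apply/measurable_EFinP; exact: measurable_int iB.
have Kb y : (\int[m1]_x `|(EFin \o f) (x, y)| <= (`|B y| * K)%:E)%E.
  rewrite /K /Rintegral EFinM fineK; last first.
    by apply: integrable_fin_num => //; exact: integrable_norm iA.
  rewrite -ge0_integralZl//; last first.
    by apply/measurable_EFinP; exact: measurableT_comp.
  apply: ge0_le_integral => //.
  - by apply: measurableT_comp => //; exact: measurable_int (iB1 y).
  - by apply: measurable_funeM; apply/measurable_EFinP; exact: measurableT_comp.
  - move=> x _; rewrite /= -EFinM lee_fin (le_trans (fAB x y))//.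
    by rewrite (le_trans (ler_norm _))// normrM mulrC.
have iK : m2.-integrable setT (EFin \o (fun y => K * `|B y|)).
  exact: (integrableZl _ K (integrable_norm iB)).
have imf : (m1 \x m2)%E.-integrable setT (EFin \o f).
  apply/(integrable21ltyP m1 m2) => //.
  apply: (@le_lt_trans _ _ (\int[m2]_y (`|B y| * K)%:E)%E).
    apply: ge0_le_integral => //.
    - by move=> y _; exact: integral_ge0.
    - apply: (measurable_fun_fubini_tonelli_G (m1 := m1) (abse \o (EFin \o f))) => //=.
      exact: measurableT_comp.
    - by apply/measurable_EFinP; apply: measurable_funM => //; exact: measurableT_comp.
  under eq_integral do rewrite mulrC.
  rewrite ltey_eq; apply/orP; left; exact: integrable_fin_num iK.
have iG : m2.-integrable setT (fun y => \int[m1]_x (EFin \o f) (x, y))%E.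
  apply: le_integrable iK => //; first exact: (measurable_fubini_G imf).
  move=> y _; rewrite (le_trans (le_abse_integral _ _ _))//.
    exact: measurable_int (iB1 y).
  rewrite (le_trans (Kb y))// lee_fin mulrC /= ler_norm//.
split; last first.
  apply: eq_integrable iG => // y _; rewrite /= /Rintegral fineK//.
  exact: (integrable_fin_num _ (iB1 y)).
rewrite /Rintegral.
under eq_integral do rewrite fineK ?(integrable_fin_num _ (iA2 _))//.
under [in RHS]eq_integral do rewrite fineK ?(integrable_fin_num _ (iB1 _))//.
by congr fine; exact: (Fubini imf).
Qed.

(** Transition and Levy measures are plain measures whose sigma-finiteness is a proved proposition;
    the structures required by Fubini are packed from these proofs. *)
Lemma fubini_dominated (m1 : {measure set T1 -> \bar R})
    (m2 : {measure set T2 -> \bar R}) (f : T1 * T2 -> R) (A : T1 -> R) (B : T2 -> R) :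
  sigma_finite setT m1 -> sigma_finite setT m2 ->
  measurable_fun setT f -> (forall x y, `|f (x, y)| <= A x * B y) ->
  m1.-integrable setT (EFin \o A) -> m2.-integrable setT (EFin \o B) ->
  (Rintegral m1 setT (fun x => Rintegral m2 setT (fun y => f (x, y))) =
   Rintegral m2 setT (fun y => Rintegral m1 setT (fun x => f (x, y)))) /\
  m2.-integrable setT (EFin \o (fun y => Rintegral m1 setT (fun x => f (x, y)))).
Proof.
move=> s1 s2.
pose M1 := HB.pack_for (SigmaFiniteMeasure.type T1 R) (Measure.sort m1)
  (isSFinite.Build _ T1 R (Measure.sort m1) (sfinite_measure_sigma_finite s1))
  (isSigmaFinite.Build _ T1 R (Measure.sort m1) s1).
pose M2 := HB.pack_for (SigmaFiniteMeasure.type T2 R) (Measure.sort m2)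
  (isSFinite.Build _ T2 R (Measure.sort m2) (sfinite_measure_sigma_finite s2))
  (isSigmaFinite.Build _ T2 R (Measure.sort m2) s2).
have E1 : m1 = M1 by exact: eq_measure.
have E2 : m2 = M2 by exact: eq_measure.
rewrite E1 E2; exact: fubini_dominated_sigma_finite.
Qed.

End Fubini.

Section ProbabilityIntegrals.
Context d (T : measurableType d) (R : realType) (mu : {measure set T -> \bar R}).
Hypothesis mu1 : mu setT = 1%E.

Lemma sigma_finite_mass1 : sigma_finite setT mu.
Proof.
exists (fun=> setT); first by rewrite bigcup_const.
by move=> _; split => //; rewrite mu1 ltry.
Qed.

Lemma integrable_cst_mass1 (r : R) : mu.-integrable setT (EFin \o cst r).
Proof.
apply/integrableP; split; first exact/measurable_EFinP.
by rewrite /= integral_cst// mu1 mule1 ltry.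
Qed.

Lemma bounded_integrable_mass1 (f : T -> R) (M : R) :
  measurable_fun setT f -> (forall t, `|f t| <= M) -> mu.-integrable setT (EFin \o f).
Proof.
by move=> mf fM; apply: dominated_integrable_real mf fM (integrable_cst_mass1 M).
Qed.

Lemma Rintegral_cst_mass1 (r : R) : Rintegral mu setT (cst r) = r.
Proof. by rewrite Rintegral_cst// mu1 mulr1. Qed.

Lemma normr_Rintegral_mass1 (f : T -> R) (M : R) :
  measurable_fun setT f -> (forall t, `|f t| <= M) -> `|Rintegral mu setT f| <= M.
Proof.
move=> mf fM; have If := bounded_integrable_mass1 f M mf fM.
rewrite (le_trans (le_normr_Rintegral _ If))// -[leRHS](Rintegral_cst_mass1 M).
apply: le_Rintegral => //; last exact: integrable_cst_mass1.
by have := integrable_norm If; apply: eq_integrable => // w _.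
Qed.

End ProbabilityIntegrals.

Lemma normr_cos_le1 (R : realType) (x : R) : `|cos x| <= 1.
Proof. by rewrite ler_norml cos_geN1 cos_le1. Qed.

Lemma normr_sin_le1 (R : realType) (x : R) : `|sin x| <= 1.
Proof. by rewrite ler_norml sin_geN1 sin_le1. Qed.

Lemma normr_le_1Dsq (R : realType) (w : R) : `|w| <= 1 + w ^+ 2.
Proof.
have : 0 <= (`|w| - 1) ^+ 2 by exact: sqr_ge0.
by rewrite -[w ^+ 2]real_normK ?num_real//; have := normr_ge0 w; nra.
Qed.

(** * The Poisson functional *)

Section PoissonFormula.
Context {R : realType}.
Local Notation leb := (@lebesgue_measure R).
Local Notation c0 := (@poisson_const R).

(* The functional [f + i g |-> Re int k(w) (f + i g)(w) dw] for the kernel [k = Ak + i Bk];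
   on [e^{iwy}], [y >= 0], it evaluates to [c0 e^{-y}]. *)
Definition poisson (f g : R -> R) : R :=
  Rintegral leb setT (fun w => Ak w * f w - Bk w * g w).

(** Quadratic growth is that of a Levy-Khintchine exponent along a line; against the kernel, of
    modulus [qinv ^+ 2], it leaves a multiple of [qinv]. *)
Definition tame (f g : R -> R) (C : R) := [/\ measurable_fun setT f, measurable_fun setT g &
  forall w, `|f w| <= C * (1 + w ^+ 2) /\ `|g w| <= C * (1 + w ^+ 2)].

Lemma normr_kernel_sq (w a b C : R) : `|a| <= C * (1 + w ^+ 2) -> `|b| <= C * (1 + w ^+ 2) ->
  `|Ak w * a - Bk w * b| <= C * (2 * qinv w).
Proof.
move=> ha hb; rewrite (le_trans (ler_normB _ _))// (normrM (Ak w)) (normrM (Bk w)).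
have [_ _ _ h _] := normr_kernel_le w; have q := qinv_mul w.
rewrite (@le_trans _ _ ((`|Ak w| + `|Bk w|) * (C * (1 + w ^+ 2))))//.
  by rewrite mulrDl lerD// ler_wpM2l.
have C0 : 0 <= C * (1 + w ^+ 2) by rewrite (le_trans _ ha).
apply: (le_trans (ler_wpM2r C0 h)).
rewrite [leLHS](_ : _ = C * (2 * qinv w) * (qinv w * (1 + w ^+ 2))); last by ring.
by rewrite q mulr1.
Qed.

Lemma integrable_poisson {f g C} : tame f g C ->
  leb.-integrable setT (EFin \o (fun w => Ak w * f w - Bk w * g w)).
Proof.
have [_ _ _ _ [mA mB]] := @measurable_kernels R => -[mf mg b].
apply: dominated_integrable_real (integrable_Cqinv (C * 2)).
  by apply: measurable_funB; exact: measurable_funM.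
by move=> w; rewrite -mulrA; have [b1 b2] := b w; exact: normr_kernel_sq.
Qed.

Lemma poisson_cvg (f_ g_ : nat -> R -> R) (f g : R -> R) (C : R) :
  (forall n, tame (f_ n) (g_ n) C) -> measurable_fun setT f -> measurable_fun setT g ->
  (forall w, f_ n w @[n --> \oo] --> f w) -> (forall w, g_ n w @[n --> \oo] --> g w) ->
  poisson (f_ n) (g_ n) @[n --> \oo] --> poisson f g.
Proof.
have [_ _ _ _ [mA mB]] := @measurable_kernels R => t mf mg cf cg.
apply: (@Rintegral_dominated_cvg _ _ R leb (fun n w => Ak w * f_ n w - Bk w * g_ n w)
  (fun w => Ak w * f w - Bk w * g w) (fun w => C * 2 * qinv w)).
- by move=> n; have [m1 m2 _] := t n; apply: measurable_funB; exact: measurable_funM.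
- by apply: measurable_funB; exact: measurable_funM.
- by move=> w; apply: cvgB; apply: cvgMr; [exact: cf|exact: cg].
- by move=> n w; rewrite -mulrA; have [_ _ b] := t n; have [b1 b2] := b w; exact: normr_kernel_sq.
- exact: integrable_Cqinv.
Qed.

Lemma eq_poisson (f g f' g' : R -> R) : f =1 f' -> g =1 g' -> poisson f g = poisson f' g'.
Proof. by move=> ff gg; apply: eq_Rintegral => w _; rewrite ff gg. Qed.

Lemma eq_tame {f g f' g' : R -> R} {C} : f =1 f' -> g =1 g' -> tame f g C -> tame f' g' C.
Proof. by move=> /funext-> /funext->. Qed.

Lemma tameZ (k : R) {f g C} : tame f g C -> tame (fun w => k * f w) (fun w => k * g w) (`|k| * C).
Proof.
move=> [mf mg b]; split; try exact: measurable_funM.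
by move=> w; rewrite !normrM -mulrA; have [b1 b2] := b w; rewrite !ler_wpM2l.
Qed.

Lemma tameD {f g f' g' C C'} : tame f g C -> tame f' g' C' ->
  tame (fun w => f w + f' w) (fun w => g w + g' w) (C + C').
Proof.
move=> [mf mg b] [mf' mg' b']; split; try exact: measurable_funD.
move=> w; have [b1 b2] := b w; have [b1' b2'] := b' w.
by rewrite mulrDl; split; rewrite (le_trans (ler_normD _ _))// lerD.
Qed.

Lemma poissonZ (k : R) {f g C} : tame f g C ->
  poisson (fun w => k * f w) (fun w => k * g w) = k * poisson f g.
Proof.
move=> t; rewrite /poisson -RintegralZl//; last exact: integrable_poisson t.
by apply: eq_Rintegral => w _; ring.
Qed.

Lemma poissonD {f g f' g' C C'} : tame f g C -> tame f' g' C' ->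
  poisson (fun w => f w + f' w) (fun w => g w + g' w) = poisson f g + poisson f' g'.
Proof.
move=> t t'; rewrite /poisson -RintegralD//.
- by apply: eq_Rintegral => w _; ring.
- exact: integrable_poisson t.
- exact: integrable_poisson t'.
Qed.

Lemma poisson_exp (y : R) : 0 <= y ->
  poisson (fun w => cos (w * y)) (fun w => sin (w * y)) = c0 * expR (- y).
Proof. by move=> y0; rewrite -osck_eq. Qed.

Lemma measurable_mulr_cos (y : R) : measurable_fun setT (fun w : R => cos (w * y)).
Proof. by apply: measurable_fun_cos; exact: measurable_funM. Qed.

Lemma measurable_mulr_sin (y : R) : measurable_fun setT (fun w : R => sin (w * y)).
Proof. by apply: measurable_fun_sin; exact: measurable_funM. Qed.

Lemma tame_exp (y : R) : tame (fun w => cos (w * y)) (fun w => sin (w * y)) 1.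
Proof.
split; [exact: measurable_mulr_cos|exact: measurable_mulr_sin|move=> w].
by rewrite mul1r; split; apply: (@le_trans _ _ 1);
  rewrite ?normr_cos_le1 ?normr_sin_le1// lerDl sqr_ge0.
Qed.

(* Real and imaginary parts of [(a + b (iw) + c (iw)^2) e^{iwy}]. *)
Definition expoly_re (a b c y w : R) : R :=
  a * cos (w * y) - b * w * sin (w * y) - c * w ^+ 2 * cos (w * y).
Definition expoly_im (a b c y w : R) : R :=
  a * sin (w * y) + b * w * cos (w * y) - c * w ^+ 2 * sin (w * y).

Lemma tame_expoly (a b c y : R) :
  tame (expoly_re a b c y) (expoly_im a b c y) (`|a| + `|b| + `|c|).
Proof.
have mw2 : measurable_fun setT (fun w : R => c * w ^+ 2).
  by apply: measurable_funM => //; exact: measurable_funX.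
have mc := measurable_mulr_cos y; have ms := measurable_mulr_sin y.
have B (w u v z : R) : `|u| <= 1 -> `|v| <= 1 -> `|z| <= 1 ->
    `|a * u + b * w * v - c * w ^+ 2 * z| <= (`|a| + `|b| + `|c|) * (1 + w ^+ 2).
  move=> hu hv hz; rewrite (le_trans (ler_normB _ _))// !mulrDl lerD//.
    rewrite (le_trans (ler_normD _ _))// lerD//.
      by rewrite normrM ler_wpM2l// (le_trans hu)// lerDl sqr_ge0.
    by rewrite -mulrA normrM ler_wpM2l// normrM (le_trans _ (normr_le_1Dsq _ w))// ler_piMr.
  rewrite -mulrA normrM ler_wpM2l// normrM ger0_norm ?sqr_ge0//.
  by rewrite (@le_trans _ _ (w ^+ 2))// ?lerDr// ler_piMr ?sqr_ge0.
split.
- apply: measurable_funB; last exact: measurable_funM.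
  by apply: measurable_funB; do ?apply: measurable_funM.
- apply: measurable_funB; last exact: measurable_funM.
  by apply: measurable_funD; do ?apply: measurable_funM.
move=> w; split; last by apply: B; rewrite ?normr_cos_le1 ?normr_sin_le1.
rewrite /expoly_re -[- (b * _ * _)]mulrN.
by apply: B; rewrite ?normrN ?normr_cos_le1 ?normr_sin_le1.
Qed.

(* On [e^{iwy}] the multiplier [iw] acts as [-1], up to kernels whose transform vanishes. *)
Lemma poisson_expoly (a b c y : R) : 0 <= y ->
  poisson (expoly_re a b c y) (expoly_im a b c y) = c0 * expR (- y) * (a - b + c).
Proof.
have [mA2 mB2 mA3 mB3 [mAk mBk]] := @measurable_kernels R => y0.
have b2 (w : R) : `|A2 w| + `|B2 w| <= 2 * qinv w by have [] := normr_kernel_le w.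
have b3 (w : R) : `|A3 w| + `|B3 w| <= 2 * qinv w by have [] := normr_kernel_le w.
have J2 := integrable_osc _ _ _ mA2 mB2 b2 y; have I2 := integrableZl measurableT (- c) J2.
have J3 := integrable_osc _ _ _ mA3 mB3 b3 y; have I3 := integrableZl measurableT b J3.
have Jk := integrable_osc _ _ _ mAk mBk normr_kernel_lin y.
have Ik := integrableZl measurableT (a - b + c) Jk.
have I23 := integrableD measurableT I3 I2.
(* With [z = iw], [z k = (1 - z)^-3 - k] and [z^2 k = k - (1 - z)^-2], so [(a + bz + cz^2) k = (a -
   b + c) k + b (1 - z)^-3 - c (1 - z)^-2]. *)
have -> : c0 * expR (- y) * (a - b + c) =
    (a - b + c) * osc Ak Bk y + (b * osc A3 B3 y + - c * osc A2 B2 y).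
  by rewrite osc2_eq0// osc3_eq0// osck_eq//; ring.
rewrite /osc -!RintegralZl//.
rewrite -RintegralD// -RintegralD//; apply: eq_Rintegral => w _.
rewrite /expoly_re /expoly_im /Ak /Bk /A2 /B2 /A3 /B3 /qinv; field; exact: oneDsq_neq0.
Qed.

(** [rotr] and [roti] are the real and imaginary parts of [e^{iwy} (f + ig)]. *)
Definition rotr (y : R) (f g : R -> R) (w : R) := cos (w * y) * f w - sin (w * y) * g w.
Definition roti (y : R) (f g : R -> R) (w : R) := sin (w * y) * f w + cos (w * y) * g w.

Lemma normr_rot_le (y w C : R) (f g : R -> R) : `|f w| <= C -> `|g w| <= C ->
  `|rotr y f g w| <= 2 * C /\ `|roti y f g w| <= 2 * C.
Proof.
move=> hf hg.
have H (u v : R) : `|u| <= 1 -> `|v| <= C -> `|u * v| <= C.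
  by move=> hu hv; rewrite normrM (le_trans _ hv)// ler_piMl.
split; rewrite mulr_natl mulr2n.
  by rewrite (le_trans (ler_normB _ _))// lerD ?H// ?normr_cos_le1 ?normr_sin_le1.
by rewrite (le_trans (ler_normD _ _))// lerD ?H// ?normr_cos_le1 ?normr_sin_le1.
Qed.

Lemma tame_rot (y : R) {f g C} : tame f g C -> tame (rotr y f g) (roti y f g) (2 * C).
Proof.
have mc := measurable_mulr_cos y; have ms := measurable_mulr_sin y; move=> [mf mg b]; split.
- by apply: measurable_funB; exact: measurable_funM.
- by apply: measurable_funD; exact: measurable_funM.
- by move=> w; have [b1 b2] := b w; rewrite -mulrA; exact: normr_rot_le.
Qed.

Lemma Rintegral_rotation d (T : measurableType d) (mu : {measure set T -> \bar R})
    (p q : R) (a b : T -> R) :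
  mu.-integrable setT (EFin \o a) -> mu.-integrable setT (EFin \o b) ->
  Rintegral mu setT (fun t => p * a t - q * b t) =
    p * Rintegral mu setT a - q * Rintegral mu setT b /\
  Rintegral mu setT (fun t => p * a t + q * b t) =
    p * Rintegral mu setT a + q * Rintegral mu setT b.
Proof.
move=> ia ib; have ia' := integrableZl measurableT p ia.
have ib' := integrableZl measurableT q ib.
by split; rewrite -!RintegralZl// ?RintegralB ?RintegralD.
Qed.

Lemma integrable_section d (T : measurableType d) (mu : {measure set T -> \bar R})
    (N : T -> R) (k : T -> R -> R) (w : R) : mu.-integrable setT (EFin \o N) ->
  measurable_fun setT (fun z : T * R => k z.1 z.2) ->
  (forall t, `|k t w| <= N t * (1 + w ^+ 2)) -> mu.-integrable setT (EFin \o k ^~ w).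
Proof.
move=> iN mk kb.
have iw : mu.-integrable setT (EFin \o (fun t => (1 + w ^+ 2) * N t)).
  exact: (integrableZl measurableT (1 + w ^+ 2) iN).
apply: dominated_integrable_real iw; last by move=> t; rewrite mulrC.
rewrite (_ : k ^~ w = (fun z : T * R => k z.1 z.2) \o (fun t => (t, w)))//.
by apply: measurableT_comp mk _; exact: pair2_measurable.
Qed.

Lemma poisson_fubini d (T : measurableType d) (mu : {measure set T -> \bar R})
    (N : T -> R) (f g : T -> R -> R) :
  sigma_finite setT mu -> mu.-integrable setT (EFin \o N) ->
  measurable_fun setT (fun z : T * R => f z.1 z.2) ->
  measurable_fun setT (fun z : T * R => g z.1 z.2) ->
  (forall t w, `|f t w| <= N t * (1 + w ^+ 2) /\ `|g t w| <= N t * (1 + w ^+ 2)) ->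
  let F w := Rintegral mu setT (f ^~ w) in
  let G w := Rintegral mu setT (g ^~ w) in
  [/\ tame F G (Rintegral mu setT N),
    mu.-integrable setT (EFin \o (fun t => poisson (f t) (g t))) &
    poisson F G = Rintegral mu setT (fun t => poisson (f t) (g t))].
Proof.
have [_ _ _ _ [mA mB]] := @measurable_kernels R => sf iN mf mg b F G.
have msnd (h : R -> R) : measurable_fun setT h -> measurable_fun setT (fun z : T * R => h z.2).
  by move=> mh; exact: measurableT_comp.
have part (h : T -> R -> R) : measurable_fun setT (fun z : T * R => h z.1 z.2) ->
    (forall t w, `|h t w| <= N t * (1 + w ^+ 2)) ->
    [/\ forall w, mu.-integrable setT (EFin \o h ^~ w),
      measurable_fun setT (fun w : R => Rintegral mu setT (h ^~ w)) &
      forall w, `|Rintegral mu setT (h ^~ w)| <= Rintegral mu setT N * (1 + w ^+ 2)].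
  move=> mh hb; have ih w := integrable_section _ _ mu N h w iN mh (hb ^~ w).
  split => //; last first.
    have iw w : mu.-integrable setT (EFin \o (fun t => (1 + w ^+ 2) * N t)).
      exact: (integrableZl measurableT (1 + w ^+ 2) iN).
    move=> w; rewrite (le_trans (le_normr_Rintegral _ (ih w)))// mulrC -RintegralZl//.
    apply: le_Rintegral => //; first by have := integrable_norm (ih w); apply: eq_integrable => // t _.
    by move=> t _; rewrite mulrC.
  (* Damping by [qinv ^+ 2] brings [h] under a product bound; Fubini then yields measurability of
     the integral in [w], and the factor is divided out again. *)
  pose k (z : T * R) := qinv z.2 ^+ 2 * h z.1 z.2.
  have mk : measurable_fun setT k.
    apply: measurable_funM => //; apply: (msnd (fun w => qinv w ^+ 2)).
    by apply: measurable_funX; exact: measurable_qinv.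
  have kb t w : `|k (t, w)| <= N t * qinv w.
    rewrite normrM ger0_norm ?exprn_ge0 ?(ltW (qinv_gt0 _))//=.
    apply: le_trans (ler_wpM2l (sqr_ge0 _) (hb t w)) _.
    rewrite [leLHS](_ : _ = N t * qinv w * (qinv w * (1 + w ^+ 2))); last by ring.
    by rewrite qinv_mul mulr1.
  have [_ /measurable_int/measurable_EFinP m] := fubini_dominated _ _ _ _ _ mu leb k N
     qinv sf (sigma_finiteT _) mk kb iN (@integrable_qinv R).
  rewrite (_ : (fun w => _) = fun w => (1 + w ^+ 2) ^+ 2 * Rintegral mu setT (fun t => k (t, w))).
    by apply: measurable_funM => //; apply: measurable_funX; exact: measurable_funD.
  apply/funext => w; rewrite /k/= RintegralZl//.
  by rewrite mulrA -exprMn [_ * qinv w]mulrC qinv_mul expr1n mul1r.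
have [If mF Fb] := part f mf (fun t w => (b t w).1).
have [Ig mG Gb] := part g mg (fun t w => (b t w).2).
pose K (z : T * R) := Ak z.2 * f z.1 z.2 - Bk z.2 * g z.1 z.2.
have mK : measurable_fun setT K.
  by apply: measurable_funB; apply: measurable_funM => //; exact: msnd.
have Kb t w : `|K (t, w)| <= N t * (2 * qinv w).
  by have [b1 b2] := b t w; exact: normr_kernel_sq.
have [E _] := fubini_dominated _ _ _ _ _ mu leb K N (fun w => 2 * qinv w)
     sf (sigma_finiteT _) mK Kb iN (integrable_Cqinv 2).
(* With the factors exchanged, the same lemma gives integrability in [t] of the Poisson
   functional. *)
have mK' : measurable_fun setT (fun z : R * T => K (z.2, z.1)).
  by apply: measurableT_comp mK _; exact: measurable_swap.
have Kb' w t : `|K (t, w)| <= 2 * qinv w * N t by rewrite mulrC.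
have [_ iH] := fubini_dominated _ _ _ _ _ leb mu (fun z => K (z.2, z.1)) (fun w => 2 * qinv w) N
     (sigma_finiteT _) sf mK' Kb' (integrable_Cqinv 2) iN.
split; [by split => // w; rewrite Fb Gb|exact: iH|].
rewrite -[RHS]/(Rintegral mu setT (fun t => Rintegral leb setT (fun w => K (t, w)))) E.
apply: eq_Rintegral => w _.
by have [<- _] := Rintegral_rotation _ _ mu (Ak w) (Bk w) _ _ (If w) (Ig w).
Qed.

Section Laplace.
Context d (T : measurableType d) (mu : {measure set T -> \bar R}).
Hypothesis mu1 : mu setT = 1%E.
Variable Y : T -> R.
Hypotheses (mY : measurable_fun setT Y) (Y0 : forall t, 0 <= Y t).

Lemma measurable_mulr_prod : measurable_fun setT (fun z : T * R => z.2 * Y z.1).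
Proof. by apply: measurable_funM => //; apply: measurableT_comp. Qed.

Lemma integrable_laplace : mu.-integrable setT (EFin \o (fun t => expR (- Y t))).
Proof.
apply: (bounded_integrable_mass1 _ _ _ _ mu1 _ 1).
  by apply: measurableT_comp => //; exact: measurableT_comp.
by move=> t; rewrite ger0_norm ?expR_ge0// expR_le1 oppr_le0.
Qed.

Lemma integrable_ft (w : R) : mu.-integrable setT (EFin \o (fun t => cos (w * Y t))) /\
  mu.-integrable setT (EFin \o (fun t => sin (w * Y t))).
Proof.
have m := measurable_funM (measurable_cst w) mY.
split; apply: (bounded_integrable_mass1 _ _ _ _ mu1 _ 1).
- exact: measurable_fun_cos m.
- by move=> t; exact: normr_cos_le1.
- exact: measurable_fun_sin m.
- by move=> t; exact: normr_sin_le1.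
Qed.

Lemma laplace_poisson :
  let C w := Rintegral mu setT (fun t => cos (w * Y t)) in
  let S w := Rintegral mu setT (fun t => sin (w * Y t)) in
  tame C S 1 /\ poisson C S = c0 * Rintegral mu setT (fun t => expR (- Y t)).
Proof.
have [|||t _ E] := poisson_fubini _ _ mu (cst 1) (fun t w => cos (w * Y t))
  (fun t w => sin (w * Y t)) (sigma_finite_mass1 _ _ _ _ mu1) (integrable_cst_mass1 _ _ _ _ mu1 1).
- exact: measurable_fun_cos measurable_mulr_prod.
- exact: measurable_fun_sin measurable_mulr_prod.
- by move=> t w; have [_ _ b] := tame_exp (Y t); exact: b.
rewrite (Rintegral_cst_mass1 _ _ _ _ mu1 1) in t; split=> //.
rewrite E -RintegralZl//; last exact: integrable_laplace.
by apply: eq_Rintegral => s _; rewrite poisson_exp.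
Qed.

End Laplace.

(** Multiplying a characteristic function by [e^{iws}] shifts its variable by [s >= 0], hence
    multiplies the transform by [e^{-s}]; averaging over [s = Y2] gives the product, without a joint
    law of [Y1] and [Y2]. *)
Lemma laplace_product d1 d2 (T1 : measurableType d1) (T2 : measurableType d2)
    (mu1 : {measure set T1 -> \bar R}) (mu2 : {measure set T2 -> \bar R})
    (Y1 : T1 -> R) (Y2 : T2 -> R) :
  mu1 setT = 1%E -> mu2 setT = 1%E ->
  measurable_fun setT Y1 -> measurable_fun setT Y2 ->
  (forall t, 0 <= Y1 t) -> (forall t, 0 <= Y2 t) ->
  let C1 w := Rintegral mu1 setT (fun t => cos (w * Y1 t)) in
  let S1 w := Rintegral mu1 setT (fun t => sin (w * Y1 t)) in
  let C2 w := Rintegral mu2 setT (fun t => cos (w * Y2 t)) in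
  let S2 w := Rintegral mu2 setT (fun t => sin (w * Y2 t)) in
  poisson (fun w => C1 w * C2 w - S1 w * S2 w) (fun w => C1 w * S2 w + S1 w * C2 w) =
  c0 * (Rintegral mu1 setT (fun t => expR (- Y1 t)) *
        Rintegral mu2 setT (fun t => expR (- Y2 t))).
Proof.
move=> m1 m2 mY1 mY2 Y10 Y20 C1 S1 C2 S2.
have [t1 _] := laplace_poisson _ _ _ m1 _ mY1 Y10; rewrite -/C1 -/S1 in t1.
have shift s : 0 <= s -> poisson (rotr s C1 S1) (roti s C1 S1) =
    c0 * Rintegral mu1 setT (fun t => expR (- Y1 t)) * expR (- s).
  move=> s0.
  have mYs : measurable_fun setT (fun t => Y1 t + s) by exact: measurable_funD.
  have -> : c0 * Rintegral mu1 setT (fun t => expR (- Y1 t)) * expR (- s) =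
      c0 * Rintegral mu1 setT (fun t => expR (- (Y1 t + s))).
    rewrite -mulrA -[X in c0 * X]RintegralZr//; last exact: integrable_laplace.
    by congr (_ * _); apply: eq_Rintegral => t _; rewrite opprD expRD.
  have [|_ <-] := laplace_poisson _ _ _ m1 _ mYs; first by move=> t; rewrite addr_ge0.
  apply: eq_poisson => w; have [ic is_] := integrable_ft _ _ _ m1 _ mY1 w.
    rewrite /rotr; have [<- _] := Rintegral_rotation _ _ mu1 (cos (w * s)) (sin (w * s)) _ _ ic is_.
    by apply: eq_Rintegral => t _; rewrite mulrDr cosD; ring.
  rewrite /roti; have [_ <-] := Rintegral_rotation _ _ mu1 (sin (w * s)) (cos (w * s)) _ _ ic is_.
  by apply: eq_Rintegral => t _; rewrite mulrDr sinD; ring.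
have mZ := measurable_mulr_prod _ _ _ mY2.
have mc := measurable_fun_cos _ _ _ _ mZ; have ms := measurable_fun_sin _ _ _ _ mZ.
have msnd (h : R -> R) : measurable_fun setT h -> measurable_fun setT (fun z : T2 * R => h z.2).
  by move=> mh; exact: measurableT_comp.
have [mC1 mS1 _] := t1.
have [|||_ _ E] := poisson_fubini _ _ mu2 (cst (2 * 1)) (fun t => rotr (Y2 t) C1 S1)
  (fun t => roti (Y2 t) C1 S1) (sigma_finite_mass1 _ _ _ _ m2) (integrable_cst_mass1 _ _ _ _ m2 _).
- by apply: measurable_funB; apply: measurable_funM => //; exact: msnd.
- by apply: measurable_funD; apply: measurable_funM => //; exact: msnd.
- by move=> t w; have [_ _ b] := tame_rot (Y2 t) t1; exact: b.
rewrite mulrA -RintegralZl//; last exact: integrable_laplace.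
transitivity (poisson (fun w => Rintegral mu2 setT (fun t => rotr (Y2 t) C1 S1 w))
  (fun w => Rintegral mu2 setT (fun t => roti (Y2 t) C1 S1 w))); last first.
  by rewrite E; apply: eq_Rintegral => t _; exact: shift.
apply: eq_poisson => w; have [ic is_] := integrable_ft _ _ _ m2 _ mY2 w.
  have [<- _] := Rintegral_rotation _ _ mu2 (C1 w) (S1 w) _ _ ic is_.
  by apply: eq_Rintegral => t _; rewrite /rotr; ring.
rewrite addrC; have [_ <-] := Rintegral_rotation _ _ mu2 (S1 w) (C1 w) _ _ ic is_.
by apply: eq_Rintegral => t _; rewrite /roti; ring.
Qed.

(** After rotation the integrand is [e^{iw(y0 + s)} - (1 + iw h) e^{iw y0}], to which the rule for
    exponential polynomials applies pointwise: [iw] becomes [-1], whence the sign of [h]. *)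
Lemma poisson_levy d (T : measurableType d) (mu : {measure set T -> \bar R})
    (s h N : T -> R) (y0 : R) :
  sigma_finite setT mu -> measurable_fun setT s -> measurable_fun setT h ->
  mu.-integrable setT (EFin \o N) -> (forall t, 0 <= s t) -> 0 <= y0 ->
  (forall t w, `|cos (w * s t) - 1| <= N t * (1 + w ^+ 2) /\
    `|sin (w * s t) - w * h t| <= N t * (1 + w ^+ 2)) ->
  let Ic w := Rintegral mu setT (fun t => cos (w * s t) - 1) in
  let Is w := Rintegral mu setT (fun t => sin (w * s t) - w * h t) in
  tame Ic Is (Rintegral mu setT N) /\
  poisson (rotr y0 Ic Is) (roti y0 Ic Is) =
    c0 * expR (- y0) * Rintegral mu setT (fun t => expR (- s t) - 1 + h t).
Proof.
move=> sf ms mh iN s0 y00 b Ic Is.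
have mZ := measurable_mulr_prod _ _ _ ms.
pose f t w := cos (w * s t) - 1; pose g t w := sin (w * s t) - w * h t.
have mf : measurable_fun setT (fun z : T * R => f z.1 z.2).
  by apply: measurable_funB => //; exact: measurable_fun_cos.
have mg : measurable_fun setT (fun z : T * R => g z.1 z.2).
  by apply: measurable_funB; [exact: measurable_fun_sin|exact: measurable_mulr_prod].
have [t1 _ _] := poisson_fubini _ _ mu N f g sf iN mf mg b.
split => //.
have mc : measurable_fun setT (fun z : T * R => cos (z.2 * y0)).
  by apply: measurable_fun_cos; exact: measurable_funM.
have msy : measurable_fun setT (fun z : T * R => sin (z.2 * y0)).
  by apply: measurable_fun_sin; exact: measurable_funM.
have [|||_ iH E] := poisson_fubini _ _ mu (fun t => 2 * N t) (fun t => rotr y0 (f t) (g t))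
  (fun t => roti y0 (f t) (g t)) sf (integrableZl measurableT 2 iN).
- by apply: measurable_funB; exact: measurable_funM.
- by apply: measurable_funD; exact: measurable_funM.
- by move=> t w; have [b1 b2] := b t w; rewrite -mulrA; exact: normr_rot_le.
have G t : poisson (rotr y0 (f t) (g t)) (roti y0 (f t) (g t)) =
    c0 * expR (- y0) * (expR (- s t) - 1 + h t).
  have ys : 0 <= y0 + s t by rewrite addr_ge0.
  have -> : c0 * expR (- y0) * (expR (- s t) - 1 + h t) =
     c0 * expR (- (y0 + s t)) * (1 - 0 + 0) + c0 * expR (- y0) * (-1 - - h t + 0).
    by rewrite opprD expRD; ring.
  rewrite -!poisson_expoly// -(poissonD (tame_expoly _ _ _ _) (tame_expoly _ _ _ _)).
  by apply: eq_poisson => w;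
    rewrite /rotr /roti /f /g /expoly_re /expoly_im (mulrDr w y0 (s t)) ?cosD ?sinD; ring.
(* Integrability is read off from the Fubini step, the two integrands being proportional with a
   nonzero factor. *)
have ig : mu.-integrable setT (EFin \o (fun t => expR (- s t) - 1 + h t)).
  have k0 : c0 * expR (- y0) != 0 by rewrite gt_eqF// mulr_gt0 ?expR_gt0 ?poisson_const_gt0.
  have := integrableZl measurableT (c0 * expR (- y0))^-1 iH.
  by apply: eq_integrable => // t _; rewrite /= G -EFinM mulKf.
rewrite -RintegralZl//.
transitivity (Rintegral mu setT (fun t => poisson (rotr y0 (f t) (g t)) (roti y0 (f t) (g t)))); last first.
  by apply: eq_Rintegral => t _; exact: G.
rewrite -E; apply: eq_poisson => w.
all: have If := integrable_section _ _ mu N f w iN mf (fun t => (b t w).1).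
all: have Ig := integrable_section _ _ mu N g w iN mg (fun t => (b t w).2).
  by have [E1 _] := Rintegral_rotation _ _ mu (cos (w * y0)) (sin (w * y0)) _ _ If Ig; exact: (esym E1).
by have [_ E1] := Rintegral_rotation _ _ mu (sin (w * y0)) (cos (w * y0)) _ _ If Ig; exact: (esym E1).
Qed.

End PoissonFormula.

(** * The functions R_j *)

Section ElementaryBounds.
Context {R : realType}.
Implicit Types x y z : R.

Lemma normr_sin_le x : `|sin x| <= `|x|.
Proof.
wlog x0 : x / 0 <= x => [H|].
  have [/H//|x0] := leP 0 x.
  by rewrite -normrN -sinN -(normrN x) H// oppr_ge0 ltW.
move: x0; rewrite le_eqVlt => /predU1P[<-|x0]; first by rewrite sin0 normr0.
have [|c _ E] := @MVT R (@sin R) (@cos R) 0 x x0 (fun z _ => is_derive_sin z).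
  by apply: continuous_subspaceT; exact: continuous_sin.
by move: E; rewrite sin0 !subr0 => ->; rewrite normrM ler_piMl// normr_cos_le1.
Qed.

Lemma cosB1_half x : 1 - cos x = 2 * `|sin (x / 2)| ^+ 2.
Proof.
have -> : cos x = cos (x / 2 + x / 2) by congr cos; lra.
by rewrite real_normK ?num_real// cosD -!expr2 cos2sin2; ring.
Qed.

Lemma normr_cosB1_le x : `|cos x - 1| <= `|x| /\ `|cos x - 1| <= x ^+ 2.
Proof.
have s1 := normr_sin_le (x / 2); have s2 := normr_sin_le1 _ (x / 2).
rewrite distrC ger0_norm ?subr_ge0 ?cos_le1// cosB1_half.
move: s1; rewrite normrM (ger0_norm (x := 2^-1))// => s1.
have s0 := normr_ge0 (sin (x / 2)); have x0 := normr_ge0 x.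
by rewrite -[x ^+ 2]real_normK ?num_real//; split; nra.
Qed.

Lemma normr_sinB_le x : `|sin x - x| <= x ^+ 2.
Proof.
wlog x0 : x / 0 <= x => [H|].
  have [/H//|x0] := leP 0 x.
  have := H (- x); rewrite sinN sqrrN (_ : - sin x - - x = - (sin x - x)); last by ring.
  by rewrite normrN; apply; rewrite oppr_ge0 ltW.
move: x0; rewrite le_eqVlt => /predU1P[<-|x0]; first by rewrite sin0 subrr normr0 expr0n.
have [|c] := @MVT R (fun z => sin z - z) (fun z => cos z - 1) 0 x x0 _.
  by apply: continuous_subspaceT => z; apply: cvgB; [exact: continuous_sin|exact: cvg_id].
rewrite in_itv/= => /andP[c0 cx] E.
move: E; rewrite sin0 !subr0 => ->; rewrite normrM expr2.
have [h _] := normr_cosB1_le c; move: h c0 cx.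
rewrite !(ger0_norm (ltW x0)) => h c0 cx.
rewrite ler_wpM2r ?(ltW x0)// (le_trans h)// ger0_norm ?ltW//.
Qed.

Lemma cexp_taylor (r d : R) : r <= 2^-1 ->
  `|expR r * cos d - 1 - r| <= 8 * (r ^+ 2 + d ^+ 2) /\
  `|expR r * sin d - d| <= 8 * (r ^+ 2 + d ^+ 2).
Proof.
move=> r2; have e1 := expR_ge1Dx r; have e2 := expR_ge1Dx (- r).
have e3 : expR r * expR (- r) = 1 by rewrite -expRD subrr expR0.
have e0 := expR_ge0 r.
have er2 : expR r <= 2 by nra.
have a2 : `|expR r - 1 - r| <= 2 * r ^+ 2 by rewrite ger0_norm; nra.
have a1 : `|expR r - 1| <= 2 * `|r|.
  have [r0|r0] := leP 0 r; last first.
    by rewrite ler0_norm ?(ltr0_norm r0); [|rewrite subr_le0 expR_le1 ltW]; lra.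
  by rewrite (ger0_norm r0) ger0_norm; [nra|lra].
have [_ b] := normr_cosB1_le d; have c := normr_sinB_le d.
have en : `|expR r| <= 2 by rewrite ger0_norm.
have s1 := sqr_ge0 r; have s2 := sqr_ge0 d.
split.
  rewrite (_ : _ - r = (expR r - 1 - r) + expR r * (cos d - 1)); last by ring.
  rewrite (le_trans (ler_normD _ _))// normrM.
  have : `|expR r| * `|cos d - 1| <= 2 * d ^+ 2 by rewrite ler_pM.
  lra.
rewrite (_ : _ - d = expR r * (sin d - d) + (expR r - 1) * d); last by ring.
rewrite (le_trans (ler_normD _ _))// !normrM.
have : `|expR r| * `|sin d - d| <= 2 * d ^+ 2 by rewrite ler_pM.
have : `|expR r - 1| * `|d| <= 2 * `|r| * `|d| by rewrite ler_wpM2r.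
have : 2 * `|r| * `|d| <= r ^+ 2 + d ^+ 2.
  rewrite -[r ^+ 2]real_normK ?num_real// -[d ^+ 2]real_normK ?num_real//.
  by have := sqr_ge0 (`|r| - `|d|); lra.
lra.
Qed.

Lemma sum_normr_sqr (I : finType) (f : I -> R) :
  (\sum_i `|f i|) ^+ 2 <= #|I|%:R * \sum_i f i ^+ 2.
Proof.
rewrite expr2 big_distrlr/=.
pose S := \sum_i f i ^+ 2.
apply: (@le_trans _ _ (\sum_(i : I) \sum_(j : I) (2^-1 * f i ^+ 2 + 2^-1 * f j ^+ 2))).
  apply: ler_sum => i _; apply: ler_sum => j _.
  rewrite -[f i ^+ 2]real_normK ?num_real// -[f j ^+ 2]real_normK ?num_real//.
  have := sqr_ge0 (`|f i| - `|f j|); lra.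
rewrite (eq_bigr (fun i => #|I|%:R * 2^-1 * f i ^+ 2 + 2^-1 * S)); last first.
  by move=> i _; rewrite big_split/= sumr_const -mulr_sumr -(mulr_natl (2^-1 * f i ^+ 2)) mulrA.
rewrite big_split/= sumr_const -mulr_sumr -/S -mulr_natl; lra.
Qed.

End ElementaryBounds.

Section ComplexParts.
Context {R : realType} {m n : nat}.
Implicit Types (z : R[i]) (u : 'I_(m + n) -> R[i]) (x : 'rV[R]_(m + n)).

Lemma complexReD z1 z2 : complex.Re (z1 + z2) = complex.Re z1 + complex.Re z2 :> R.
Proof. by case: z1 z2 => [a b] [c e]. Qed.
Lemma complexImD z1 z2 : complex.Im (z1 + z2) = complex.Im z1 + complex.Im z2 :> R.
Proof. by case: z1 z2 => [a b] [c e]. Qed.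
Lemma complexReN z : complex.Re (- z) = - complex.Re z :> R.
Proof. by case: z. Qed.
Lemma complexImN z : complex.Im (- z) = - complex.Im z :> R.
Proof. by case: z. Qed.
Lemma complexReM z1 z2 : complex.Re (z1 * z2) =
  complex.Re z1 * complex.Re z2 - complex.Im z1 * complex.Im z2 :> R.
Proof. by case: z1 z2 => [a b] [c e]. Qed.
Lemma complexImM z1 z2 : complex.Im (z1 * z2) =
  complex.Re z1 * complex.Im z2 + complex.Im z1 * complex.Re z2 :> R.
Proof. by case: z1 z2 => [a b] [c e]. Qed.

Lemma complexRe_sum (I : Type) (r : seq I) (P : pred I) (F : I -> R[i]) :
  complex.Re (\sum_(i <- r | P i) F i) = \sum_(i <- r | P i) complex.Re (F i).
Proof. by elim/big_rec2: _ => [//|i a b _ <-]; rewrite complexReD. Qed.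

Lemma complexIm_sum (I : Type) (r : seq I) (P : pred I) (F : I -> R[i]) :
  complex.Im (\sum_(i <- r | P i) F i) = \sum_(i <- r | P i) complex.Im (F i).
Proof. by elim/big_rec2: _ => [//|i a b _ <-]; rewrite complexImD. Qed.

Lemma Re_cdot u x : complex.Re (cdot u x) = \sum_k complex.Re (u k) * x ord0 k.
Proof. by rewrite complexRe_sum; apply: eq_bigr => k _; rewrite complexReM/= mulr0 subr0. Qed.

Lemma Im_cdot u x : complex.Im (cdot u x) = \sum_k complex.Im (u k) * x ord0 k.
Proof. by rewrite complexIm_sum; apply: eq_bigr => k _; rewrite complexImM/= mulr0 add0r. Qed.

Lemma split_lshift (i : 'I_m) : fintype.split (lshift n i) = inl i.
Proof. exact: (unsplitK (inl i)). Qed.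

Lemma split_rshift (i : 'I_n) : fintype.split (rshift m i) = inr i.
Proof. exact: (unsplitK (inr i)). Qed.

End ComplexParts.

(** * State space, truncation and the Levy-Khintchine integrand *)

Section StateSpace.
Context {R : realType} {m n : nat}.
Local Notation vec := 'rV[R]_(m + n).
Local Notation Bv := (Bvec R m n).

Lemma continuous_measurable_Bvec (f : vec -> R) :
  continuous f -> measurable_fun (setT : set Bv) (f : Bv -> R).
Proof.
move=> /continuousP cf; apply: (measurability _ (RGenOpens.measurableE R)).
move=> _ [_ [a [b ->] <-]]; rewrite setTI.
by apply: sub_sigma_algebra; apply: cf; exact: interval_open.
Qed.

Lemma measurable_coord (k : 'I_(m + n)) :
  measurable_fun (setT : set Bv) (fun x : Bv => (x : vec) ord0 k).
Proof. by apply: continuous_measurable_Bvec; exact: coord_continuous. Qed.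

Lemma measurable_stateD : measurable (@stateD R m n : set Bv).
Proof.
rewrite (_ : @stateD R m n = \bigcap_(k in [set k : 'I_(m + n) | (k < m)%N])
   [set x : Bv | 0 <= (x : vec) ord0 k]).
  apply: fin_bigcap_measurable => // k _.
  have := measurable_coord k measurableT _ (measurable_itv `[(0 : R), +oo[).
  rewrite setTI; congr measurable; apply/seteqP; split => x /=;
    by rewrite in_itv/= andbT.
by apply/seteqP; split => x Dx k /=; exact: Dx.
Qed.

Lemma measurable_stateD0 : measurable (@stateD0 R m n : set Bv).
Proof.
apply: measurableD; first exact: measurable_stateD.
rewrite (_ : [set 0] = \bigcap_(k in [set: 'I_(m + n)])
   [set x : Bv | (x : vec) ord0 k = 0]).
  apply: fin_bigcap_measurable => // k _.
  have := measurable_coord k measurableT _ (measurable_set1 (0 : R)).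
  by rewrite setTI.
apply/seteqP; split => x /=; first by move=> -> k _ /=; rewrite mxE.
by move=> x0; apply/rowP => k; rewrite mxE; exact: x0.
Qed.

(** As a clamp to [[-1, 1]] the truncation is visibly measurable, and the case split at 0
    disappears. *)
Lemma trunc_coord (x : vec) k : trunc x ord0 k = Num.max (-1) (Num.min 1 (x ord0 k)).
Proof.
rewrite mxE; case: eqVneq => [->|x0].
  by rewrite min_r ?ler01// max_r// lerN10.
have [xp|xn|] := ltgtP (x ord0 k) 0; last by move=> e; rewrite e eqxx in x0.
- rewrite ltr0_norm// invrN mulrN divff// mulrN1 (min_r (_ : x ord0 k <= 1)); last by lra.
  by rewrite oppr_min opprK.
- rewrite gtr0_norm// divff// mulr1 [RHS]max_r// le_min; apply/andP; split; lra.
Qed.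

Lemma measurable_trunc (k : 'I_(m + n)) :
  measurable_fun (setT : set Bv) (fun x : Bv => trunc (x : vec) ord0 k).
Proof.
under eq_fun do rewrite trunc_coord.
by apply: measurable_maxr => //; apply: measurable_minr => //; exact: measurable_coord.
Qed.

Definition trsq (x : vec) : R := \sum_k trunc x ord0 k ^+ 2.

Lemma trsq_ge0 (x : vec) : 0 <= trsq x.
Proof. by apply: sumr_ge0 => k _; exact: sqr_ge0. Qed.

Lemma measurable_trsq : measurable_fun (setT : set Bv) (trsq : Bv -> R).
Proof.
by apply: measurable_sum => k; apply: measurable_funX; exact: measurable_trunc.
Qed.

Lemma normr_trunc_le1 (x : vec) k : `|trunc x ord0 k| <= 1.
Proof.
rewrite trunc_coord ler_norml le_max lexx/= ge_max ge_min lexx andbT; lra.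
Qed.

Lemma trunc_small (x : vec) k : `|x ord0 k| <= 1 -> trunc x ord0 k = x ord0 k.
Proof. by rewrite trunc_coord ler_norml => /andP[h1 h2]; rewrite min_r// max_r. Qed.

Lemma trsq_ge1 (x : vec) k : 1 < `|x ord0 k| -> 1 <= trsq x.
Proof.
move=> h; rewrite /trsq (bigD1 k)//= -[leLHS]addr0 lerD//; last first.
  by apply: sumr_ge0 => l _; exact: sqr_ge0.
rewrite trunc_coord; move: h; rewrite lter_normr => /orP[h|h].
  by rewrite min_l ?(ltW h)// max_r ?expr1n//; lra.
by rewrite min_r ?max_l ?sqrrN ?expr1n//; lra.
Qed.

Definition dotN (c : 'I_(m + n) -> R) (x : vec) := \sum_k c k * x ord0 k.

Lemma normr_dotN_le (c : 'I_(m + n) -> R) x M :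
  (forall k, `|c k| <= M) -> `|dotN c x| <= M * \sum_k `|x ord0 k|.
Proof.
move=> cM; rewrite (le_trans (ler_norm_sum _ _ _))// mulr_sumr ler_sum// => k _.
by rewrite normrM ler_wpM2r.
Qed.

(** The terms [2 + d M] bound the integrand at a large jump; [16 d M^2] is the Taylor constant 8
    times two squares, each at most [d M^2 trsq x] by Cauchy-Schwarz. *)
Definition levy_cst (M : R) : R := 2 + (m + n)%:R * M + 16 * (m + n)%:R * M ^+ 2.

(* The bound making the Levy-Khintchine integrals converge, uniformly for
   exponents [a + i b] in a box with [a] in the dual of [D]. *)
Lemma levy_integrand_le (a b : 'I_(m + n) -> R) (M : R) x :
  (forall k, `|a k| <= M) -> (forall k, `|b k| <= M) -> dotN a x <= 0 ->
  `|expR (dotN a x) * cos (dotN b x) - 1 - dotN a (trunc x)| <= levy_cst M * trsq x /\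
  `|expR (dotN a x) * sin (dotN b x) - dotN b (trunc x)| <= levy_cst M * trsq x.
Proof.
move=> aM bM ax0; have N0 := trsq_ge0 x; rewrite /levy_cst.
set dd : R := (m + n)%:R.
have dd0 : 0 <= dd by exact: ler0n.
(* A coordinate beyond 1 forces [trsq x >= 1], so a constant bound is enough; otherwise truncation
   is the identity and the second-order Taylor bound applies. *)
have [/existsP[k xk]|/existsPn h] := boolP [exists k, 1 < `|x ord0 k|].
  have M0 : 0 <= M by rewrite (le_trans _ (aM k)).
  have N1 := trsq_ge1 _ _ xk.
  have tr (c : 'I_(m + n) -> R) : (forall k, `|c k| <= M) -> `|dotN c (trunc x)| <= dd * M.
    move=> cM; rewrite (le_trans (normr_dotN_le _ _ _ cM))// mulrC ler_wpM2r//.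
    rewrite (le_trans (_ : _ <= \sum_(k < m + n) 1))//.
      by apply: ler_sum => l _; exact: normr_trunc_le1.
    by rewrite sumr_const card_ord.
  have e1 : `|expR (dotN a x)| <= 1 by rewrite ger0_norm ?expR_ge0// expR_le1.
  have ee (z : R) : `|z| <= 1 -> `|expR (dotN a x) * z| <= 1.
    by move=> hz; rewrite normrM mulr_ile1.
  have K (q : R) : q <= 2 + dd * M -> q <= (2 + dd * M + 16 * dd * M ^+ 2) * trsq x.
    move=> hq; have h1 : 0 <= dd * M by rewrite mulr_ge0.
    have h2 : 0 <= 16 * dd * M ^+ 2 by rewrite !mulr_ge0// sqr_ge0.
    by rewrite (le_trans hq)//; nra.
  split; apply: K.
    rewrite (le_trans (ler_normB _ _))// lerD ?tr//.
    by rewrite (le_trans (ler_normB _ _))// normr1 -[leRHS]/(1 + 1) lerD2r ee// normr_cos_le1.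
  rewrite (le_trans (ler_normB _ _))// lerD ?tr//.
  by rewrite (le_trans (ee _ (normr_sin_le1 _ _)))// ler1n.
have tx : trunc x = x.
  by apply/rowP => k; rewrite trunc_small// leNgt h.
rewrite tx.
have M20 : 0 <= M ^+ 2 by exact: sqr_ge0.
have sq (c : 'I_(m + n) -> R) : (forall k, `|c k| <= M) -> dotN c x ^+ 2 <= dd * M ^+ 2 * trsq x.
  move=> cM; rewrite -real_normK ?num_real//.
  apply: (@le_trans _ _ ((M * \sum_k `|x ord0 k|) ^+ 2)).
    by rewrite ler_sqr ?nnegrE ?normr_dotN_le// (le_trans _ (normr_dotN_le _ _ _ cM)).
  rewrite exprMn [leRHS](_ : _ = M ^+ 2 * (dd * trsq x)); last by ring.
  have := sum_normr_sqr _ (fun k => x ord0 k); rewrite card_ord /trsq tx => h2.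
  by rewrite ler_wpM2l.
have a2 : dotN a x <= 2^-1 by rewrite (le_trans ax0).
have [h1 h2] := cexp_taylor _ (dotN b x) a2.
have sa := sq _ aM; have sb := sq _ bM.
have dM : 0 <= dd * M.
  rewrite /dd; case: (posnP (m + n)) => [e|p]; first by rewrite e mul0r.
  by rewrite mulr_ge0// (le_trans _ (aM (Ordinal p))).
have K (q : R) : q <= 8 * (dotN a x ^+ 2 + dotN b x ^+ 2) ->
    q <= (2 + dd * M + 16 * dd * M ^+ 2) * trsq x.
  have : 0 <= dd * M * trsq x by rewrite mulr_ge0.
  by move=> ? ?; lra.
by split; apply: K.
Qed.

End StateSpace.

Lemma Rintegral_bigsum d (T : measurableType d) (R : realType)
    (mu : {measure set T -> \bar R}) (D : set T) (I : Type) (r : seq I) (f : I -> T -> R) :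
  measurable D -> (forall i, mu.-integrable D (EFin \o f i)) ->
  mu.-integrable D (EFin \o (fun x => \sum_(i <- r) f i x)) /\
  Rintegral mu D (fun x => \sum_(i <- r) f i x) = \sum_(i <- r) Rintegral mu D (f i).
Proof.
move=> mD fi; elim: r => [|i r [IH1 IH2]].
  rewrite big_nil (_ : (fun x => \sum_(i <- [::]) f i x) = cst 0); last first.
    by apply/funext => x; rewrite big_nil.
  by split; [exact: integrable0|rewrite Rintegral_cst// mul0r].
have -> : (fun x => \sum_(k <- i :: r) f k x) = (fun x => f i x + \sum_(k <- r) f k x).
  by apply/funext => x; rewrite big_cons.
split; last by rewrite RintegralD// IH2 big_cons.
exact: (integrableD mD (fi i) IH1).
Qed.

Lemma integrable_normr d (T : measurableType d) (R : realType)
    (mu : {measure set T -> \bar R}) (D : set T) (f : T -> R) :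
  measurable D -> mu.-integrable D (EFin \o f) ->
  mu.-integrable D (EFin \o (fun x => `|f x|)).
Proof. by move=> mD If; apply: eq_integrable (integrable_norm If). Qed.

(** Convexity of the exponential on the ray from 0 through [s]; it makes the jump part of [R_j]
    superhomogeneous. *)
Lemma expR_scale_ge (R : realType) (l s : R) : 1 <= l -> l * (expR s - 1) <= expR (l * s) - 1.
Proof.
move=> l1; have h1 := expR_ge1Dx ((l - 1) * s); have h2 := expR_ge1Dx (- s).
have e0 := expR_ge0 s.
have : expR s * (1 + (l - 1) * s) <= expR (l * s).
  rewrite (_ : l * s = s + (l - 1) * s); last by ring.
  by rewrite expRD ler_wpM2l.
have : expR s * (1 - s) <= 1.
  by rewrite -[leRHS]expR0 -(subrr s) expRD ler_wpM2l.
move=> a b; have : (l - 1) * (expR s * (1 - s)) <= l - 1.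
  by rewrite -[leRHS]mulr1 ler_wpM2l// subr_ge0.
lra.
Qed.

(** * Measures integrating the squared truncation *)

Section LevyMeasure.
Context {R : realType} {m n : nat}.
Local Notation vec := 'rV[R]_(m + n).
Local Notation Bv := (Bvec R m n).
Local Notation D0 := (@stateD0 R m n).
Variable mu : {measure set Bv -> \bar R}.
Hypothesis mu_trsq : (\int[mu]_(x in D0) (trsq x)%:E < +oo)%E.

Lemma integrable_trsq : mu.-integrable (D0 : set Bv) (EFin \o (@trsq R m n : Bv -> R)).
Proof.
apply/integrableP; split.
  by apply/measurable_EFinP; apply: measurable_funTS; exact: measurable_trsq.
by under eq_integral do rewrite /= ger0_norm ?trsq_ge0//.
Qed.

Lemma integrable_levy (f : Bv -> R) (C : R) : measurable_fun setT f ->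
  (forall x, stateD x -> `|f x| <= C * trsq x) -> mu.-integrable (D0 : set Bv) (EFin \o f).
Proof.
move=> mf fC; apply: le_integrable (integrableZl measurable_stateD0 C integrable_trsq).
- exact: measurable_stateD0.
- by apply/measurable_EFinP; exact: measurable_funTS.
- by move=> x [Dx _] /=; rewrite lee_fin (le_trans (fC _ Dx))// ler_norm.
Qed.

Lemma normr_Rintegral_levy (f : Bv -> R) (C : R) : measurable_fun setT f ->
  (forall x, stateD x -> `|f x| <= C * trsq x) ->
  `|Rintegral mu D0 f| <= C * Rintegral mu D0 (@trsq R m n : Bv -> R).
Proof.
move=> mf fC; have If := integrable_levy f C mf fC.
rewrite (le_trans (le_normr_Rintegral measurable_stateD0 If))//.
rewrite -RintegralZl; [|exact: measurable_stateD0|exact: integrable_trsq].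
apply: le_Rintegral; [exact: measurable_stateD0| | |by move=> x [Dx _]; exact: fC].
- exact: (integrable_normr _ _ _ _ _ _ measurable_stateD0 If).
- by apply: (integrableZl measurable_stateD0 C integrable_trsq).
Qed.

(** [trsq] is positive on [D0], so the sets [trsq >= 1 / (k + 1)] exhaust it, and each has finite
    mass by Markov's inequality. *)
Lemma sigma_finite_levy : mu (~` D0) = 0%E -> sigma_finite (setT : set Bv) mu.
Proof.
move=> mu0.
pose F (k : nat) : set Bv := (~` D0) `|` (D0 `&` [set x | k.+1%:R^-1 <= trsq x]).
have mE (k : nat) : measurable (D0 `&` [set x | k.+1%:R^-1 <= trsq x] : set Bv).
  apply: measurableI; first exact: measurable_stateD0.
  have := @measurable_trsq R m n measurableT _ (measurable_itv `[(k.+1%:R^-1 : R), +oo[).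
  rewrite setTI; congr measurable; apply/seteqP; split => x /=;
    by rewrite in_itv/= andbT.
have mC : measurable (~` D0 : set Bv) by apply: measurableC; exact: measurable_stateD0.
exists F.
  apply/seteqP; split => // x _.
  have [Dx|nDx] := pselect (D0 x); last by exists 0%N => //; left.
  have t0 : 0 < trsq x.
    rewrite lt_neqAle trsq_ge0 andbT eq_sym; apply/negP => /eqP t0.
    case: Dx => _; apply; apply/rowP => k; rewrite mxE.
    have : trunc x ord0 k ^+ 2 = 0.
      by move/psumr_eq0P : t0; apply => // i _; exact: sqr_ge0.
    move/eqP; rewrite sqrf_eq0 => /eqP tk.
    have [h|h] := leP `|x ord0 k| 1; first by rewrite -tk trunc_small.
    move: h tk; rewrite trunc_coord lter_normr => /orP[h|h].
      by rewrite min_l ?(ltW h)// max_r; lra.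
    by rewrite min_r ?max_l; lra.
  exists (Num.truncn (trsq x)^-1) => //; right; split => //=.
  rewrite invf_ple ?posrE ?ltr0n//; apply/ltW; exact: truncnS_gt.
move=> k; split; first exact: measurableU.
pose S : set Bv := D0 `&` [set x | (k.+1%:R^-1 : R) <= trsq x].
have E : (mu S < +oo)%E.
  have : ((k.+1%:R^-1)%:E * mu S <= \int[mu]_(x in D0) (trsq x)%:E)%E.
    rewrite -integral_cst; last exact: mE.
    apply: (@le_trans _ _ (\int[mu]_(x in S) (trsq x)%:E)%E).
      apply: ge0_le_integral => //; first exact: mE.
      - by move=> x _; rewrite lee_fin invr_ge0 ler0n.
      - by apply/measurable_EFinP; apply: measurable_funTS; exact: measurable_trsq.
      - by move=> x [_ /=]; rewrite lee_fin.
    apply: ge0_subset_integral => //.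
    - exact: mE.
    - exact: measurable_stateD0.
    - by apply/measurable_EFinP; apply: measurable_funTS; exact: measurable_trsq.
    - by move=> x _; rewrite lee_fin trsq_ge0.
    - by move=> x [].
  move=> /le_lt_trans/(_ mu_trsq); have [->|h _] := eqVneq (mu S) +oo%E; last by rewrite ltey.
  by rewrite gt0_muley// lte_fin invr_gt0 ltr0n.
apply: le_lt_trans (measureU2 _ _ _) _ => //.
by rewrite [X in (X + _)%E](_ : _ = 0%E) ?add0e//; exact: mu0.
Qed.

End LevyMeasure.

(** * Real and imaginary parts of [R_j], superhomogeneity and quasi-monotonicity *)

Section Rparts.
Context {R : realType} {m n : nat}.
Local Notation vec := 'rV[R]_(m + n).
Local Notation Bv := (Bvec R m n).
Local Notation D0 := (@stateD0 R m n).

Lemma measurable_dotN (c : 'I_(m + n) -> R) :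
  measurable_fun (setT : set Bv) (fun x : Bv => dotN c (x : vec)) /\
  measurable_fun (setT : set Bv) (fun x : Bv => dotN c (trunc (x : vec))).
Proof.
split; apply: measurable_sum => k; apply: measurable_funM => //.
  exact: measurable_coord.
exact: measurable_trunc.
Qed.

Definition levy_re (a b : 'I_(m + n) -> R) (x : vec) : R :=
  expR (dotN a x) * cos (dotN b x) - 1 - dotN a (trunc x).
Definition levy_im (a b : 'I_(m + n) -> R) (x : vec) : R :=
  expR (dotN a x) * sin (dotN b x) - dotN b (trunc x).

Lemma measurable_levy (a b : 'I_(m + n) -> R) :
  measurable_fun (setT : set Bv) (levy_re a b : Bv -> R) /\
  measurable_fun (setT : set Bv) (levy_im a b : Bv -> R).
Proof.
have [ma ma'] := measurable_dotN a; have [mb mb'] := measurable_dotN b.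
have me : measurable_fun (setT : set Bv) (fun x : Bv => expR (dotN a (x : vec))).
  by apply: measurableT_comp ma.
split.
  apply: measurable_funB => //; apply: measurable_funB => //.
  by apply: measurable_funM => //; exact: measurable_fun_cos.
apply: measurable_funB => //.
by apply: measurable_funM => //; exact: measurable_fun_sin.
Qed.

Definition rep (u : 'I_(m + n) -> R[i]) k : R := complex.Re (u k).
Definition imp (u : 'I_(m + n) -> R[i]) k : R := complex.Im (u k).

Variables (alpha : 'I_(m + n).+1 -> 'M[R]_(m + n)) (beta : 'I_(m + n).+1 -> vec).
Variables (gamma : 'I_(m + n).+1 -> R) (kappa : 'I_(m + n).+1 -> {measure set Bv -> \bar R}).
Local Notation Rf := (Rfun alpha beta gamma kappa).

Definition quad (j : 'I_(m + n).+1) (a b : 'I_(m + n) -> R) : R :=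
  \sum_k \sum_l alpha j k l * a k * b l.
Definition lin (j : 'I_(m + n).+1) (a : 'I_(m + n) -> R) : R :=
  \sum_k beta j ord0 k * a k.

Lemma Rfun_parts j u :
  complex.Re (Rf j u) = 2^-1 * (quad j (rep u) (rep u) - quad j (imp u) (imp u)) +
    lin j (rep u) - gamma j + Rintegral (kappa j) D0 (levy_re (rep u) (imp u)) /\
  complex.Im (Rf j u) = 2^-1 * (quad j (rep u) (imp u) + quad j (imp u) (rep u)) +
    lin j (imp u) + Rintegral (kappa j) D0 (levy_im (rep u) (imp u)).
Proof.
rewrite /Rfun !complexReD !complexImD !complexReN !complexImN !complexReM !complexImM !complexRe_sum !complexIm_sum /=.
rewrite !mul0r subr0 addr0 oppr0 addr0; split; congr (_ + _).
- congr (_ + _ - _).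
    congr (_ * _); rewrite /quad -sumrB; apply: eq_bigr => k _.
    rewrite complexRe_sum -sumrB; apply: eq_bigr => l _; rewrite !complexReM/= !complexImM/=; ring.
  by apply: eq_bigr => k _; rewrite complexReM/= mul0r subr0.
- apply: eq_Rintegral => x _; rewrite !complexReD !complexReN/= !Re_cdot !Im_cdot//.
- congr (_ + _).
    congr (_ * _); rewrite /quad -big_split/=; apply: eq_bigr => k _.
    rewrite complexIm_sum -big_split/=; apply: eq_bigr => l _; rewrite !complexImM/= !complexReM/=; ring.
  by apply: eq_bigr => k _; rewrite complexImM/= mul0r addr0.
- apply: eq_Rintegral => x _; rewrite !complexImD !complexImN/= oppr0 addr0 !Re_cdot !Im_cdot//.
Qed.

Lemma Rfun0 j : Rf j (fun=> 0) = (- gamma j)%:C.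
Proof.
have z x : dotN (fun _ : 'I_(m + n) => 0 : R) x = 0 by apply: big1 => k _; rewrite mul0r.
have q0 : quad j (fun=> 0) (fun=> 0) = 0.
  by apply: big1 => k _; apply: big1 => l _; rewrite mulr0.
have l0 : lin j (fun=> 0) = 0 by apply: big1 => k _; rewrite mulr0.
have [hr hi] := Rfun_parts j (fun=> 0).
have r0 : rep (fun=> 0) = (fun=> 0) by [].
have i0 : imp (fun=> 0) = (fun=> 0) by [].
have re0 : levy_re (fun=> 0) (fun=> 0) = cst 0.
  by apply/funext => x; rewrite /levy_re !z expR0 cos0 mulr1 subrr subr0.
have im0 : levy_im (fun=> 0) (fun=> 0) = cst 0.
  by apply/funext => x; rewrite /levy_im !z sin0 mulr0 subrr.
have mD := @measurable_stateD0 R m n.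
have RE : complex.Re (Rf j (fun=> 0)) = - gamma j.
  by rewrite hr r0 i0 q0 l0 re0 Rintegral_cst// mul0r addr0 subrr mulr0 !add0r.
have IM : complex.Im (Rf j (fun=> 0)) = 0.
  by rewrite hi r0 i0 q0 l0 im0 Rintegral_cst// mul0r !addr0 mulr0.
by move: RE IM; case: (Rf j _) => a b /= -> ->.
Qed.

Hypothesis adm : admissible alpha beta gamma kappa.

Lemma admissible_trsq j : (\int[kappa j]_(x in D0) (trsq x)%:E < +oo)%E.
Proof.
case: adm => _ [_ [_ [_ [_ [h0 [h _]]]]]].
have [jm|jm] := leqP j m; first exact: h.
rewrite null_set_integral ?ltry//; last by apply: h0 => //; exact: measurable_stateD0.
- exact: measurable_stateD0.
- by apply/measurable_EFinP; apply: measurable_funTS; exact: measurable_trsq.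
Qed.

Lemma admissible_sigma_finite j : sigma_finite (setT : set Bv) (kappa j).
Proof.
apply: sigma_finite_levy; first exact: admissible_trsq.
by case: adm => _ [_ [_ [_ [h _]]]].
Qed.

(** The exponents for which [e^{<u,x>}] is bounded on [D]; the last [n] real parts must vanish
    because [D] contains both directions of these axes. *)
Definition in_U (u : 'I_(m + n) -> R[i]) :=
  forall k : 'I_(m + n), (rep u k <= 0) /\ ((m <= k)%N -> rep u k = 0).

Lemma in_U_dotN u x : in_U u -> stateD x -> dotN (rep u) x <= 0.
Proof.
move=> Uu Dx; apply: sumr_le0 => k _; have [h1 h2] := Uu k.
have [km|km] := ltnP k m; last by rewrite h2// mul0r.
by apply: mulr_le0_ge0 => //; exact: Dx.
Qed.

(** [R] may fail to be Lipschitz up to the boundary of [in_U]; boundedness on boxes is what the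
    continuation argument for [psi] relies on instead. *)
Lemma Rfun_bounded (M : R) : exists2 C, 0 <= C & forall j u, in_U u ->
  (forall k, `|rep u k| <= M) -> (forall k, `|imp u k| <= M) ->
  `|complex.Re (Rf j u)| <= C /\ `|complex.Im (Rf j u)| <= C.
Proof.
pose Q j := \sum_k \sum_l `|alpha j k l|.
pose L j := \sum_k `|beta j ord0 k|.
pose K j := Rintegral (kappa j) D0 (@trsq R m n : Bv -> R).
pose C j := Q j * M ^+ 2 + L j * `|M| + `|gamma j| + `|levy_cst (m := m) (n := n) M| * `|K j|.
have C0 j : 0 <= C j.
  rewrite !addr_ge0// mulr_ge0//.
  - by apply: sumr_ge0 => k _; apply: sumr_ge0.
  - exact: sqr_ge0.
  - exact: sumr_ge0.
exists (\sum_j C j); first exact: sumr_ge0.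
move=> j u Uu ru iu.
have qb (a b : 'I_(m + n) -> R) : (forall k, `|a k| <= M) -> (forall k, `|b k| <= M) ->
    `|quad j a b| <= Q j * M ^+ 2.
  move=> ha hb; rewrite (le_trans (ler_norm_sum _ _ _))// mulr_suml ler_sum// => k _.
  rewrite (le_trans (ler_norm_sum _ _ _))// mulr_suml ler_sum// => l _.
  by rewrite !normrM -mulrA ler_wpM2l// expr2 ler_pM.
have lb (a : 'I_(m + n) -> R) : (forall k, `|a k| <= M) -> `|lin j a| <= L j * `|M|.
  move=> ha; rewrite (le_trans (ler_norm_sum _ _ _))// mulr_suml ler_sum// => k _.
  by rewrite normrM ler_wpM2l// (le_trans (ha k))// ler_norm.
have kb := normr_Rintegral_levy (kappa j) (admissible_trsq j).
have K1 : levy_cst (m := m) (n := n) M * K j <= `|levy_cst (m := m) (n := n) M| * `|K j|.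
  by rewrite -normrM ler_norm.
have [m1 m2] := measurable_levy (rep u) (imp u).
have lev x : stateD x -> _ := fun Dx => levy_integrand_le _ _ _ _ ru iu (in_U_dotN _ _ Uu Dx).
have I1 : `|Rintegral (kappa j) D0 (levy_re (rep u) (imp u))| <= levy_cst (m := m) (n := n) M * K j.
  by apply: kb => // x Dx; have [] := lev x Dx.
have I2 : `|Rintegral (kappa j) D0 (levy_im (rep u) (imp u))| <= levy_cst (m := m) (n := n) M * K j.
  by apply: kb => // x Dx; have [] := lev x Dx.
have Cj : C j <= \sum_j C j.
  by rewrite [leRHS](bigD1 j)//= lerDl sumr_ge0.
have [-> ->] := Rfun_parts j u.
have H (a b c e a' b' c' e' : R) : `|a| <= 2 * a' -> `|b| <= b' -> `|c| <= c' -> `|e| <= e' ->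
    `|2^-1 * a + b - c + e| <= a' + b' + c' + e'.
  by rewrite !ler_norml => /andP[? ?] /andP[? ?] /andP[? ?] /andP[? ?]; apply/andP; split; lra.
have q2 (a b a' b' : 'I_(m + n) -> R) : (forall k, `|a k| <= M) -> (forall k, `|b k| <= M) ->
   (forall k, `|a' k| <= M) -> (forall k, `|b' k| <= M) ->
   `|quad j a b + quad j a' b'| <= 2 * (Q j * M ^+ 2) /\ `|quad j a b - quad j a' b'| <= 2 * (Q j * M ^+ 2).
  move=> h1 h2 h3 h4; have := qb _ _ h1 h2; have := qb _ _ h3 h4.
  by rewrite !ler_norml => /andP[? ?] /andP[? ?]; split; apply/andP; split; lra.
split; apply: le_trans Cj.
  apply: (H _ _ (gamma j)); [by have [] := q2 _ _ _ _ ru ru iu iu|exact: lb| by []|].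
  exact: le_trans I1 K1.
apply: (le_trans (y := Q j * M ^+ 2 + L j * `|M| + 0 + `|levy_cst (m := m) (n := n) M| * `|K j|)); last first.
  by rewrite /C; have := normr_ge0 (gamma j); lra.
rewrite -[X in `|X + _|]subr0.
apply: H; [by have [] := q2 _ _ _ _ ru iu iu ru|exact: lb|by rewrite normr0|].
exact: le_trans I2 K1.
Qed.

Definition extR (v : 'I_m -> R) (k : 'I_(m + n)) : R :=
  match fintype.split k with inl i => v i | inr _ => 0 end.

Lemma extR_lshift v i : extR v (lshift n i) = v i.
Proof. by rewrite /extR split_lshift. Qed.

Lemma extR_rshift v i : extR v (rshift m i) = 0.
Proof. by rewrite /extR split_rshift. Qed.

Lemma dotN_extR v x : dotN (extR v) x = \sum_(i < m) v i * x ord0 (lshift n i).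
Proof.
rewrite /dotN big_split_ord/= [X in _ + X]big1 ?addr0.
  by apply: eq_bigr => i _; rewrite extR_lshift.
by move=> i _; rewrite extR_rshift mul0r.
Qed.

Lemma dotN_extR_le0 v x : (forall i, v i <= 0) -> stateD x -> dotN (extR v) x <= 0.
Proof.
move=> v0 Dx; rewrite dotN_extR; apply: sumr_le0 => i _.
by apply: mulr_le0_ge0 => //; apply: Dx => /=.
Qed.

Definition Rreal (j : 'I_(m + n).+1) (v : 'I_m -> R) : R :=
  2^-1 * quad j (extR v) (extR v) + lin j (extR v) - gamma j +
  Rintegral (kappa j) D0 (fun x => expR (dotN (extR v) x) - 1 - dotN (extR v) (trunc x)).

Lemma rep_ext0 v : rep (ext0 v) = extR v.
Proof. by apply/funext => k; rewrite /rep /ext0 /extR; case: fintype.split. Qed.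

Lemma imp_ext0 v : imp (ext0 v) = (fun=> 0).
Proof. by apply/funext => k; rewrite /imp /ext0; case: fintype.split. Qed.

Lemma Re_Rfun_ext0 j v : complex.Re (Rf j (ext0 v)) = Rreal j v.
Proof.
have [-> _] := Rfun_parts j (ext0 v).
have q0 : quad j (fun=> 0) (fun=> 0) = 0.
  by apply: big1 => k _; apply: big1 => l _; rewrite mulr0.
rewrite rep_ext0 imp_ext0 q0 subr0 /Rreal; congr (_ + _).
apply: eq_Rintegral => x _; rewrite /levy_re.
by rewrite (_ : dotN (fun=> 0) x = 0) ?cos0 ?mulr1//; apply: big1 => k _; rewrite mul0r.
Qed.

Lemma integrable_levy_real j v : (forall i, v i <= 0) ->
  (kappa j).-integrable (D0 : set Bv)
    (EFin \o (fun x : Bv => expR (dotN (extR v) x) - 1 - dotN (extR v) (trunc (x : vec)))).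
Proof.
move=> v0; pose M := \sum_i `|v i|.
have vM k : `|extR v k| <= M.
  rewrite /extR; case: fintype.split => [i|_]; last by rewrite normr0 sumr_ge0.
  by rewrite /M (bigD1 i)//= lerDl sumr_ge0.
have oM (k : 'I_(m + n)) : `|0 : R| <= M by rewrite normr0 sumr_ge0.
have [m1 m2] := measurable_dotN (extR v).
apply: (integrable_levy _ (admissible_trsq j) _ (levy_cst (m := m) (n := n) M)).
  by do 2 apply: measurable_funB => //; exact: measurableT_comp m1.
move=> x Dx; have [h _] := levy_integrand_le _ (fun=> 0) _ _ vM oM (dotN_extR_le0 _ _ v0 Dx).
apply: le_trans h; rewrite (_ : dotN (fun=> 0) x = 0) ?cos0 ?mulr1//.
by apply: big1 => k _; rewrite mul0r.
Qed.

Lemma dotNZ (l : R) (c : 'I_(m + n) -> R) x : dotN (fun k => l * c k) x = l * dotN c x.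
Proof. by rewrite /dotN mulr_sumr; apply: eq_bigr => k _; rewrite mulrA. Qed.

Lemma quad_ge0 j (a : 'I_(m + n) -> R) : 0 <= quad j a a.
Proof.
case: adm => _ [h _]; have := h j (\row_k a k); rewrite mxE.
congr (0 <= _); rewrite /quad exchange_big/=; apply: eq_bigr => l _.
rewrite mxE mulr_suml; apply: eq_bigr => k _; rewrite !mxE; ring.
Qed.

(** [R_j] is convex along rays and vanishes at 0: the quadratic and the jump part are
    superhomogeneous, the linear part is homogeneous. *)
Lemma Rreal_scale j v (l : R) : (forall i, v i <= 0) -> gamma j = 0 -> 1 <= l ->
  l * Rreal j v <= Rreal j (fun i => l * v i).
Proof.
move=> v0 g0 l1.
have lv0 i : l * v i <= 0 by rewrite mulr_ge0_le0// (le_trans ler01).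
have eE : extR (fun i => l * v i) = (fun k => l * extR v k).
  by apply/funext => k; rewrite /extR; case: fintype.split => // _; rewrite mulr0.
rewrite /Rreal g0 eE !subr0 !mulrDr.
have I1 := integrable_levy_real j _ v0; have I2 := integrable_levy_real j _ lv0.
apply: lerD; first apply: lerD.
- have -> : quad j (fun k => l * extR v k) (fun k => l * extR v k) = l ^+ 2 * quad j (extR v) (extR v).
    rewrite /quad mulr_sumr; apply: eq_bigr => k _; rewrite mulr_sumr.
    by apply: eq_bigr => i _; ring.
  have := quad_ge0 j (extR v); set q := quad _ _ _ => q0.
  have : l <= l ^+ 2 by rewrite expr2 ler_peMl// (le_trans ler01).
  by move=> ll; have := ler_wpM2r q0 ll; lra.
- rewrite le_eqVlt; apply/orP; left; apply/eqP; rewrite /lin mulr_sumr.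
  by apply: eq_bigr => k _; ring.
- rewrite eE in I2; rewrite -RintegralZl//; [|exact: measurable_stateD0].
  apply: le_Rintegral => //; first exact: measurable_stateD0.
    exact: (integrableZl measurable_stateD0 l I1).
  move=> x _; rewrite !dotNZ; have := @expR_scale_ge R l (dotN (extR v) x) l1; lra.
Qed.

(** Admissibility acts here. On the first [m] coordinates the diffusion matrix has only the entry at
    [(i, i)], so the quadratic part sees only [v i]. The compensator in the other coordinates is
    integrable and at most the drift, which leaves the monotone exponential. *)
Lemma Rreal_quasimonotone (i : 'I_m) (v w : 'I_m -> R) :
  (forall k, v k <= w k) -> (forall k, w k <= 0) -> v i = w i ->
  Rreal (lift ord0 (lshift n i)) v <= Rreal (lift ord0 (lshift n i)) w.
Proof.
move=> vw w0 vwi; set j := lift ord0 (lshift n i).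
have ji : nat_of_ord j = i.+1 by rewrite /j lift0.
have jm : (j <= m)%N by rewrite ji.
have v0 k : v k <= 0 by exact: le_trans (vw k) (w0 k).
case: adm => _ [_ [_ [ha [_ [_ [_ [hk [_ [hb _]]]]]]]]].
have qE : quad j (extR v) (extR v) = quad j (extR w) (extR w).
  rewrite /quad; apply: eq_bigr => k _; apply: eq_bigr => l _.
  rewrite /extR; case: (splitP k) => [k' kk'|k' _]; last by rewrite !mulr0 !mul0r.
  case: (splitP l) => [l' ll'|l' _]; last by rewrite !mulr0.
  have [/eqP ki|ki] := boolP (k' == i); last first.
    rewrite (ha j jm k l) ?mul0r// ?kk' ?ll'// => -[e1 _].
    by case/negP: ki; apply/eqP/val_inj; move: e1; rewrite ji => -[].
  have [/eqP li|li] := boolP (l' == i); last first.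
    rewrite (ha j jm k l) ?mul0r// ?kk' ?ll'// => -[_ e1].
    by case/negP: li; apply/eqP/val_inj; move: e1; rewrite ji => -[].
  by rewrite ki li vwi.
pose dl (k : 'I_m) := w k - v k.
have dl0 k : 0 <= dl k by rewrite subr_ge0.
have dli : dl i = 0 by rewrite /dl vwi subrr.
(* Coordinate [i] of the truncation need not be integrable, but its coefficient [dl i] is 0. *)
pose f (k : 'I_m) (x : Bv) := dl k * trunc (x : vec) ord0 (lshift n k).
have mD := @measurable_stateD0 R m n.
have kj k : k != i -> (lshift n k).+1 != j.
  by rewrite ji eqSS; apply: contra => /eqP e; apply/eqP/val_inj; exact: e.
have trint (k : 'I_m) : k != i -> (kappa j).-integrable (D0 : set Bv)
    (EFin \o (fun x : Bv => trunc (x : vec) ord0 (lshift n k))).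
  move=> ki; apply/integrableP; split.
    by apply/measurable_EFinP; apply: measurable_funTS; exact: measurable_trunc.
  by apply: hk => //=; exact: kj.
have fint k : (kappa j).-integrable (D0 : set Bv) (EFin \o f k).
  have [->|ki] := eqVneq k i.
    by apply: eq_integrable (integrable0 (kappa j) _) => // x _; rewrite /= /f dli mul0r.
  exact: (integrableZl mD (dl k) (trint k ki)).
have [Sint SE] := Rintegral_bigsum _ _ _ (kappa j) _ _ (index_enum 'I_m) f mD fint.
have Iv := integrable_levy_real j _ v0; have Iw := integrable_levy_real j _ w0.
set Fv := (fun x : Bv => expR (dotN (extR v) x) - 1 - _) in Iv.
set Fw := (fun x : Bv => expR (dotN (extR w) x) - 1 - _) in Iw.
(* Adding back the truncation terms leaves [e^{<w,x>} - e^{<v,x>}], which is nonnegative on [D]. *)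
have pos : 0 <= Rintegral (kappa j) D0 Fw - Rintegral (kappa j) D0 Fv + \sum_k Rintegral (kappa j) D0 (f k).
  rewrite -SE -RintegralB// -RintegralD//; last exact: (integrableB mD Iw Iv).
  apply: Rintegral_ge0 => x [Dx _]; rewrite /Fw /Fv.
  have -> : \sum_k f k x = dotN (extR w) (trunc (x : vec)) - dotN (extR v) (trunc (x : vec)).
    by rewrite !dotN_extR -sumrB; apply: eq_bigr => k _; rewrite -mulrBl.
  have : expR (dotN (extR v) x) <= expR (dotN (extR w) x).
    rewrite ler_expR !dotN_extR; apply: ler_sum => k _; rewrite ler_wpM2r//.
    by apply: Dx => /=.
  lra.
have linE : lin j (extR w) - lin j (extR v) = \sum_k beta j ord0 (lshift n k) * dl k.
  rewrite /lin -sumrB big_split_ord/= [X in _ + X]big1 ?addr0.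
    by apply: eq_bigr => k _; rewrite !extR_lshift -mulrBr.
  by move=> k _; rewrite !extR_rshift !mulr0 subrr.
have le : \sum_k Rintegral (kappa j) D0 (f k) <= \sum_k beta j ord0 (lshift n k) * dl k.
  apply: ler_sum => k _; have [->|ki] := eqVneq k i.
    rewrite dli mulr0 (_ : f i = cst 0) ?Rintegral_cst ?mul0r//.
    by apply/funext => x; rewrite /f dli mul0r.
  rewrite /f RintegralZl//; last exact: trint.
  rewrite mulrC ler_wpM2r// -subr_ge0; apply: hb => //=; exact: kj.
rewrite /Rreal qE -/Fv -/Fw; lra.
Qed.

End Rparts.

(** * Affine processes *)

Section MeasureComplements.
Context d (T : measurableType d) (R : realType) (mu : {measure set T -> \bar R}).

Lemma Rintegral_conull (D : set T) (f g : T -> R) :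
  measurable D -> mu (~` D) = 0%E ->
  measurable_fun setT f -> measurable_fun setT g -> (forall x, D x -> f x = g x) ->
  Rintegral mu D f = Rintegral mu setT g.
Proof.
move=> mD muD mf mg fg; rewrite /Rintegral integral_mkcond; congr fine.
apply: ae_eq_integral => //.
- by apply/(measurable_restrictT _ _).1 => //; apply/measurable_EFinP; exact: measurable_funTS.
- exact/measurable_EFinP.
exists (~` D); split => //; first exact: measurableC.
move=> x /= h Dx; apply: h => _; rewrite patchE mem_set//=.
by rewrite fg.
Qed.

Lemma normr_Rintegral_submass (D : set T) (f : T -> R) :
  measurable D -> (mu setT <= 1)%E -> measurable_fun setT f -> (forall x, `|f x| <= 1) ->
  `|Rintegral mu D f| <= 1.
Proof.
move=> mD mu1 mf f1.
have muD : (mu D <= 1)%E by rewrite (le_trans _ mu1)// le_measure// inE.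
have i1 : mu.-integrable D (EFin \o cst 1).
  apply/integrableP; split; first exact/measurable_EFinP.
  under eq_integral do rewrite /= normr1.
  by rewrite integral_cst// mul1e (le_lt_trans muD)// ltry.
have If : mu.-integrable D (EFin \o f).
  apply: le_integrable i1 => //; first by apply/measurable_EFinP; exact: measurable_funTS.
  by move=> x _; rewrite /= lee_fin normr1.
rewrite (le_trans (le_normr_Rintegral mD If))//.
rewrite (le_trans (le_Rintegral mD (integrable_normr _ _ _ _ _ _ mD If) i1 _))//.
rewrite Rintegral_cst// mul1r -lee_fin fineK//.
by rewrite ge0_fin_numE// (le_lt_trans muD)// ltry.
Qed.

Lemma Rintegral_mass1_gt0 (f : T -> R) : mu setT = 1%E ->
  measurable_fun setT f -> (forall x, 0 < f x) -> (forall x, f x <= 1) ->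
  0 < Rintegral mu setT f.
Proof.
move=> mu1 mf f0 f1; rewrite lt_neqAle Rintegral_ge0 ?andbT; last by move=> x _; exact/ltW.
rewrite eq_sym; apply/negP => /eqP f_0.
have If : mu.-integrable setT (EFin \o f).
  apply: (bounded_integrable_mass1 _ _ _ _ mu1 _ 1) => // x.
  by rewrite ger0_norm// ltW.
have : (\int[mu]_x `|(EFin \o f) x| = 0)%E.
  under eq_integral do rewrite /= ger0_norm ?(ltW (f0 _))//.
  by rewrite -[LHS]fineK ?(integrable_fin_num _ If)// -/(Rintegral mu setT f) f_0.
move/(ae_eq_integral_abs _ measurableT (measurable_int _ If)).1 => [N [mN N0 NS]].
have : (mu setT <= mu N)%E.
  apply: le_measure; rewrite ?inE// => x _; apply: NS => /= h.
  by have [/eqP] := h Logic.I; rewrite gt_eqF.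
by rewrite mu1 N0 lee_fin ler10.
Qed.

End MeasureComplements.

(** * Integration against a mixture of measures *)

Section Mixture.
Context d1 d2 (Y : measurableType d1) (Z : measurableType d2) (R : realType).
Variables (mu : {measure set Y -> \bar R}) (D : set Y) (K : Y -> {measure set Z -> \bar R}).
Variable nu : {measure set Z -> \bar R}.
Hypothesis mD : measurable D.
Hypothesis mK : forall A, measurable A -> measurable_fun D (fun y => K y A).
Hypothesis nuE : forall A, measurable A -> nu A = (\int[mu]_(y in D) K y A)%E.

Import HBSimple HBNNSimple.

(** Chapman-Kolmogorov is given on sets only; simple functions and monotone convergence extend it to
    nonnegative functions. *)
Lemma integral_mixture (f : Z -> \bar R) : measurable_fun setT f -> (forall z, 0 <= f z)%E ->
  (\int[nu]_z f z = \int[mu]_(y in D) \int[K y]_z f z)%E.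
Proof.
move=> mf f0.
pose f_ := nnsfun_approx measurableT mf.
have f_f (x : Z) : (EFin \o (fun k => f_ k x)) @ \oo --> f x.
  by apply: cvg_nnsfun_approx => // z _; exact: f0.
have nf_ (x : Z) : nondecreasing_seq (fun k => (f_ k x)%:E).
  by move=> a b ab; rewrite lee_fin; exact/lefP/nd_nnsfun_approx.
have limE (m : {measure set Z -> \bar R}) :
    (\int[m]_z f z = limn (fun k => \int[m]_z (f_ k z)%:E))%E.
  rewrite -monotone_convergence//.
  - by apply: eq_integral => z _; apply/esym/cvg_lim => //; exact: f_f.
  - by move=> k; exact/measurable_EFinP.
  - by move=> k z _; rewrite lee_fin.
have E (g : {nnsfun Z >-> R}) (m : {measure set Z -> \bar R}) :
    (\int[m]_z (g z)%:E = \sum_(x \in range g) x%:E * m (g @^-1` [set x]))%E.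
  by rewrite integralT_nnsfun sintegralE.
have mg (g : {nnsfun Z >-> R}) x : measurable_fun D (fun y => (x%:E * K y (g @^-1` [set x]))%E).
  by apply: measurable_funeM; apply: mK; exact: measurable_sfunP.
have Kge (g : {nnsfun Z >-> R}) x y : (0 <= x%:E * K y (g @^-1` [set x]))%E.
  have [x0|x0] := leP 0 x; first by rewrite mule_ge0// lee_fin.
  by rewrite preimage_nnfun0// measure0 mule0.
have mint (g : {nnsfun Z >-> R}) : measurable_fun D (fun y => (\int[K y]_z (g z)%:E)%E).
  under eq_fun do rewrite E.
  by apply: emeasurable_fsum => // x; exact: mg.
have step (g : {nnsfun Z >-> R}) :
    (\int[nu]_z (g z)%:E = \int[mu]_(y in D) \int[K y]_z (g z)%:E)%E.
  rewrite E; under [in RHS]eq_integral do rewrite E.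
  rewrite ge0_integral_fsum//.
  apply: eq_fsbigr => x _.
  rewrite nuE; last exact: measurable_sfunP.
  have [x0|x0] := leP 0 x.
    by rewrite ge0_integralZl// ?lee_fin//; apply: mK; exact: measurable_sfunP.
  rewrite preimage_nnfun0//.
  under eq_integral do rewrite measure0.
  by rewrite integral0 mule0; under eq_integral do rewrite measure0 mule0; rewrite integral0.
rewrite limE; under [in LHS]eq_fun do rewrite step.
rewrite -monotone_convergence//.
- by apply: eq_integral => y _; rewrite limE.
- by move=> k y _; apply: integral_ge0 => z _; rewrite lee_fin.
- move=> y _ a b ab; apply: ge0_le_integral => //.
  + by move=> z _; rewrite lee_fin.
  + by apply/measurable_EFinP.
  + by apply/measurable_EFinP.
  + by move=> z _; exact: nf_.
Qed.

End Mixture.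

Section AdditiveBounded.
Context {R : realType}.

(** From [k f(l) = f(k l) <= B] for all [k] follows [f <= 0], so an additive [f] is decreasing, and
    monotone additive functions are linear. *)
Lemma additive_bounded_linear (f : R -> R) (B : R) :
  (forall a b, 0 <= a -> 0 <= b -> f (a + b) = f a + f b) ->
  (forall a, 0 <= a -> f a <= B) ->
  forall l, 0 <= l -> f l <= 0 /\ f l = l * f 1.
Proof.
move=> fD fB.
have f0 : f 0 = 0 by have := fD 0 0 (lexx _) (lexx _); rewrite addr0; lra.
have fn k l : 0 <= l -> f (k%:R * l) = k%:R * f l.
  move=> l0; elim: k => [|k IH]; first by rewrite !mul0r.
  by rewrite -natr1 !mulrDl !mul1r fD ?mulr_ge0// IH.
have small (z b : R) : (forall k : nat, k%:R * z <= b) -> z <= 0.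
  move=> h; rewrite leNgt; apply/negP => z0.
  have := h (Num.truncn (b / z)).+1; apply/negP; rewrite -ltNge -ltr_pdivrMr//.
  exact: truncnS_gt.
have fle0 l : 0 <= l -> f l <= 0.
  move=> l0; apply: (small _ B) => k; rewrite -fn//; apply: fB.
  by rewrite mulr_ge0.
have fmono a b : 0 <= a -> a <= b -> f b <= f a.
  move=> a0 ab; rewrite -(subrKC a b) fD ?subr_ge0//.
  by rewrite gerDl fle0// subr_ge0.
move=> l l0; split; first exact: fle0.
(* Enclosing [k l] between consecutive integers [N] and [N + 1] leaves an error [|f 1|] independent
   of [k]. *)
have key k : `|k%:R * (f l - l * f 1)| <= `|f 1|.
  have kl : 0 <= k%:R * l by rewrite mulr_ge0.
  have := truncn_le (k%:R * l); rewrite kl => t1.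
  have t2 := ltW (truncnS_gt (k%:R * l)); set N := Num.truncn _ in t1 t2.
  have h1 := fmono _ _ (ler0n _ N) t1; have h2 := fmono _ _ kl t2.
  move: h1 h2; rewrite -[N%:R]mulr1 -[N.+1%:R]mulr1 !fn// => h1 h2.
  have f1 := fle0 1 ler01.
  have n1 : N.+1%:R = N%:R + 1 :> R by rewrite natr1.
  rewrite n1 in t2 h2; rewrite (ler0_norm f1) ler_norml.
  have := ler_wnM2r f1 t1; have := ler_wnM2r f1 t2.
  by move=> ? ?; apply/andP; split; lra.
apply/eqP; rewrite -subr_eq0 -normr_le0; apply: (small _ `|f 1|) => k.
by have := key k; rewrite normrM ger0_norm.
Qed.

End AdditiveBounded.

(** * First consequences of the affine property *)

Section AffineProcess.
Context {R : realType} {m n : nat}.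
Local Notation vec := 'rV[R]_(m + n).
Local Notation Bv := (Bvec R m n).
Local Notation D := (@stateD R m n).
Variables (p : R -> vec -> {measure set Bv -> \bar R}).
Variables (psi0 : R -> ('I_(m + n) -> R[i]) -> R[i]).
Variables (psi : R -> ('I_(m + n) -> R[i]) -> 'I_(m + n) -> R[i]).
Hypotheses (tf : transition_function p) (aff : affine_with p psi0 psi).

Lemma stateD_add (x y : vec) : D x -> D y -> D (x + y).
Proof. by move=> Dx Dy k km; rewrite mxE addr_ge0 ?Dx ?Dy. Qed.

Lemma stateD_scale (l : R) (x : vec) : 0 <= l -> D x -> D (l *: x).
Proof. by move=> l0 Dx k km; rewrite mxE mulr_ge0 ?Dx. Qed.

Lemma stateD_zero : D 0.
Proof. by move=> k _; rewrite mxE. Qed.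

Lemma stateD_delta (l : R) (k : 'I_(m + n)) : ((k < m)%N -> 0 <= l) ->
  D (l *: delta_mx ord0 k).
Proof.
move=> l0 j jm; rewrite !mxE eqxx/=; have [e|] := eqVneq j k; last by rewrite mulr0.
by rewrite mulr1 l0// -e.
Qed.

Lemma dotN_delta (c : 'I_(m + n) -> R) (l : R) k : dotN c (l *: delta_mx ord0 k) = l * c k.
Proof.
rewrite /dotN (bigD1 k)//= big1 ?addr0; first by rewrite !mxE !eqxx mulr1 mulrC.
by move=> j /negPf jk; rewrite !mxE eqxx jk/= !mulr0.
Qed.

Lemma dotND (c : 'I_(m + n) -> R) (x y : vec) : dotN c (x + y) = dotN c x + dotN c y.
Proof. by rewrite /dotN -big_split; apply: eq_bigr => k _; rewrite mxE mulrDr. Qed.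

Lemma cint_parts t u x : 0 <= t -> imag_vec u -> D x ->
  Rintegral (p t x) D (fun xi => cos (dotN (imp u) xi)) =
    expR (complex.Re (psi0 t u) + dotN (rep (psi t u)) x) *
    cos (complex.Im (psi0 t u) + dotN (imp (psi t u)) x) /\
  Rintegral (p t x) D (fun xi => sin (dotN (imp u) xi)) =
    expR (complex.Re (psi0 t u) + dotN (rep (psi t u)) x) *
    sin (complex.Im (psi0 t u) + dotN (imp (psi t u)) x).
Proof.
move=> t0 iu Dx; have := aff t u x t0 iu Dx.
have e (xi : vec) : complex.Re (cdot u xi) = 0.
  by rewrite Re_cdot big1// => k _; rewrite iu mul0r.
move=> E; have := congr1 (@complex.Re R) E; have := congr1 (@complex.Im R) E.
rewrite /= complexReD complexImD Re_cdot Im_cdot => hi hr.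
split; [rewrite -[RHS]hr|rewrite -[RHS]hi]; apply: eq_Rintegral => xi _ /=;
  by rewrite e expR0 mul1r Im_cdot.
Qed.

Lemma measurable_trig_dotN (c : 'I_(m + n) -> R) :
  measurable_fun (setT : set Bv) (fun xi : Bv => cos (dotN c (xi : vec))) /\
  measurable_fun (setT : set Bv) (fun xi : Bv => sin (dotN c (xi : vec))).
Proof.
by have [mc _] := measurable_dotN c; split; [exact: measurable_fun_cos|exact: measurable_fun_sin].
Qed.

(** The characteristic function is bounded, so the affine function [Re psi0 + <Re psi, x>] is
    bounded above on the cone [D], which restricts the signs of its slopes. *)
Lemma psi_in_U t u : 0 <= t -> imag_vec u -> in_U (psi t u).
Proof.
move=> t0 iu; have [tf1 _] := tf.
set r0 := complex.Re (psi0 t u); set c := rep (psi t u).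
have bnd x : D x -> r0 + dotN c x <= 1.
  move=> Dx; have [hc hs] := cint_parts t u x t0 iu Dx.
  have [mc ms] := measurable_trig_dotN (imp u).
  have h1 := normr_Rintegral_submass _ _ _ (p t x) D _ measurable_stateD (tf1 t x t0 Dx) mc
    (fun _ => normr_cos_le1 _ _).
  have h2 := normr_Rintegral_submass _ _ _ (p t x) D _ measurable_stateD (tf1 t x t0 Dx) ms
    (fun _ => normr_sin_le1 _ _).
  rewrite hc in h1; rewrite hs in h2; move: h1 h2; rewrite -/r0 -/c.
  set q := r0 + _; set th := _ + _ => h1 h2.
  (* The cosine and sine integrals are bounded separately, which gives 2 rather than 1; only
     uniformity in [x] matters. *)
  have E : expR q ^+ 2 <= 2.
    have -> : expR q ^+ 2 = `|expR q * cos th| ^+ 2 + `|expR q * sin th| ^+ 2.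
      by rewrite !real_normK ?num_real// !exprMn -mulrDr cos2Dsin2 mulr1.
    have := normr_ge0 (expR q * cos th); have := normr_ge0 (expR q * sin th); nra.
  have := expR_ge1Dx q; have := expR_ge0 q; nra.
have unb (z : R) : (forall l, 0 <= l -> r0 + l * z <= 1) -> z <= 0.
  move=> h; rewrite leNgt; apply/negP => z0.
  have L0 : 0 <= (`|r0| + 2) / z by rewrite divr_ge0 ?(ltW z0)// addr_ge0.
  have := h _ L0; rewrite divfK ?gt_eqF//; have := ler_norm (- r0); rewrite normrN; lra.
move=> k; have le0 : c k <= 0.
  apply: unb => l l0; rewrite -dotN_delta; apply: bnd; exact: stateD_delta.
split => // mk; apply/eqP; rewrite eq_le le0/= -oppr_le0; apply: unb => l l0.
rewrite mulrN -mulNr -dotN_delta; apply: bnd; apply: stateD_delta.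
by rewrite ltnNge mk.
Qed.

Lemma imag_vec0 : imag_vec (fun _ : 'I_(m + n) => 0 : R[i]).
Proof. by []. Qed.

Lemma mass_psi t x : 0 <= t -> D x ->
  fine (p t x D) = expR (complex.Re (psi0 t (fun=> 0)) + dotN (rep (psi t (fun=> 0))) x) *
    cos (complex.Im (psi0 t (fun=> 0)) + dotN (imp (psi t (fun=> 0))) x) /\
  0 = expR (complex.Re (psi0 t (fun=> 0)) + dotN (rep (psi t (fun=> 0))) x) *
    sin (complex.Im (psi0 t (fun=> 0)) + dotN (imp (psi t (fun=> 0))) x).
Proof.
move=> t0 Dx; have [<- <-] := cint_parts t _ x t0 imag_vec0 Dx.
have z (y : vec) : dotN (imp (fun _ : 'I_(m + n) => 0 : R[i])) y = 0.
  by rewrite /dotN big1// => k _; rewrite mul0r.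
split.
  rewrite (_ : (fun xi => _) = cst 1); last by apply/funext => y; rewrite z cos0.
  by rewrite Rintegral_cst ?mul1r//; exact: measurable_stateD.
rewrite (_ : (fun xi => _) = cst 0); last by apply/funext => y; rewrite z sin0.
by rewrite Rintegral_cst ?mul0r//; exact: measurable_stateD.
Qed.

(** The mass of [D] is real, so the phase [a + l b] is a multiple of [pi] for every [l >= 0]; a
    nonzero slope [b] would pass through [a + pi / 2] or [a - pi / 2]. *)
Lemma Im_psi0 t k : 0 <= t -> imp (psi t (fun=> 0)) k = 0.
Proof.
move=> t0; set a := complex.Im (psi0 t (fun=> 0)); set b := imp _ k.
have s0 l : 0 <= l -> sin (a + l * b) = 0.
  move=> l0; have Dx := stateD_delta l k (fun _ => l0).
  have [_ /esym/eqP] := mass_psi t _ t0 Dx.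
  by rewrite mulf_eq0 gt_eqF ?expR_gt0//= dotN_delta => /eqP.
have sa : sin a = 0 by have := s0 0 (lexx _); rewrite mul0r addr0.
have ca : cos a != 0.
  apply/eqP => ca; have := cos2Dsin2 a; rewrite sa ca !expr0n/= addr0 => /eqP.
  by rewrite eq_sym oner_eq0.
apply/eqP/negP => /negP b0.
have := s0 (pi / 2 / `|b|); rewrite !divr_ge0 ?pi_ge0// => /(_ isT).
rewrite sinD sa mul0r add0r => /eqP; rewrite mulf_eq0 (negPf ca)/= => /eqP.
have [bp|bn|] := ltgtP b 0; last by move/eqP; rewrite (negPf b0).
  rewrite ltr0_norm// invrN mulrN mulNr divfK// sinN sin_pihalf => /eqP.
  by rewrite oppr_eq0 oner_eq0.
by rewrite gtr0_norm// divfK// sin_pihalf => /eqP; rewrite oner_eq0.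
Qed.

End AffineProcess.

(** * One-sided derivatives and an a priori growth bound *)

Section Derivatives.
Context {R : realType}.

Lemma deriv_within_sub (S S' : set R) (f g : R -> R) (t l : R) :
  S' `<=` S -> S' t -> (forall s, S' s -> f s = g s) -> deriv_within S f t l ->
  deriv_within S' g t l.
Proof.
move=> SS St fg df e e0; have [dl dl0 h] := df e e0; exists dl => // q q0 Sq qd.
by rewrite -!fg//; apply: h => //; exact: SS.
Qed.

Lemma deriv_within_cst0 (f : R -> R) (t l : R) : 0 <= t -> (forall s, 0 <= s -> f s = 0) ->
  deriv_within [set s | 0 <= s] f t l -> l = 0.
Proof.
move=> t0 f0 df; apply/eqP/negP => /negP; rewrite -normr_gt0 => l0.
have [dl dl0 h] := df _ l0; have := h (dl / 2).
rewrite /= gt_eqF ?divr_gt0// ger0_norm ?divr_ge0 ?ltW//.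
have td : 0 <= t + dl / 2 by rewrite addr_ge0// divr_ge0// ltW.
rewrite !f0// subrr mul0r sub0r normrN ltxx => /(_ isT isT) hh.
have /hh : dl / 2 < dl by rewrite ltr_pdivrMr// ltr_pMr// ltr1n.
  by [].
by rewrite ltr_wpDl// divr_gt0.
Qed.

Lemma deriv_within_step (S : set R) (f : R -> R) (t l e : R) : deriv_within S f t l -> 0 < e ->
  exists2 d, 0 < d & forall s, S s -> `|s - t| < d -> `|f s - f t - l * (s - t)| <= e * `|s - t|.
Proof.
move=> df e0; have [dl dl0 h] := df e e0; exists dl => // s Ss sd.
have [->|st] := eqVneq s t; first by rewrite !subrr mulr0 subrr normr0 mulr0.
have h0 : s - t != 0 by rewrite subr_eq0.
have := h _ h0; rewrite subrKC => /(_ Ss sd)/ltW hh.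
rewrite (_ : _ - l * (s - t) = ((f s - f t) / (s - t) - l) * (s - t)).
  by rewrite normrM ler_wpM2r.
by rewrite mulrBl divfK.
Qed.

(* Continuation argument: the derivative is only bounded as long as the growth bound holds. *)
Lemma deriv_growth (I : finType) (T B : R) (f l : I -> R -> R) :
  0 <= B ->
  (forall i t, 0 <= t -> deriv_within [set s | 0 <= s] (f i) t (l i t)) ->
  (forall t, 0 <= t < T -> (forall i, `|f i t - f i 0| <= 2 * (B + 1) * t) ->
     forall i, `|l i t| <= B) ->
  forall t, 0 <= t < T -> forall i, `|f i t - f i 0| <= 2 * (B + 1) * t.
Proof.
move=> B0 df lB.
apply: real_induction => [i|t /andP[t0 tT] Ps i|t /andP[t0 tT] Ps].
- by rewrite subrr normr0 mulr0.
- rewrite leNgt; apply/negP => ft.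
  set e := `|f i t - f i 0| - 2 * (B + 1) * t in ft.
  have e0 : 0 < e by rewrite subr_gt0.
  have [d d0 hd] := deriv_within_step _ _ _ _ 1 (df i t (ltW t0)) ltr01.
  set M := `|l i t| + 1.
  have M0 : 0 < M by rewrite ltr_wpDl.
  (* Going back by [q] changes [f i] by at most [M q <= e / 2], half of the excess [e] at [t], so
     the bound would already fail at [t - q]. *)
  pose q := Num.min (t / 2) (Num.min (d / 2) (e / (2 * M))).
  have q0 : 0 < q by rewrite !lt_min !divr_gt0 ?mulr_gt0.
  have qt : q <= t / 2 by rewrite ge_min lexx.
  have qd : q <= d / 2 by rewrite ge_min; apply/orP; right; rewrite ge_min lexx.
  have qe : q * (2 * M) <= e.
    by rewrite -ler_pdivlMr ?mulr_gt0// ge_min; apply/orP; right; rewrite ge_min lexx orbT.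
  have eq : t - q - t = - q by ring.
  have sd : `|t - q - t| < d by rewrite eq normrN gtr0_norm//; lra.
  have S0 : 0 <= t - q by lra.
  have := hd _ S0 sd; rewrite eq normrN (gtr0_norm q0) mul1r => h1.
  have := Ps (t - q) _ i; rewrite S0 gtrBl q0 => /(_ isT) h2.
  have h3 : `|l i t * - q| = `|l i t| * q by rewrite normrM normrN (gtr0_norm q0).
  have h4 : `|f i t - f i 0| <= `|f i (t - q) - f i 0| + (`|f i (t - q) - f i t - l i t * - q| + `|l i t * - q|).
    rewrite (_ : f i t - f i 0 = (f i (t - q) - f i 0) - ((f i (t - q) - f i t - l i t * - q) + l i t * - q)); last by ring.
    by rewrite (le_trans (ler_normB _ _))// lerD2l ler_normD.
  have h5 : 2 * (B + 1) * (t - q) <= 2 * (B + 1) * t by rewrite ler_wpM2l ?mulr_ge0 ?addr_ge0// gerBl ltW.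
  rewrite h3 in h4; rewrite /M in qe; rewrite /e in qe.
  have : 0 <= `|l i t| by [].
  nra.
- have Pt := Ps t; rewrite t0 lexx in Pt; move: Pt => /(_ isT) Pt.
  have lt := lB t; rewrite t0 tT in lt; move: lt => /(_ isT Pt) lt.
  have step i : exists2 d, 0 < d & forall s, t < s < t + d -> `|f i s - f i t| <= (B + 1) * (s - t).
    have [d d0 hd] := deriv_within_step _ _ _ _ 1 (df i t t0) ltr01.
    exists d => // s /andP[ts sd].
    have st0 : 0 < s - t by rewrite subr_gt0.
    have := hd s; rewrite /= (le_trans t0 (ltW ts)) (gtr0_norm st0) ltrBlDl => /(_ isT sd) h1.
    have h2 : `|l i t * (s - t)| <= B * (s - t).
      by rewrite normrM (gtr0_norm st0) ler_wpM2r// ltW.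
    rewrite (_ : f i s - f i t = (f i s - f i t - l i t * (s - t)) + l i t * (s - t)); last by ring.
    by rewrite (le_trans (ler_normD _ _))//; lra.
  pose dd i := projT1 (cid2 (step i)).
  have dd0 i : 0 < dd i by rewrite /dd; case: cid2.
  have ddP i s : t < s < t + dd i -> `|f i s - f i t| <= (B + 1) * (s - t).
    by rewrite /dd; case: cid2 => d /= _; exact.
  exists (\big[Num.min/1]_i dd i); first by rewrite lt_bigmin.
  move=> s /andP[ts sd] _ i.
  have := ddP i s; rewrite ts (lt_le_trans sd) ?lerD2l ?bigmin_le_cond// => /(_ isT) h.
  rewrite (_ : f i s - f i 0 = (f i s - f i t) + (f i t - f i 0)); last by ring.
  rewrite (le_trans (ler_normD _ _))//; have := Pt i.
  have : 0 <= (B + 1) * (s - t) by rewrite mulr_ge0 ?subr_ge0 ?addr_ge0// ltW.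
  lra.
Qed.

End Derivatives.

(** * The Laplace transform of a conservative process *)

Lemma deriv_within_cvg (R : realType) (f : R -> R) (t l : R) (u : nat -> R) :
  deriv_within [set s | 0 <= s] f t l -> (forall k, 0 <= u k) ->
  u k @[k --> \oo] --> t -> f (u k) @[k --> \oo] --> f t.
Proof.
move=> df u0 ut.
have [d d0 hd] := deriv_within_step _ _ _ _ 1 df ltr01.
apply/cvgrPdist_lt => e e0.
set M := `|l| + 2.
have M0 : 0 < M by rewrite ltr_wpDl.
have q0 : 0 < Num.min d (e / M) by rewrite lt_min d0 divr_gt0.
near=> k.
have : `|t - u k| < Num.min d (e / M) by near: k; exact: (cvgrPdist_lt _ _).1 ut _ q0.
rewrite lt_min => /andP[h1 h2].
rewrite distrC in h1; rewrite distrC in h2; rewrite distrC.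
have h3 := hd (u k) (u0 k) h1.
rewrite (_ : f (u k) - f t = (f (u k) - f t - l * (u k - t)) + l * (u k - t)); last by ring.
rewrite (le_lt_trans (ler_normD _ _))// normrM.
move: h2; rewrite ltr_pdivlMr// /M => h2.
by have := normr_ge0 (u k - t); nra.
Unshelve. all: by end_near. Qed.

Lemma cvg_dotN (R : realType) (m n : nat) (c : nat -> 'I_(m + n) -> R)
    (l : 'I_(m + n) -> R) (x : 'rV[R]_(m + n)) :
  (forall k, c N k @[N --> \oo] --> l k) -> dotN (c N) x @[N --> \oo] --> dotN l x.
Proof.
move=> cl; rewrite /dotN; elim: (index_enum _) => [|k r IH].
  by rewrite big_nil; under eq_fun do rewrite big_nil; exact: cvg_cst.
rewrite big_cons; under eq_fun do rewrite big_cons.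
by apply: cvgD => //; apply: cvgMl; exact: cl.
Qed.

Section ConservativeProcess.
Context {R : realType} {m n : nat}.
Local Notation vec := 'rV[R]_(m + n).
Local Notation Bv := (Bvec R m n).
Local Notation D := (@stateD R m n).
Local Notation c0 := (@poisson_const R).
Variables (p : R -> vec -> {measure set Bv -> \bar R}).
Variables (psi0 : R -> ('I_(m + n) -> R[i]) -> R[i]).
Variables (psi : R -> ('I_(m + n) -> R[i]) -> 'I_(m + n) -> R[i]).
Hypotheses (tf : transition_function p) (aff : affine_with p psi0 psi).
Hypothesis cons : conservative p.

Lemma conservative_mass t x : 0 <= t -> D x -> p t x setT = 1%E.
Proof.
move=> t0 Dx; case: tf => h _; apply/eqP; rewrite eq_le h//=.
rewrite -(cons t x t0 Dx); apply: le_measure; rewrite ?inE//; exact: measurable_stateD.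
Qed.

Lemma Rintegral_stateD t x (f g : Bv -> R) : 0 <= t -> D x ->
  measurable_fun setT f -> measurable_fun setT g -> (forall y, D y -> f y = g y) ->
  Rintegral (p t x) D f = Rintegral (p t x) setT g.
Proof.
move=> t0 Dx mf mg fg; apply: Rintegral_conull => //; first exact: measurable_stateD.
by case: tf => _ [h _]; exact: h.
Qed.

(** Taking positive parts makes the form nonnegative on the whole space and not only on [D], as the
    Laplace lemmas require; on [D] it is [<(a, 0), x>]. *)
Definition dotpos (a : 'I_m -> R) (x : vec) : R :=
  \sum_i a i * Num.max 0 (x ord0 (lshift n i)).

Lemma measurable_dotpos a : measurable_fun (setT : set Bv) (dotpos a : Bv -> R).
Proof.
apply: measurable_sum => i; apply: measurable_funM => //.
by apply: measurable_maxr => //; exact: measurable_coord.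
Qed.

Lemma dotpos_ge0 a x : (forall i, 0 <= a i) -> 0 <= dotpos a x.
Proof.
by move=> a0; apply: sumr_ge0 => i _; rewrite mulr_ge0// le_max lexx.
Qed.

Lemma dotposE a x : D x -> dotpos a x = dotN (extR a) x.
Proof.
move=> Dx; rewrite dotN_extR; apply: eq_bigr => i _; rewrite max_r//.
by apply: Dx => /=.
Qed.

Lemma dotposZ (l : R) a x : dotpos (fun i => l * a i) x = l * dotpos a x.
Proof. by rewrite /dotpos mulr_sumr; apply: eq_bigr => i _; rewrite mulrA. Qed.

Lemma dotN0 (c : 'I_(m + n) -> R) : dotN c 0 = 0.
Proof. by apply: big1 => k _; rewrite mxE mulr0. Qed.

Definition Lap t a x : R := Rintegral (p t x) setT (fun y : Bv => expR (- dotpos a y)).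

Definition uvec (a : 'I_m -> R) (w : R) : 'I_(m + n) -> R[i] :=
  fun k => 0 +i* (w * extR a k).

Lemma imag_uvec a w : imag_vec (uvec a w).
Proof. by []. Qed.

Definition char_re t a x w :=
  Rintegral (p t x) setT (fun y : Bv => cos (w * dotpos a y)).
Definition char_im t a x w :=
  Rintegral (p t x) setT (fun y : Bv => sin (w * dotpos a y)).
Definition expo_re t a x w :=
  complex.Re (psi0 t (uvec a w)) + dotN (rep (psi t (uvec a w))) x.
Definition expo_im t a x w :=
  complex.Im (psi0 t (uvec a w)) + dotN (imp (psi t (uvec a w))) x.

Lemma char_parts t a x w : 0 <= t -> D x ->
  char_re t a x w = expR (expo_re t a x w) * cos (expo_im t a x w) /\
  char_im t a x w = expR (expo_re t a x w) * sin (expo_im t a x w).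
Proof.
move=> t0 Dx; have [<- <-] := cint_parts _ _ _ aff t _ x t0 (imag_uvec a w) Dx.
have [mc ms] := measurable_trig_dotN (m := m) (n := n) (imp (uvec a w)).
have e y : D y -> dotN (imp (uvec a w)) y = w * dotpos a y.
  by move=> Dy; rewrite dotposE// -dotNZ.
have my : measurable_fun setT (fun y : Bv => w * dotpos a y).
  by apply: measurable_funM => //; exact: measurable_dotpos.
split; apply/esym/Rintegral_stateD => //; try by move=> y Dy; rewrite e.
  exact: measurable_fun_cos.
exact: measurable_fun_sin.
Qed.

Lemma Lap_poisson t a x : 0 <= t -> D x -> (forall i, 0 <= a i) ->
  tame (char_re t a x) (char_im t a x) 1 /\
  poisson (char_re t a x) (char_im t a x) = c0 * Lap t a x.
Proof.
move=> t0 Dx a0; apply: (laplace_poisson _ _ _ (conservative_mass _ _ t0 Dx)).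
  exact: measurable_dotpos.
by move=> y; exact: dotpos_ge0.
Qed.

(** The affine form of the exponent gives the same identity for characteristic functions, and the
    product formula carries it over. The multiplicative form avoids taking a complex logarithm. *)
Lemma Lap_mul t a x y : 0 <= t -> D x -> D y -> (forall i, 0 <= a i) ->
  Lap t a x * Lap t a y = Lap t a (x + y) * Lap t a 0.
Proof.
move=> t0 Dx Dy a0.
have P x' y' : D x' -> D y' -> _ := fun Dx' Dy' => laplace_product _ _ _ _
  (p t x') (p t y') (dotpos a) (dotpos a)
  (conservative_mass _ _ t0 Dx') (conservative_mass _ _ t0 Dy')
  (measurable_dotpos a) (measurable_dotpos a) (fun z => dotpos_ge0 a z a0)
  (fun z => dotpos_ge0 a z a0).
have Dxy := stateD_add _ _ Dx Dy; have D0 := @stateD_zero R m n.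
have c00 : c0 != 0 by rewrite gt_eqF// poisson_const_gt0.
apply: (mulfI c00).
rewrite -[LHS](P x y Dx Dy) -[RHS](P _ _ Dxy D0).
have er w : expo_re t a (x + y) w + expo_re t a 0 w = expo_re t a x w + expo_re t a y w.
  by rewrite /expo_re !dotND dotN0; ring.
have ei w : expo_im t a (x + y) w + expo_im t a 0 w = expo_im t a x w + expo_im t a y w.
  by rewrite /expo_im !dotND dotN0; ring.
apply: eq_poisson => w; rewrite -!/(char_re _ _ _ _) -!/(char_im _ _ _ _);
  have [-> ->] := char_parts t a x w t0 Dx;
  have [-> ->] := char_parts t a y w t0 Dy; have [-> ->] := char_parts t a _ w t0 Dxy;
  have [-> ->] := char_parts t a _ w t0 D0.
  rewrite [LHS](_ : _ = expR (expo_re t a x w + expo_re t a y w) * cos (expo_im t a x w + expo_im t a y w)).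
    by rewrite -er -ei expRD cosD; ring.
  by rewrite expRD cosD; ring.
rewrite [LHS](_ : _ = expR (expo_re t a x w + expo_re t a y w) * sin (expo_im t a x w + expo_im t a y w)).
  by rewrite -er -ei expRD sinD; ring.
by rewrite expRD sinD; ring.
Qed.

Lemma expN_dotpos_bounds a : (forall i, 0 <= a i) ->
  [/\ measurable_fun setT (fun y : Bv => expR (- dotpos a y)),
      (forall y, 0 < expR (- dotpos a y)) & (forall y, expR (- dotpos a y) <= 1)].
Proof.
move=> a0; split.
- apply: measurableT_comp => //; apply: measurableT_comp => //.
  exact: measurable_dotpos.
- by move=> y; exact: expR_gt0.
- by move=> y; rewrite expR_le1 oppr_le0 dotpos_ge0.
Qed.

Lemma Lap_gt0 t a x : 0 <= t -> D x -> (forall i, 0 <= a i) -> 0 < Lap t a x.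
Proof.
move=> t0 Dx a0; have [h1 h2 h3] := expN_dotpos_bounds a a0.
exact: (Rintegral_mass1_gt0 _ _ _ _ _ (conservative_mass _ _ t0 Dx)).
Qed.

Lemma integrable_expN_dotpos t a x : 0 <= t -> D x -> (forall i, 0 <= a i) ->
  (p t x).-integrable setT (EFin \o (fun y : Bv => expR (- dotpos a y))).
Proof.
move=> t0 Dx a0; have [h1 h2 h3] := expN_dotpos_bounds a a0.
apply: (bounded_integrable_mass1 _ _ _ _ (conservative_mass _ _ t0 Dx) _ 1) => // y.
by rewrite gtr0_norm.
Qed.

Lemma Lap_le1 t a x : 0 <= t -> D x -> (forall i, 0 <= a i) -> Lap t a x <= 1.
Proof.
move=> t0 Dx a0; have [h1 h2 h3] := expN_dotpos_bounds a a0.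
rewrite (le_trans (ler_norm _))//.
apply: (normr_Rintegral_mass1 _ _ _ _ (conservative_mass _ _ t0 Dx)) => // y.
by rewrite gtr0_norm.
Qed.

Definition unitv (k : 'I_(m + n)) : vec := delta_mx ord0 k.

(* The exponent of the Laplace transform: [flow t a] plays the role of [- psi_I(t, -a)]. *)
Definition flow t a (i : 'I_m) : R :=
  ln (Lap t a 0) - ln (Lap t a (unitv (lshift n i))).

Lemma stateD_unitv k : D (unitv k).
Proof. by rewrite -[unitv k]scale1r; apply: stateD_delta => _; exact: ler01. Qed.

(** [E y = ln Lap y - ln Lap 0] is additive on [D], and bounded above because [Lap <= 1]; hence it
    is linear and nonpositive along every ray of [D]. *)
Lemma Lap_affine t a x : 0 <= t -> D x -> (forall i, 0 <= a i) ->
  (forall i, 0 <= flow t a i) /\ Lap t a x = Lap t a 0 * expR (- dotpos (flow t a) x).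
Proof.
move=> t0 Dx a0; have D0 := @stateD_zero R m n.
pose E y := ln (Lap t a y) - ln (Lap t a 0).
have L0 := Lap_gt0 t a _ t0 D0 a0.
have ED y z : D y -> D z -> E (y + z) = E y + E z.
  move=> Dy Dz; have Ly := Lap_gt0 t a _ t0 Dy a0; have Lz := Lap_gt0 t a _ t0 Dz a0.
  have Lyz := Lap_gt0 t a _ t0 (stateD_add _ _ Dy Dz) a0.
  have := congr1 (@ln R) (Lap_mul t a y z t0 Dy Dz a0).
  by rewrite !lnM ?posrE// /E; lra.
have Eb y : D y -> E y <= - ln (Lap t a 0).
  by move=> Dy; rewrite /E gerDr; apply: ln_le0; exact: Lap_le1.
have Elin y : D y -> forall l, 0 <= l -> E (l *: y) <= 0 /\ E (l *: y) = l * E y.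
  move=> Dy l l0.
  have := additive_bounded_linear (fun l => E (l *: y)) (- ln (Lap t a 0)) _ _ l l0.
  rewrite scale1r; apply.
  - by move=> b c hb hc; rewrite scalerDl ED//; exact: stateD_scale.
  - by move=> b hb; apply: Eb; exact: stateD_scale.
have Ele y : D y -> E y <= 0.
  by move=> Dy; have [] := Elin y Dy 1 ler01; rewrite scale1r.
have E0 : E 0 = 0 by have := ED 0 0 D0 D0; rewrite addr0; lra.
have flE i : flow t a i = - E (unitv (lshift n i)) by rewrite /flow /E opprB.
split; first by move=> i; rewrite flE oppr_ge0; apply: Ele; exact: stateD_unitv.
have Ek (k : 'I_(m + n)) : E (x ord0 k *: unitv k) =
    match fintype.split k with inl i => - (x ord0 k * flow t a i) | inr _ => 0 end.
  case: (splitP k) => [i ki|i ki].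
    have -> : k = lshift n i by exact: val_inj.
    rewrite flE mulrN opprK; have [] := Elin _ (stateD_unitv (lshift n i)) (x ord0 (lshift n i)) => //.
    by apply: Dx => /=.
  (* Along the last [n] axes both directions lie in [D], so [E] is nonpositive with both signs and
     vanishes. *)
  have km l : D (l *: unitv k) by apply: stateD_delta; rewrite ki ltnNge leq_addr.
  have h1 := Ele _ (km (x ord0 k)); have h2 := Ele _ (km (- x ord0 k)).
  have := ED _ _ (km (x ord0 k)) (km (- x ord0 k)); rewrite -scalerDl subrr scale0r E0; lra.
have Esum (r : seq 'I_(m + n)) : D (\sum_(k <- r) x ord0 k *: unitv k) /\
    E (\sum_(k <- r) x ord0 k *: unitv k) = \sum_(k <- r) E (x ord0 k *: unitv k).
  elim: r => [|k r [IH1 IH2]]; first by rewrite !big_nil.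
  have Dk : D (x ord0 k *: unitv k) by apply: stateD_delta => km; exact: Dx.
  by rewrite !big_cons ED// IH2; split => //; exact: stateD_add.
have Ex : E x = - dotpos (flow t a) x.
  rewrite {1}(row_sum_delta x) (Esum _).2 dotposE// dotN_extR.
  under eq_bigr do rewrite Ek.
  rewrite big_split_ord/= [X in _ + X]big1 ?addr0; last by move=> i _; rewrite split_rshift.
  by rewrite -sumrN; apply: eq_bigr => i _; rewrite split_lshift mulrC.
rewrite -Ex /E expRD expRN !lnK ?posrE ?Lap_gt0//.
by rewrite mulrCA divff ?mulr1// gt_eqF.
Qed.

Lemma flow_ge0 t a : 0 <= t -> (forall i, 0 <= a i) -> forall i, 0 <= flow t a i.
Proof. by move=> t0 a0; have [] := Lap_affine t a 0 t0 (@stateD_zero R m n) a0. Qed.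

(** In Chapman-Kolmogorov for [e^{-<a,y>}] the inner integral is [Lap t a 0] times the exponential
    with [flow t a] in place of [a]. *)
Lemma Lap_semigroup s t a x : 0 <= s -> 0 <= t -> D x -> (forall i, 0 <= a i) ->
  Lap (s + t) a x = Lap t a 0 * Lap s (flow t a) x.
Proof.
move=> s0 t0 Dx a0; have [h1 h2 h3] := expN_dotpos_bounds a a0.
have f0 := flow_ge0 t a t0 a0; have [k1 k2 k3] := expN_dotpos_bounds _ f0.
case: tf => _ [_ [_ [mK CK]]].
have E := integral_mixture _ _ _ _ _ (p s x) D (p t) (p (s + t) x) measurable_stateD
  (fun A mA => mK t A t0 mA) (fun A mA => CK s t x A s0 t0 Dx mA)
  (fun y : Bv => (expR (- dotpos a y))%:E).
rewrite /Lap /Rintegral E; last 2 first.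
- exact/measurable_EFinP.
- by move=> z; rewrite lee_fin ltW.
rewrite (eq_integral (fun y : Bv => (Lap t a 0 * expR (- dotpos (flow t a) y))%:E)); last first.
  move=> y /set_mem Dy; have [_ <-] := Lap_affine t a y t0 Dy a0.
  by rewrite /Lap /Rintegral fineK//; exact: (integrable_fin_num _ (integrable_expN_dotpos t a y t0 Dy a0)).
rewrite -/(Rintegral (p s x) D (fun y : Bv => Lap t a 0 * expR (- dotpos (flow t a) y))).
rewrite (Rintegral_stateD _ _ _ (fun y : Bv => Lap t a 0 * expR (- dotpos (flow t a) y)))//.
- by rewrite RintegralZl//; exact: integrable_expN_dotpos.
- exact: measurable_funM.
- exact: measurable_funM.
Qed.

Lemma flow_semigroup s t a i : 0 <= s -> 0 <= t -> (forall i, 0 <= a i) ->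
  flow (s + t) a i = flow s (flow t a) i.
Proof.
move=> s0 t0 a0; have f0 := flow_ge0 t a t0 a0; have D0 := @stateD_zero R m n.
have De := stateD_unitv (lshift n i).
rewrite /flow !Lap_semigroup// !lnM ?posrE ?Lap_gt0//; lra.
Qed.

Lemma Lap_time0 a x : D x -> Lap 0 a x = expR (- dotpos a x).
Proof.
move=> Dx; rewrite /Lap /Rintegral (eq_measure_integral (@dirac _ Bv x R)).
  rewrite integral_dirac// ?diracT ?mul1e//.
  by apply/measurable_EFinP; do 2 apply: measurableT_comp => //; exact: measurable_dotpos.
by move=> A mA _; case: tf => _ [_ [h _]]; exact: h.
Qed.

Lemma dotpos0 a : dotpos a 0 = 0.
Proof. by apply: big1 => i _; rewrite mxE max_r ?mulr0. Qed.

Lemma dotpos_unitv a i : dotpos a (unitv (lshift n i)) = a i.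
Proof.
rewrite dotposE; last exact: stateD_unitv.
by rewrite -[unitv _]scale1r dotN_delta mul1r extR_lshift.
Qed.

Lemma flow_time0 a i : flow 0 a i = a i.
Proof.
rewrite /flow !Lap_time0 ?dotpos0 ?dotpos_unitv; [|exact: stateD_unitv|exact: stateD_zero].
by rewrite !expRK oppr0 sub0r opprK.
Qed.

(** As the argument shrinks the transform recovers the total mass. That this mass is 1 makes
    [flow t a] tend to 0 with [a], which closes the comparison argument. *)
Lemma Lap_small (a : 'I_m -> R) t x : 0 <= t -> D x -> (forall i, 0 <= a i) ->
  Lap t (fun i => k.+1%:R^-1 * a i) x @[k --> \oo] --> (1 : R).
Proof.
move=> t0 Dx a0; have mass := conservative_mass _ _ t0 Dx.
have ka0 k i : 0 <= (k.+1%:R^-1 : R) * a i by rewrite mulr_ge0.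
suff : Rintegral (p t x) setT (fun y : Bv => expR (- dotpos (fun i => k.+1%:R^-1 * a i) y))
    @[k --> \oo] --> Rintegral (p t x) setT (cst (1 : R)).
  by rewrite (Rintegral_cst_mass1 _ _ _ (p t x) mass 1).
apply: (@Rintegral_dominated_cvg _ _ _ (p t x) _ _ (cst 1)).
- by move=> k; have [] := expN_dotpos_bounds _ (ka0 k).
- exact: measurable_cst.
- move=> y.
  have H : expR (- (k.+1%:R^-1 * dotpos a y)) @[k --> \oo] --> expR (- (0 * dotpos a y)).
    apply: continuous_cvg; first exact: continuous_expR.
    apply: cvgN; apply: cvgMl; exact: cvg_harmonic.
  rewrite mul0r oppr0 expR0 in H.
  by under eq_fun do rewrite dotposZ.
- by move=> k y; have [_ h1 h2] := expN_dotpos_bounds _ (ka0 k); rewrite gtr0_norm.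
- exact: integrable_cst_mass1.
Qed.

Variables (alpha : 'I_(m + n).+1 -> 'M[R]_(m + n)) (beta : 'I_(m + n).+1 -> vec).
Variables (gamma : 'I_(m + n).+1 -> R) (kappa : 'I_(m + n).+1 -> {measure set Bv -> \bar R}).
Hypothesis ric : riccati alpha beta gamma kappa psi0 psi.

Lemma expo_cvg (t : R) a x w (u : nat -> R) : 0 <= t -> (forall k, 0 <= u k) ->
  u k @[k --> \oo] --> t ->
  expo_re (u k) a x w @[k --> \oo] --> expo_re t a x w /\
  expo_im (u k) a x w @[k --> \oo] --> expo_im t a x w.
Proof.
move=> t0 u0 ut; have [_ [_ /(_ t t0) [hk [h0 h0']]]] := ric _ (imag_uvec a w).
split; apply: cvgD.
- exact: deriv_within_cvg h0 u0 ut.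
- apply: cvg_dotN => k; have [h _] := hk k; exact: deriv_within_cvg h u0 ut.
- exact: deriv_within_cvg h0' u0 ut.
- apply: cvg_dotN => k; have [_ h] := hk k; exact: deriv_within_cvg h u0 ut.
Qed.

(** Continuity in time comes from the differentiability of [psi0] and [psi], carried through the
    Poisson functional by dominated convergence. *)
Lemma Lap_cvg (t : R) a x (u : nat -> R) : 0 <= t -> D x -> (forall i, 0 <= a i) ->
  (forall k, 0 <= u k) -> u k @[k --> \oo] --> t ->
  Lap (u k) a x @[k --> \oo] --> Lap t a x.
Proof.
move=> t0 Dx a0 u0 ut.
have LE s : 0 <= s -> Lap s a x = c0^-1 * poisson (char_re s a x) (char_im s a x).
  move=> s0; have [_ ->] := Lap_poisson s a x s0 Dx a0.
  by rewrite mulKf// gt_eqF// poisson_const_gt0.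
rewrite LE//; under eq_fun do rewrite LE//.
apply: cvgMr; have [[mr mi _] _] := Lap_poisson t a x t0 Dx a0.
apply: (poisson_cvg _ _ _ _ 1) => //.
- by move=> k; have [] := Lap_poisson (u k) a x (u0 k) Dx a0.
- move=> w; have [-> _] := char_parts t a x w t0 Dx.
  rewrite (_ : (fun k => _) = fun k => expR (expo_re (u k) a x w) * cos (expo_im (u k) a x w)); last first.
    by apply/funext => k; have [] := char_parts (u k) a x w (u0 k) Dx.
  have [h1 h2] := expo_cvg t a x w u t0 u0 ut.
  by apply: cvgM; apply: continuous_cvg => //; [exact: continuous_expR|exact: continuous_cos].
- move=> w; have [_ ->] := char_parts t a x w t0 Dx.
  rewrite (_ : (fun k => _) = fun k => expR (expo_re (u k) a x w) * sin (expo_im (u k) a x w)); last first.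
    by apply/funext => k; have [] := char_parts (u k) a x w (u0 k) Dx.
  have [h1 h2] := expo_cvg t a x w u t0 u0 ut.
  by apply: cvgM; apply: continuous_cvg => //; [exact: continuous_expR|exact: continuous_sin].
Qed.

Lemma flow_cvg (t : R) a i (u : nat -> R) : 0 <= t -> (forall i, 0 <= a i) ->
  (forall k, 0 <= u k) -> u k @[k --> \oo] --> t ->
  flow (u k) a i @[k --> \oo] --> flow t a i.
Proof.
move=> t0 a0 u0 ut; have D0 := @stateD_zero R m n; have De := stateD_unitv (lshift n i).
apply: cvgB; apply: continuous_cvg; try exact: Lap_cvg;
  apply: continuous_ln; exact: Lap_gt0.
Qed.

End ConservativeProcess.

(** * Trigonometric inequalities at integer multiples of an angle *)

Section TrigMultiples.
Context {R : realType}.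
Implicit Types x : R.

Lemma normr_sin_natmul k x : `|sin (k%:R * x)| <= k%:R * `|sin x|.
Proof.
elim: k => [|k IH]; first by rewrite !mul0r sin0 normr0.
rewrite -natr1 !mulrDl !mul1r sinD (le_trans (ler_normD _ _))// !normrM lerD//.
  by rewrite (le_trans _ IH)// ler_piMr// normr_cos_le1.
by rewrite ler_piMl// normr_cos_le1.
Qed.

Lemma cosB1_natmul k x : 1 - cos (k%:R * x) <= k%:R ^+ 2 * (1 - cos x).
Proof.
rewrite !cosB1_half -(mulrA k%:R).
rewrite [leRHS](_ : _ = 2 * (k%:R * `|sin (x / 2)|) ^+ 2); last by ring.
by apply: ler_wpM2l => //; rewrite ler_sqr ?nnegrE ?mulr_ge0// normr_sin_natmul.
Qed.

(** The increment from [k] to [k + 1] is at most [(2k + 1)(1 - cos x)], and these odd numbers sum to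
    [k^2]. The part [2k] comes from half angles, since [1 - cos x = 2 sin(x/2)^2]. *)
Lemma sinB_natmul k x : `|sin (k%:R * x) - k%:R * sin x| <= k%:R ^+ 2 * (1 - cos x).
Proof.
have c0 : 0 <= 1 - cos x by rewrite subr_ge0 cos_le1.
elim: k => [|k IH]; first by rewrite !mulr0n !mul0r sin0 subrr normr0 expr0n/= mul0r.
rewrite -natr1 mulrDl mul1r sinD.
set K : R := k%:R; rewrite -/K in IH.
have h1 : `|sin (K * x) * (cos x - 1)| <= 1 - cos x.
  by rewrite normrM distrC (ger0_norm c0) ler_piMl// normr_sin_le1.
have h2 : `|sin x * (cos (K * x) - 1)| <= 2 * K * (1 - cos x).
  have cK : 0 <= 1 - cos (K * x) by rewrite subr_ge0 cos_le1.
  rewrite normrM (distrC (cos (K * x))) (ger0_norm cK).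
  have -> : `|sin x| = 2 * `|sin (x / 2)| * `|cos (x / 2)|.
    have -> : sin x = sin (x / 2 + x / 2) by congr sin; lra.
    rewrite sinD (_ : _ + _ = 2 * sin (x / 2) * cos (x / 2)); last by ring.
    by rewrite !normrM (ger0_norm (ler0n R 2)).
  rewrite !cosB1_half -(mulrA K x).
  have a1 := normr_sin_natmul k (x / 2); rewrite -/K in a1.
  have a2 := normr_sin_le1 _ (K * (x / 2)); have a3 := normr_cos_le1 _ (x / 2).
  have b1 := normr_ge0 (sin (K * (x / 2))); have b2 := normr_ge0 (sin (x / 2)).
  have b3 := normr_ge0 (cos (x / 2)).
  set S := `|sin (x / 2)| in a1 b2 *; set Q := `|sin (K * _)| in a1 a2 b1 *.
  set c := `|cos _| in a3 b3 *.
  have q2 : Q ^+ 2 <= K * S by rewrite expr2 (le_trans _ a1)// ler_piMr.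
  have Sc : S * c <= S by rewrite ler_piMr.
  have : (S * c) * Q ^+ 2 <= S * (K * S) by rewrite ler_pM// ?mulr_ge0// sqr_ge0.
  lra.
rewrite (_ : _ - _ = (sin (K * x) - K * sin x) + sin (K * x) * (cos x - 1) + sin x * (cos (K * x) - 1)); last by ring.
rewrite (le_trans (ler_normD _ _))// (le_trans (lerD (ler_normD _ _) (lexx _)))//.
lra.
Qed.

End TrigMultiples.

(** * The Poisson functional of [R_j] *)

Section PoissonR.
Context {R : realType} {m n : nat}.
Local Notation vec := 'rV[R]_(m + n).
Local Notation Bv := (Bvec R m n).
Local Notation D0 := (@stateD0 R m n).
Local Notation c0 := (@poisson_const R).
Variables (alpha : 'I_(m + n).+1 -> 'M[R]_(m + n)) (beta : 'I_(m + n).+1 -> vec).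
Variables (gamma : 'I_(m + n).+1 -> R) (kappa : 'I_(m + n).+1 -> {measure set Bv -> \bar R}).
Hypothesis adm : admissible alpha beta gamma kappa.
Local Notation Rf := (Rfun alpha beta gamma kappa).

Lemma Rintegral_patch (mu : {measure set Bv -> \bar R}) (f g : Bv -> R) :
  (forall x, D0 x -> f x = g x) -> (forall x, ~ D0 x -> g x = 0) ->
  Rintegral mu D0 f = Rintegral mu setT g.
Proof.
move=> fg g0; rewrite Rintegral_mkcond; apply: eq_Rintegral => x _.
rewrite patchE; case: ifPn => [/set_mem/fg//|/negP h].
by rewrite g0// => Dx; apply: h; rewrite inE.
Qed.

(** Along [u = iw(a, 0)] the function [R_j] is a polynomial of degree two in [iw] plus a Levy
    integral; the functional replaces [iw] by [-1] in both, and the rotation contributes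
    [e^{-y0}]. *)
Lemma poisson_Rfun j (a : 'I_m -> R) (y0 : R) : (forall i, 0 <= a i) -> 0 <= y0 ->
  let Fr w := complex.Re (Rf j (uvec (n := n) a w)) in
  let Fi w := complex.Im (Rf j (uvec (n := n) a w)) in
  (exists C, tame Fr Fi C) /\
  poisson (rotr y0 Fr Fi) (roti y0 Fr Fi) =
    c0 * expR (- y0) * Rreal alpha beta gamma kappa j (fun i => - a i).
Proof.
move=> a0 y00 Fr Fi; set ea := extR (n := n) a.
have [md mdt] := measurable_dotN (m := m) (n := n) ea.
have mD := @measurable_stateD0 R m n.
(* The integrands are cut off outside [D0], since the Poisson lemmas integrate over the whole space
   and ask for [0 <= s] everywhere. *)
pose s : Bv -> R := (fun x : Bv => dotN ea (x : vec)) \_ D0.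
pose h : Bv -> R := (fun x : Bv => dotN ea (trunc (x : vec))) \_ D0.
have sD x : D0 x -> s x = dotN ea x by move=> Dx; rewrite /s patchE mem_set.
have hD x : D0 x -> h x = dotN ea (trunc x) by move=> Dx; rewrite /h patchE mem_set.
have sN x : ~ D0 x -> s x = 0 by move=> Dx; rewrite /s patchE memNset.
have hN x : ~ D0 x -> h x = 0 by move=> Dx; rewrite /h patchE memNset.
have ea0 k : 0 <= ea k by rewrite /ea /extR; case: fintype.split.
have dn0 x : stateD x -> 0 <= dotN ea x.
  by move=> Dx; rewrite -dotposE//; exact: dotpos_ge0.
have s0 x : 0 <= s x.
  have [Dx|nD] := pselect (D0 x); last by rewrite sN.
  by rewrite sD//; apply: dn0; case: Dx.
pose A := \sum_i a i.
have A0 : 0 <= A by exact: sumr_ge0.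
have eaA k : `|ea k| <= A.
  rewrite ger0_norm// /ea /extR; case: fintype.split => // i.
  by rewrite /A (bigD1 i)//= lerDl sumr_ge0.
pose C := levy_cst (m := m) (n := n) A.
pose N : Bv -> R := (fun x : Bv => C * trsq (x : vec)) \_ D0.
have ND x : D0 x -> N x = C * trsq x by move=> Dx; rewrite /N patchE mem_set.
have NN x : ~ D0 x -> N x = 0 by move=> Dx; rewrite /N patchE memNset.
have dm0 : 0 <= (m + n)%:R * A :> R by rewrite mulr_ge0.
have dm1 : 0 <= (m + n)%:R * A ^+ 2 :> R by rewrite mulr_ge0// sqr_ge0.
(* At frequency [w] the exponent lies in the box of size [|w| A], whose constant grows at most
   quadratically in [w], as tameness demands. *)
have Cw (w : R) : levy_cst (m := m) (n := n) (`|w| * A) <= C * (1 + w ^+ 2).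
  rewrite /C /levy_cst exprMn real_normK ?num_real//.
  have := ler_wpM2l dm0 (normr_le_1Dsq _ w); have := mulr_ge0 dm1 (sqr_ge0 w); have := sqr_ge0 w.
  nra.
have bnd (x : Bv) w : `|cos (w * s x) - 1| <= N x * (1 + w ^+ 2) /\
    `|sin (w * s x) - w * h x| <= N x * (1 + w ^+ 2).
  have [Dx|nD] := pselect (D0 x); last first.
    by rewrite sN// hN// NN// !mulr0 mul0r cos0 sin0 !subrr normr0.
  rewrite sD// hD// ND// mulrAC.
  have M0 (k : 'I_(m + n)) : `|0 : R| <= `|w| * A by rewrite normr0 mulr_ge0.
  have M1 k : `|w * ea k| <= `|w| * A by rewrite normrM ler_wpM2l.
  have z (y : vec) : dotN (fun _ : 'I_(m + n) => 0 : R) y = 0.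
    by apply: big1 => k _; rewrite mul0r.
  have [] := levy_integrand_le _ _ _ x M0 M1; first by rewrite z.
  rewrite !z expR0 !mul1r !subr0 !dotNZ => h1 h2.
  have K : levy_cst (m := m) (n := n) (`|w| * A) * trsq x <= C * (1 + w ^+ 2) * trsq x.
    by rewrite ler_wpM2r ?trsq_ge0.
  by split; [apply: le_trans h1 K|apply: le_trans h2 K].
have ms : measurable_fun setT s by apply/(measurable_restrictT _ _).1 => //; exact: measurable_funTS.
have mh : measurable_fun setT h by apply/(measurable_restrictT _ _).1 => //; exact: measurable_funTS.
have iN : (kappa j).-integrable setT (EFin \o N).
  have := (integrable_mkcond _ mD).1 (integrableZl mD C (integrable_trsq _ (admissible_trsq _ _ _ _ adm j))).
  by rewrite (restrict_EFin (fun x : Bv => C * trsq (x : vec))).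
pose Ic w := Rintegral (kappa j) setT (fun x => cos (w * s x) - 1).
pose Is w := Rintegral (kappa j) setT (fun x => sin (w * s x) - w * h x).
have [tI PL] := poisson_levy _ _ (kappa j) s h N y0
   (admissible_sigma_finite _ _ _ _ adm j) ms mh iN s0 y00 bnd.
rewrite -/Ic -/Is in tI PL.
pose q := quad alpha j ea ea; pose l := lin beta j ea.
have FrE w : Fr w = - (2^-1 * q) * w ^+ 2 - gamma j + Ic w.
  rewrite /Fr; have [-> _] := Rfun_parts alpha beta gamma kappa j (uvec a w).
  have -> : quad alpha j (rep (uvec a w)) (rep (uvec a w)) = 0.
    by apply: big1 => k _; apply: big1 => i _; rewrite mulr0.
  have -> : quad alpha j (imp (uvec a w)) (imp (uvec a w)) = w ^+ 2 * q.
    rewrite /q /quad mulr_sumr; apply: eq_bigr => k _; rewrite mulr_sumr.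
    by apply: eq_bigr => i _; rewrite /imp /uvec/= -/ea; ring.
  have -> : lin beta j (rep (uvec a w)) = 0 by apply: big1 => k _; rewrite mulr0.
  rewrite (Rintegral_patch _ _ (fun x => cos (w * s x) - 1)).
  - by rewrite -/(Ic w); ring.
  - move=> x Dx; rewrite /levy_re sD//.
    rewrite (_ : dotN (rep (uvec a w)) x = 0); last by apply: big1 => k _; rewrite mul0r.
    rewrite (_ : dotN (rep (uvec a w)) (trunc x) = 0); last by apply: big1 => k _; rewrite mul0r.
    by rewrite expR0 mul1r subr0 (dotNZ w ea).
  - by move=> x nD; rewrite sN// mulr0 cos0 subrr.
have FiE w : Fi w = l * w + Is w.
  rewrite /Fi; have [_ ->] := Rfun_parts alpha beta gamma kappa j (uvec a w).
  have -> : quad alpha j (rep (uvec a w)) (imp (uvec a w)) = 0.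
    by apply: big1 => k _; apply: big1 => i _; rewrite mulr0 mul0r.
  have -> : quad alpha j (imp (uvec a w)) (rep (uvec a w)) = 0.
    by apply: big1 => k _; apply: big1 => i _; rewrite mulr0.
  have -> : lin beta j (imp (uvec a w)) = l * w.
    by rewrite /l /lin mulr_suml; apply: eq_bigr => k _; rewrite /imp /uvec/= -/ea; ring.
  rewrite (Rintegral_patch _ _ (fun x => sin (w * s x) - w * h x)).
  - by rewrite -/(Is w); ring.
  - move=> x Dx; rewrite /levy_im sD// hD//.
    rewrite (_ : dotN (rep (uvec a w)) x = 0); last by apply: big1 => k _; rewrite mul0r.
    by rewrite expR0 mul1r !(dotNZ w ea).
  - by move=> x nD; rewrite sN// hN// !mulr0 sin0 subrr.
split.
  eexists; apply: eq_tame (tameD (tame_expoly (- gamma j) l (2^-1 * q) 0) tI) => w.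
    by rewrite FrE /expoly_re mulr0 cos0 sin0; ring.
  by rewrite FiE /expoly_im mulr0 cos0 sin0; ring.
have -> : Rreal alpha beta gamma kappa j (fun i => - a i) =
   2^-1 * q - l - gamma j + Rintegral (kappa j) setT (fun x => expR (- s x) - 1 + h x).
  have eN : extR (n := n) (fun i => - a i) = (fun k => - 1 * ea k).
    by apply/funext => k; rewrite /ea /extR; case: fintype.split => *; rewrite ?mulN1r ?oppr0.
  rewrite /Rreal eN; congr (_ * _ + _ - _ + _).
  - rewrite /q /quad; apply: eq_bigr => k _; apply: eq_bigr => i _; ring.
  - by rewrite /l /lin -sumrN; apply: eq_bigr => k _; ring.
  - apply: Rintegral_patch.
      by move=> x Dx; rewrite sD// hD// !dotNZ !mulN1r opprK.
    by move=> x nD; rewrite sN// hN// oppr0 expR0 subrr addr0.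
set J := Rintegral (kappa j) setT (fun x => expR (- s x) - 1 + h x) in PL *.
rewrite [RHS](_ : _ = c0 * expR (- y0) * (- gamma j - l + 2^-1 * q) + c0 * expR (- y0) * J); last by ring.
rewrite -PL -poisson_expoly// -(poissonD (tame_expoly _ _ _ _) (tame_rot y0 tI)).
by apply: eq_poisson => w; rewrite /rotr /roti FrE FiE /expoly_re /expoly_im; ring.
Qed.

End PoissonR.

(** * Its derivative at time zero *)

Section QuotientLimits.
Context {R : realType}.

Lemma deriv_within_quotient (f : R -> R) (l : R) (h : nat -> R) :
  deriv_within [set s | 0 <= s] f 0 l -> (forall k, 0 < h k) -> h k @[k --> \oo] --> (0 : R) ->
  (h k)^-1 * (f (h k) - f 0) @[k --> \oo] --> l.
Proof.
move=> df h0 hc; apply/cvgrPdist_lt => e e0; have [d d0 hd] := df e e0.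
near=> k.
have hk : `|h k| < d by near: k; exact: cvgr0_norm_lt.
have := hd (h k); rewrite gt_eqF//= !add0r => /(_ isT (ltW (h0 k)) hk).
by rewrite distrC mulrC.
Unshelve. all: by end_near. Qed.

Lemma cexp_quotient_cvg (r d h : nat -> R) (x y : R) : (forall k, 0 < h k) ->
  h k @[k --> \oo] --> (0 : R) ->
  (h k)^-1 * r k @[k --> \oo] --> x -> (h k)^-1 * d k @[k --> \oo] --> y ->
  (h k)^-1 * (expR (r k) * cos (d k) - 1) @[k --> \oo] --> x /\
  (h k)^-1 * (expR (r k) * sin (d k)) @[k --> \oo] --> y.
Proof.
move=> h0 hc rx dy.
have rE k : r k = h k * ((h k)^-1 * r k) by rewrite mulVKf// gt_eqF.
have r0 : r k @[k --> \oo] --> (0 : R).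
  have E : r = fun k => h k * ((h k)^-1 * r k) by apply/funext.
  have H : h k * ((h k)^-1 * r k) @[k --> \oo] --> 0 * x by exact: cvgM.
  by rewrite mul0r in H; rewrite E.
(* The Taylor remainder [8 (r^2 + d^2)] divided by [h], written through the convergent quotients so
   that the spare factor [h] is visible. *)
pose E k := 8 * h k * ((h k)^-1 * r k * ((h k)^-1 * r k) + (h k)^-1 * d k * ((h k)^-1 * d k)).
have Ec : E k @[k --> \oo] --> (0 : R).
  have H : E k @[k --> \oo] --> 8 * 0 * (x * x + y * y).
    apply: cvgM; first exact: cvgMr.
    by apply: cvgD; exact: cvgM.
  by rewrite mulr0 mul0r in H.
have T k : r k <= 2^-1 ->
    `|(h k)^-1 * (expR (r k) * cos (d k) - 1) - (h k)^-1 * r k| <= E k /\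
    `|(h k)^-1 * (expR (r k) * sin (d k)) - (h k)^-1 * d k| <= E k.
  move=> rk; have [t1 t2] := cexp_taylor _ (d k) rk.
  have EE : E k = (h k)^-1 * (8 * (r k ^+ 2 + d k ^+ 2)).
    by rewrite /E; field; rewrite gt_eqF.
  by split; rewrite -mulrBr normrM (gtr0_norm (_ : 0 < (h k)^-1)) ?invr_gt0// EE ler_wpM2l// invr_ge0 ltW.
have lim (f g : nat -> R) (z : R) : (forall k, r k <= 2^-1 -> `|f k - g k| <= E k) ->
    g k @[k --> \oo] --> z -> f k @[k --> \oo] --> z.
  move=> fg gz.
  have : (f k - g k) @[k --> \oo] --> (0 : R).
    apply: (@squeeze_cvgr _ _ _ _ (fun k => - E k) E); last exact: Ec.
      near=> k; rewrite -ler_norml; apply: fg; apply: ltW; near: k.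
      by apply: (cvgr_lt (0 : R)) => //; rewrite invr_gt0.
    have H : - E k @[k --> \oo] --> - (0 : R) by exact: cvgN.
    by rewrite oppr0 in H.
  move=> fg0; have H : f k - g k + g k @[k --> \oo] --> 0 + z by exact: cvgD.
  have fE : f = fun k => f k - g k + g k by apply/funext => k; rewrite subrK.
  by rewrite add0r in H; rewrite fE.
split; [apply: lim rx => k /T[]//|apply: lim dy => k /T[]//].
Unshelve. all: by end_near. Qed.

End QuotientLimits.

Section LaplaceDerivative.
Context {R : realType} {m n : nat}.
Local Notation vec := 'rV[R]_(m + n).
Local Notation Bv := (Bvec R m n).
Local Notation D := (@stateD R m n).
Local Notation c0 := (@poisson_const R).
Variables (p : R -> vec -> {measure set Bv -> \bar R}).
Variables (psi0 : R -> ('I_(m + n) -> R[i]) -> R[i]).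
Variables (psi : R -> ('I_(m + n) -> R[i]) -> 'I_(m + n) -> R[i]).
Hypotheses (tf : transition_function p) (aff : affine_with p psi0 psi).
Hypothesis cons : conservative p.
Variables (alpha : 'I_(m + n).+1 -> 'M[R]_(m + n)) (beta : 'I_(m + n).+1 -> vec).
Variables (gamma : 'I_(m + n).+1 -> R) (kappa : 'I_(m + n).+1 -> {measure set Bv -> \bar R}).
Hypothesis adm : admissible alpha beta gamma kappa.
Hypothesis ric : riccati alpha beta gamma kappa psi0 psi.
Local Notation Rf := (Rfun alpha beta gamma kappa).
Local Notation Rre := (Rreal alpha beta gamma kappa).

(** For [|w| <= 1] all initial values lie in one box. [M] enlarges it by 1, [B] bounds [R] on the
    enlarged box, and up to time [1 / (2 (B + 1))] the displacement stays below 1. *)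
Lemma psi_local_bound (a : 'I_m -> R) : exists C T : R, [/\ 0 <= C, 0 < T &
  forall h w, 0 <= h < T -> `|w| <= 1 ->
    [/\ `|complex.Re (psi0 h (uvec a w))| <= C * h, `|complex.Im (psi0 h (uvec a w))| <= C * h &
      forall k, `|rep (psi h (uvec a w)) k| <= C * h /\
        `|imp (psi h (uvec a w)) k - w * extR a k| <= C * h]].
Proof.
pose M := \sum_i `|a i| + 1.
have M1 : 1 <= M by rewrite lerDr sumr_ge0.
have eaM k : `|extR (n := n) a k| + 1 <= M.
  rewrite lerD2r /extR; case: fintype.split => i.
    by rewrite (bigD1 i)//= lerDl sumr_ge0.
  by rewrite normr0 sumr_ge0.
have [B B0 hB] := Rfun_bounded _ _ _ _ adm M.
have B1 : 0 < B + 1 by rewrite ltr_wpDl.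
exists (2 * (B + 1)), (2 * (B + 1))^-1; split.
- by rewrite mulr_ge0// ltW.
- by rewrite invr_gt0 mulr_gt0.
move=> h w hh w1.
have [u0 [p0 du]] := ric _ (imag_uvec (n := n) a w).
set u := uvec a w in u0 p0 du *.
pose part (b : bool) (z : R[i]) : R := if b then complex.Re z else complex.Im z.
(* The growth bound treats a finite family of real functions at once: [None] stands for [psi0],
   [Some k] for a coordinate of [psi], the boolean for real or imaginary part. *)
pose f (x : option 'I_(m + n) * bool) t :=
  part x.2 (match x.1 with Some k => psi t u k | None => psi0 t u end).
pose l (x : option 'I_(m + n) * bool) t :=
  part x.2 (match x.1 with Some k => Rf (lift ord0 k) (psi t u) | None => Rf ord0 (psi t u) end).
have G := deriv_growth _ (2 * (B + 1))^-1 B f l B0.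
have /G{}G : forall i t, 0 <= t -> deriv_within [set s | 0 <= s] (f i) t (l i t).
  move=> [[k|] b] t t0; have [hk [h1 h2]] := du t t0; last by case: b.
  by have [h3 h4] := hk k; case: b.
have {}G : forall t, 0 <= t < (2 * (B + 1))^-1 -> forall i, `|f i t - f i 0| <= 2 * (B + 1) * t.
  apply: G => t /andP[t0 tT] ft.
  have le1 : 2 * (B + 1) * t <= 1.
    by rewrite mulrC -ler_pdivlMr ?mulr_gt0// div1r ltW.
  have U := psi_in_U p psi0 psi tf aff t u t0 (imag_uvec a w).
  have br k : `|rep (psi t u) k| <= M.
    have := ft (Some k, true); rewrite /f/= u0 /= subr0 => /le_trans; apply.
    exact: le_trans le1 M1.
  have bi k : `|imp (psi t u) k| <= M.
    have := ft (Some k, false); rewrite /f/= u0 /= => H.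
    have H2 := le_trans H le1.
    rewrite (le_trans _ (eaM k))// -[imp _ _](subrK (w * extR a k)) addrC.
    rewrite (le_trans (ler_normD _ _))// lerD// normrM ler_piMl//.
  move=> [[k|] b]; [have [h1 h2] := hB (lift ord0 k) _ U br bi|have [h1 h2] := hB ord0 _ U br bi];
    by case: b.
have {}G i := G h hh i.
split.
- by have := G (None, true); rewrite /f/= p0 subr0.
- by have := G (None, false); rewrite /f/= p0 subr0.
move=> k; split.
  by have := G (Some k, true); rewrite /f/= u0 subr0.
by have := G (Some k, false); rewrite /f/= u0.
Qed.

(** For [x] in [D] the subtracted term is the imaginary exponent at time 0, so the phase is of the
    order of the elapsed time. *)
Definition phase t a x w := expo_im psi0 psi t a x w - w * dotpos a x.

Lemma expo_local_bound (a : 'I_m -> R) (x : vec) : D x ->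
  exists C T : R, [/\ 0 <= C, 0 < T &
  forall h w, 0 <= h < T -> `|w| <= 1 ->
    `|expo_re psi0 psi h a x w| <= C * h /\ `|phase h a x w| <= C * h].
Proof.
move=> Dx; have [C [T [C0 T0 H]]] := psi_local_bound a.
set S := \sum_k `|x ord0 k|; have S0 : 0 <= S by exact: sumr_ge0.
exists (C * (1 + S)), T; split => //; first by rewrite mulr_ge0// addr_ge0.
move=> h w hh w1; have [h1 h2 h3] := H h w hh w1.
have hr := normr_dotN_le _ x _ (fun k => (h3 k).1).
have hi := normr_dotN_le _ x _ (fun k => (h3 k).2).
rewrite -/S in hr hi.
have E : C * (1 + S) * h = C * h + C * h * S by ring.
rewrite E; split; first by rewrite (le_trans (ler_normD _ _))// lerD.
rewrite /phase /expo_im -addrA (le_trans (ler_normD _ _))// lerD//.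
suff <- : dotN (fun k => imp (psi h (uvec a w)) k - w * extR a k) x =
  dotN (imp (psi h (uvec a w))) x - w * dotpos a x by [].
rewrite dotposE// -dotNZ /dotN -sumrB; apply: eq_bigr => k _; rewrite mulrBl//.
Qed.

(* Characteristic function of the centred variable [dotpos a y - dotpos a x] under [p h x]. *)
Definition centred_re h a x w := expR (expo_re psi0 psi h a x w) * cos (phase h a x w).
Definition centred_im h a x w := expR (expo_re psi0 psi h a x w) * sin (phase h a x w).

Lemma char_centred h a x w : 0 <= h -> D x ->
  char_re p h a x w - cos (w * dotpos a x) =
    cos (w * dotpos a x) * (centred_re h a x w - 1) - sin (w * dotpos a x) * centred_im h a x w /\
  char_im p h a x w - sin (w * dotpos a x) =
    sin (w * dotpos a x) * (centred_re h a x w - 1) + cos (w * dotpos a x) * centred_im h a x w.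
Proof.
move=> h0 Dx; have [-> ->] := char_parts p psi0 psi tf aff h a x w h0 Dx.
rewrite /centred_re /centred_im.
have -> : expo_im psi0 psi h a x w = w * dotpos a x + phase h a x w by rewrite /phase; ring.
by rewrite (cosD (w * _)) (sinD (w * _)); split; ring.
Qed.

Lemma centred_integral h a x w : 0 <= h -> D x ->
  centred_re h a x w = Rintegral (p h x) setT (fun y : Bv => cos (w * (dotpos a y - dotpos a x))) /\
  centred_im h a x w = Rintegral (p h x) setT (fun y : Bv => sin (w * (dotpos a y - dotpos a x))).
Proof.
move=> h0 Dx; have [e1 e2] := char_parts p psi0 psi tf aff h a x w h0 Dx.
have mass := conservative_mass p tf cons h x h0 Dx.
have my : measurable_fun setT (fun y : Bv => w * dotpos a y).
  by apply: measurable_funM => //; exact: measurable_dotpos.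
have ic : (p h x).-integrable setT (EFin \o (fun y : Bv => cos (w * dotpos a y))).
  apply: (bounded_integrable_mass1 _ _ _ _ mass _ 1); first exact: measurable_fun_cos.
  by move=> y; exact: normr_cos_le1.
have isn : (p h x).-integrable setT (EFin \o (fun y : Bv => sin (w * dotpos a y))).
  apply: (bounded_integrable_mass1 _ _ _ _ mass _ 1); first exact: measurable_fun_sin.
  by move=> y; exact: normr_sin_le1.
have [r1 _] := Rintegral_rotation _ _ (p h x) (cos (w * dotpos a x)) (- sin (w * dotpos a x)) _ _ ic isn.
have [_ r2] := Rintegral_rotation _ _ (p h x) (- sin (w * dotpos a x)) (cos (w * dotpos a x)) _ _ ic isn.
rewrite /centred_re /centred_im /phase; split.
  rewrite (@eq_Rintegral _ _ _ (p h x) setT (fun y : Bv => cos (w * dotpos a x) * cos (w * dotpos a y) - - sin (w * dotpos a x) * sin (w * dotpos a y))); last first.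
    by move=> y _; rewrite mulrBr cosB; ring.
  by rewrite r1 -/(char_re p h a x w) -/(char_im p h a x w) e1 e2 cosB; ring.
rewrite (@eq_Rintegral _ _ _ (p h x) setT (fun y : Bv => - sin (w * dotpos a x) * cos (w * dotpos a y) + cos (w * dotpos a x) * sin (w * dotpos a y))); last first.
  by move=> y _; rewrite mulrBr sinB; ring.
by rewrite r2 -/(char_re p h a x w) -/(char_im p h a x w) e1 e2 sinB; ring.
Qed.

(* Bounds at frequency [w] propagate to [k w]; this replaces, for large frequencies, the
   local Riccati estimates, which are uniform only on [|w| <= 1]. *)
Lemma centred_natmul k h a x w : 0 <= h -> D x ->
  [/\ 0 <= 1 - centred_re h a x (k%:R * w),
      1 - centred_re h a x (k%:R * w) <= k%:R ^+ 2 * (1 - centred_re h a x w) &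
      `|centred_im h a x (k%:R * w) - k%:R * centred_im h a x w| <=
        k%:R ^+ 2 * (1 - centred_re h a x w)].
Proof.
move=> h0 Dx; have mass := conservative_mass p tf cons h x h0 Dx.
have [-> ->] := centred_integral h a x (k%:R * w) h0 Dx.
have [-> ->] := centred_integral h a x w h0 Dx.
pose z (y : Bv) := w * (dotpos a y - dotpos a x).
have mz : measurable_fun setT z.
  by apply: measurable_funM => //; apply: measurable_funB => //; exact: measurable_dotpos.
have mkz : measurable_fun setT (fun y => k%:R * z y) by exact: measurable_funM.
have ib (f : Bv -> R) : measurable_fun setT f -> (forall y, `|f y| <= 1) ->
    (p h x).-integrable setT (EFin \o f).
  by move=> mf f1; exact: (bounded_integrable_mass1 _ _ _ _ mass _ 1).
have i1 : (p h x).-integrable setT (EFin \o (fun _ : Bv => 1 : R)).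
  by apply: ib => // y; rewrite normr1.
have ic := ib _ (measurable_fun_cos _ _ _ _ mz) (fun _ => normr_cos_le1 _ _).
have isn := ib _ (measurable_fun_sin _ _ _ _ mz) (fun _ => normr_sin_le1 _ _).
have ick := ib _ (measurable_fun_cos _ _ _ _ mkz) (fun _ => normr_cos_le1 _ _).
have isk := ib _ (measurable_fun_sin _ _ _ _ mkz) (fun _ => normr_sin_le1 _ _).
have one : Rintegral (p h x) setT (fun _ : Bv => 1 : R) = 1 by exact: (Rintegral_cst_mass1 _ _ _ (p h x) mass 1).
have kz y : k%:R * w * (dotpos a y - dotpos a x) = k%:R * z y by rewrite /z mulrA.
under [in X in [/\ 0 <= _ - X, _ - X <= _ & _]]eq_Rintegral do rewrite kz.
under [X in `|X - _|]eq_Rintegral do rewrite kz.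
have E1 : 1 - Rintegral (p h x) setT (fun y => cos (k%:R * z y)) =
    Rintegral (p h x) setT (fun y => 1 - cos (k%:R * z y)).
  by rewrite RintegralB// one.
have E2 : k%:R ^+ 2 * (1 - Rintegral (p h x) setT (fun y => cos (z y))) =
    Rintegral (p h x) setT (fun y => k%:R ^+ 2 * (1 - cos (z y))).
  have ii := integrableB measurableT i1 ic.
  by rewrite RintegralZl// RintegralB// one.
have E3 : Rintegral (p h x) setT (fun y => sin (k%:R * z y)) - k%:R * Rintegral (p h x) setT (fun y => sin (z y)) =
    Rintegral (p h x) setT (fun y => sin (k%:R * z y) - k%:R * sin (z y)).
  have ii := integrableZl measurableT k%:R isn.
  by rewrite RintegralB// RintegralZl.
have iE1 := integrableB measurableT i1 ick.
have iE2 := integrableZl measurableT (k%:R ^+ 2) (integrableB measurableT i1 ic).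
have iE3 := integrableB measurableT isk (integrableZl measurableT k%:R isn).
rewrite E1 E2 E3; split.
- by apply: Rintegral_ge0 => y _; rewrite subr_ge0 cos_le1.
- by apply: le_Rintegral => // y _; exact: cosB1_natmul.
rewrite (le_trans (le_normr_Rintegral measurableT iE3))//.
apply: le_Rintegral => //; first exact: integrable_normr.
by move=> y _; exact: sinB_natmul.
Qed.

(** A large [w] is written as [N w'] with [|w'| <= 1] and [N <= |w| + 1]; the local estimate at [w']
    is transported by [centred_natmul], at the cost of [N^2 <= 2 (1 + w^2)]. *)
Lemma centred_quadratic_bound (a : 'I_m -> R) (x : vec) : D x -> exists C T : R, [/\ 0 <= C, 0 < T &
  forall h w, 0 <= h < T ->
    `|centred_re h a x w - 1| <= C * (1 + w ^+ 2) * h /\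
    `|centred_im h a x w| <= C * (1 + w ^+ 2) * h].
Proof.
move=> Dx; have [C [T [C0 T0 H]]] := expo_local_bound a x Dx.
pose T' := Num.min T (2 * (C + 1))^-1.
have C1 : 0 < C + 1 by rewrite ltr_wpDl.
(* [36 = 2 * 2 * 9]: both centred parts at [w'] are at most [9 C h], [N^2] costs a factor 2, and the
   imaginary part is a sum of two such terms. [T'] ensures [C h <= 1/2], so that the Taylor bound
   applies. *)
exists (36 * C), T'; split; first by rewrite mulr_ge0.
  by rewrite lt_min T0 invr_gt0 mulr_gt0.
move=> h w /andP[h0]; rewrite lt_min => /andP[hT hC].
have Ch : C * h <= 2^-1.
  have : 2 * (C + 1) * h <= 1 by rewrite mulrC -ler_pdivlMr ?mulr_gt0// div1r ltW.
  lra.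
have Ch0 : 0 <= C * h by rewrite mulr_ge0.
pose N := (Num.truncn `|w|).+1.
have N0 : (0 : R) < N%:R by rewrite ltr0n.
have wN : `|w| < N%:R by rewrite truncnS_gt.
have Nw : (N%:R : R) <= `|w| + 1 by rewrite -natr1 lerD2r truncn_le.
pose w' := w / N%:R.
have w1 : `|w'| <= 1.
  by rewrite normrM (gtr0_norm (_ : 0 < N%:R^-1)) ?invr_gt0// ler_pdivrMr// mul1r ltW.
have [b1 b2] := H h w' (introT andP (conj h0 hT)) w1.
have r2 : expo_re psi0 psi h a x w' <= 2^-1 by rewrite (le_trans (ler_norm _))// (le_trans b1).
have [t1 t2] := cexp_taylor _ (phase h a x w') r2.
have sq (z : R) : `|z| <= C * h -> z ^+ 2 <= 2^-1 * (C * h).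
  move=> hz; rewrite -real_normK ?num_real// expr2.
  by rewrite ler_pM// (le_trans hz).
have s1 := sq _ b1; have s2 := sq _ b2.
have c1 : `|centred_re h a x w' - 1| <= 9 * (C * h).
  rewrite -[X in `|X|](subrK (expo_re psi0 psi h a x w')) (le_trans (ler_normD _ _))//.
  rewrite /centred_re; lra.
have c2 : `|centred_im h a x w'| <= 9 * (C * h).
  rewrite -[X in `|X|](subrK (phase h a x w')) (le_trans (ler_normD _ _))//.
  rewrite /centred_im; lra.
have [d1 d2 d3] := centred_natmul N h a x w' h0 Dx.
have Nw' : N%:R * w' = w by rewrite /w' mulrC divfK ?gt_eqF.
rewrite Nw' in d1 d2 d3.
have N2 : (N%:R : R) ^+ 2 <= 2 * (1 + w ^+ 2).
  have -> : w ^+ 2 = `|w| ^+ 2 by rewrite real_normK ?num_real.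
  have h1 : (N%:R : R) ^+ 2 <= (`|w| + 1) ^+ 2 by rewrite ler_sqr ?nnegrE ?addr_ge0.
  by have := sqr_ge0 (`|w| - 1); lra.
have NN : (N%:R : R) <= N%:R ^+ 2 by rewrite expr2 ler_peMr// ler1n.
have e0 : 1 - centred_re h a x w' <= 9 * (C * h) by rewrite (le_trans (ler_norm _))// distrC.
have N20 := sqr_ge0 (N%:R : R).
have k1 : N%:R ^+ 2 * (1 - centred_re h a x w') <= 2 * (1 + w ^+ 2) * (9 * (C * h)).
  rewrite (le_trans (ler_wpM2l N20 e0))// ler_wpM2r// mulr_ge0//.
have k2 : N%:R * `|centred_im h a x w'| <= 2 * (1 + w ^+ 2) * (9 * (C * h)).
  by rewrite ler_pM// (le_trans NN).
have E : 36 * C * (1 + w ^+ 2) * h = 2 * (2 * (1 + w ^+ 2) * (9 * (C * h))) by ring.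
have pos : 0 <= 2 * (1 + w ^+ 2) * (9 * (C * h)).
  by rewrite !mulr_ge0// addr_ge0// sqr_ge0.
rewrite E; split; first by rewrite distrC ger0_norm//; lra.
rewrite -[X in `|X|](subrK (N%:R * centred_im h a x w')) (le_trans (ler_normD _ _))//.
rewrite (normrM N%:R) (gtr0_norm N0); lra.
Qed.

Definition gen_re a x w : R := complex.Re (Rf ord0 (uvec a w)) +
  dotN (fun k => complex.Re (Rf (lift ord0 k) (uvec a w))) x.
Definition gen_im a x w : R := complex.Im (Rf ord0 (uvec a w)) +
  dotN (fun k => complex.Im (Rf (lift ord0 k) (uvec a w))) x.

Lemma expo_quotient_cvg (a : 'I_m -> R) x w (h : nat -> R) : D x -> (forall k, 0 < h k) ->
  h k @[k --> \oo] --> (0 : R) ->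
  (h k)^-1 * expo_re psi0 psi (h k) a x w @[k --> \oo] --> gen_re a x w /\
  (h k)^-1 * phase (h k) a x w @[k --> \oo] --> gen_im a x w.
Proof.
move=> Dx h0 hc; have [u0 [p0 /(_ 0 (lexx _)) [hk [hr hi]]]] := ric _ (imag_uvec (n := n) a w).
set u := uvec a w in u0 p0 hk hr hi *.
have pu : psi 0 u = u by apply/funext.
rewrite pu in hk hr hi.
have q := fun f l df => deriv_within_quotient f l h df h0 hc.
split.
  rewrite (_ : (fun k => _) = fun k => (h k)^-1 * complex.Re (psi0 (h k) u) +
      dotN (fun j => (h k)^-1 * rep (psi (h k) u) j) x); last first.
    by apply/funext => k; rewrite /expo_re mulrDr dotNZ.
  apply: cvgD.
    by have := q _ _ hr; rewrite p0/=; under eq_fun do rewrite subr0.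
  apply: cvg_dotN => j; have [h1 _] := hk j.
  by have := q _ _ h1; rewrite u0/=; under eq_fun do rewrite subr0.
rewrite (_ : (fun k => _) = fun k => (h k)^-1 * complex.Im (psi0 (h k) u) +
      dotN (fun j => (h k)^-1 * (imp (psi (h k) u) j - w * extR a j)) x); last first.
  apply/funext => k; rewrite /phase /expo_im dotposE// -addrA mulrDr dotNZ -dotNZ.
  by congr (_ + _ * _); rewrite /dotN -sumrB; apply: eq_bigr => j _; rewrite mulrBl.
apply: cvgD.
  by have := q _ _ hi; rewrite p0/=; under eq_fun do rewrite subr0.
apply: cvg_dotN => j; have [_ h1] := hk j.
by have := q _ _ h1; rewrite u0/=.
Qed.

(* The derivative at time 0 of the Laplace transform: [gen_re + i gen_im] is the derivative of
   the characteristic exponent, and the Poisson functional continues it to real arguments. *)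
Lemma Lap_derivative0 (a : 'I_m -> R) (i : 'I_m) (l : R) : (forall i, 0 <= a i) -> 0 <= l ->
  exists2 T : R, 0 < T & forall h : nat -> R, (forall k, 0 < h k < T) ->
    h k @[k --> \oo] --> (0 : R) ->
    (h k)^-1 * (Lap p (h k) a (l *: unitv (lshift n i)) - expR (- (l * a i))) @[k --> \oo] -->
      expR (- (l * a i)) *
        (Rre ord0 (fun i => - a i) + l * Rre (lift ord0 (lshift n i)) (fun i => - a i)).
Proof.
move=> a0 l0; set x := l *: unitv (lshift n i).
have Dx : D x by apply: stateD_scale => //; exact: stateD_unitv.
have y0E : dotpos a x = l * a i.
  by rewrite dotposE// dotN_delta extR_lshift.
have y00 : 0 <= dotpos a x by exact: dotpos_ge0.
have [C [T [C0 T0 H]]] := centred_quadratic_bound a x Dx.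
exists T => // h hT hc; rewrite -y0E; set y0 := dotpos a x in y00 *.
have h0 k : 0 < h k by have /andP[] := hT k.
have [[C1 t0] P0] := poisson_Rfun _ _ _ _ adm ord0 a y0 a0 y00.
have [[C2 ti] Pi] := poisson_Rfun _ _ _ _ adm (lift ord0 (lshift n i)) a y0 a0 y00.
set Fr0 := (fun w : R => complex.Re (Rf ord0 _)) in t0 P0.
set Fi0 := (fun w : R => complex.Im (Rf ord0 _)) in t0 P0.
set Fri := (fun w : R => complex.Re (Rf (lift _ _) _)) in ti Pi.
set Fii := (fun w : R => complex.Im (Rf (lift _ _) _)) in ti Pi.
have tchar k := Lap_poisson p tf cons (h k) a x (ltW (h0 k)) Dx a0.
pose G k w := (h k)^-1 * (char_re p (h k) a x w + -1 * cos (w * y0)).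
pose K k w := (h k)^-1 * (char_im p (h k) a x w + -1 * sin (w * y0)).
have tB k := tameD (tchar k).1 (tameZ (-1) (tame_exp y0)).
pose P k w := (h k)^-1 * (centred_re (h k) a x w - 1).
pose Q k w := (h k)^-1 * centred_im (h k) a x w.
have GE k w : G k w = rotr y0 (P k) (Q k) w.
  have [e _] := char_centred (h k) a x w (ltW (h0 k)) Dx.
  by rewrite /G mulN1r e /rotr /P /Q; ring.
have KE k w : K k w = roti y0 (P k) (Q k) w.
  have [_ e] := char_centred (h k) a x w (ltW (h0 k)) Dx.
  by rewrite /K mulN1r e /roti /P /Q; ring.
have bPQ k w : `|P k w| <= C * (1 + w ^+ 2) /\ `|Q k w| <= C * (1 + w ^+ 2).
  have /andP[hk1 hk2] := hT k.
  have [|e1 e2] := H (h k) w; first by rewrite ltW.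
  by split; rewrite normrM (gtr0_norm (_ : 0 < (h k)^-1)) ?invr_gt0// mulrC ler_pdivrMr.
have lin0 : gen_re a x =1 (fun w => Fr0 w + l * Fri w).
  by move=> w; rewrite /gen_re dotN_delta.
have lin1 : gen_im a x =1 (fun w => Fi0 w + l * Fii w).
  by move=> w; rewrite /gen_im dotN_delta.
have tgen : tame (gen_re a x) (gen_im a x) (C1 + `|l| * C2).
  by rewrite (funext lin0) (funext lin1); exact: tameD t0 (tameZ l ti).
(* Domination needs a constant independent of [k]: from [tB] only measurability is kept, and the
   bound comes from the centred estimate. *)
have tGK k : tame (G k) (K k) (2 * C).
  have [mG mK _] := tameZ (h k)^-1 (tB k); split => // w.
  rewrite GE KE -mulrA; have [b1 b2] := bPQ k w; exact: normr_rot_le.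
have cPQ w : P k w @[k --> \oo] --> gen_re a x w /\ Q k w @[k --> \oo] --> gen_im a x w.
  have [h1 h2] := expo_quotient_cvg a x w h Dx h0 hc.
  exact: cexp_quotient_cvg h0 hc h1 h2.
have main : poisson (G k) (K k) @[k --> \oo] -->
    poisson (rotr y0 (gen_re a x) (gen_im a x)) (roti y0 (gen_re a x) (gen_im a x)).
  have [mr mi _] := tame_rot y0 tgen.
  apply: (poisson_cvg _ _ _ _ (2 * C)) => // w.
    under eq_fun do rewrite GE; have [h1 h2] := cPQ w.
    by apply: cvgB; apply: cvgMr.
  under eq_fun do rewrite KE; have [h1 h2] := cPQ w.
  by apply: cvgD; apply: cvgMr.
have PG k : poisson (G k) (K k) = c0 * ((h k)^-1 * (Lap p (h k) a x - expR (- y0))).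
  rewrite (poissonZ (h k)^-1 (tB k)) (poissonD (tchar k).1 (tameZ (-1) (tame_exp y0))).
  by rewrite (poissonZ (-1) (tame_exp y0)) poisson_exp// (tchar k).2; ring.
have PF : poisson (rotr y0 (gen_re a x) (gen_im a x)) (roti y0 (gen_re a x) (gen_im a x)) =
   c0 * (expR (- y0) * (Rre ord0 (fun i => - a i) + l * Rre (lift ord0 (lshift n i)) (fun i => - a i))).
  rewrite [RHS](_ : _ = c0 * expR (- y0) * Rre ord0 (fun i => - a i) +
    l * (c0 * expR (- y0) * Rre (lift ord0 (lshift n i)) (fun i => - a i))); last by ring.
  rewrite -P0 -Pi -(poissonZ l (tame_rot y0 ti)) -(poissonD (tame_rot y0 t0) (tameZ l (tame_rot y0 ti))).
  by apply: eq_poisson => w; rewrite /rotr /roti lin0 lin1; ring.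
have c00 : c0 != 0 by rewrite gt_eqF// poisson_const_gt0.
rewrite PF in main.
set L := expR (- y0) * _ in main *.
have lim : c0^-1 * poisson (G k) (K k) @[k --> \oo] --> c0^-1 * (c0 * L) by exact: cvgMr.
rewrite mulKf// in lim.
have E : (fun k => (h k)^-1 * (Lap p (h k) a x - expR (- y0))) = fun k => c0^-1 * poisson (G k) (K k).
  by apply/funext => k; rewrite PG mulKf.
by rewrite E.
Qed.

(** The cases [l = 0] and [l = 1] of the derivative at time 0 treat the two transforms in [flow]; in
    the difference of their logarithms [R_0] cancels. A failing sequence of times is turned into a
    contradiction because the derivative is a sequential limit. *)
Lemma flow_upper_derivative0 (a : 'I_m -> R) (i : 'I_m) (e : R) : (forall i, 0 <= a i) -> 0 < e ->
  exists2 d : R, 0 < d & forall h, 0 < h < d ->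
    - flow p h a i <= - a i + h * (Rre (lift ord0 (lshift n i)) (fun i => - a i) + e).
Proof.
move=> a0 e0; set Ri := Rre (lift _ _) _.
have [T0 T00 D0] := Lap_derivative0 a i 0 a0 (lexx _).
have [T1 T10 D1] := Lap_derivative0 a i 1 a0 ler01.
apply: contrapT => nE.
have ex k : exists h : R, 0 < h < Num.min (Num.min T0 T1) k.+1%:R^-1 /\
    - a i + h * (Ri + e) < - flow p h a i.
  apply: contrapT => nH; apply: nE; exists (Num.min (Num.min T0 T1) k.+1%:R^-1).
    by rewrite !lt_min T00 T10/= invr_gt0.
  by move=> h hh; rewrite leNgt; apply/negP => bad; apply: nH; exists h.
pose h k := sval (cid (ex k)).
have h0 k : 0 < h k by rewrite /h; case: cid => z /= [/andP[]].
have hT k : [/\ h k < T0, h k < T1 & h k < k.+1%:R^-1].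
  by rewrite /h; case: cid => z /= [/andP[_]]; rewrite !lt_min -andbA => /and3P[].
have bad k : - a i + h k * (Ri + e) < - flow p (h k) a i by rewrite /h; case: cid => z /= [].
have hc : h k @[k --> \oo] --> (0 : R).
  apply: (@squeeze_cvgr _ _ _ _ (fun=> 0) harmonic); [|exact: cvg_cst|exact: cvg_harmonic].
  by near=> k; have [_ _ hk] := hT k; rewrite (ltW (h0 k)) (ltW hk).
have {}D0 : (h k)^-1 * (Lap p (h k) a 0 - 1) @[k --> \oo] --> Rre ord0 (fun i => - a i).
  have := D0 h; rewrite scale0r !mul0r oppr0 expR0 addr0 mul1r; apply => // k.
  by rewrite h0; have [] := hT k.
have {}D1 : (h k)^-1 * (Lap p (h k) a (unitv (lshift n i)) - expR (- a i)) @[k --> \oo] -->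
    expR (- a i) * (Rre ord0 (fun i => - a i) + Ri).
  have := D1 h; rewrite scale1r !mul1r; apply => // k.
  by rewrite h0; have [] := hT k.
have Dz := @stateD_zero R m n; have De := @stateD_unitv R m n (lshift n i).
have L0c : Lap p (h k) a 0 @[k --> \oo] --> (1 : R).
  have := Lap_cvg p psi0 psi tf aff cons _ _ _ _ ric 0 a 0 h (lexx _) Dz a0 (fun k => ltW (h0 k)) hc.
  by rewrite Lap_time0// dotpos0 oppr0 expR0.
(* By [ln z <= z - 1], applied to [l1 e^{a_i}] and to [1 / l0], this quantity bounds
   [(a_i - flow_i) / h k] from above, and it converges to [R_i(-a, 0)]. *)
pose F k := expR (a i) * ((h k)^-1 * (Lap p (h k) a (unitv (lshift n i)) - expR (- a i))) -
    (h k)^-1 * (Lap p (h k) a 0 - 1) * (Lap p (h k) a 0)^-1.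
have lim : F k @[k --> \oo] --> Ri.
  rewrite [Ri](_ : _ = expR (a i) * (expR (- a i) * (Rre ord0 (fun i => - a i) + Ri)) -
      Rre ord0 (fun i => - a i) * 1^-1); last first.
    by rewrite mulrA -expRD subrr expR0 invr1; ring.
  apply: cvgB; first exact: cvgMr.
  apply: cvgM => //; apply: cvgV => //; exact: oner_neq0.
have cl : \forall k \near \oo, F k < Ri + e by apply: (cvgr_lt Ri) => //; rewrite ltrDl.
near \oo => k.
have : Ri + e < Ri + e; last by rewrite ltxx.
apply: (@lt_trans _ _ (F k)); last by near: k; exact: cl.
rewrite /F.
have L0 := Lap_gt0 p tf cons (h k) a 0 (ltW (h0 k)) Dz a0.
have L1 := Lap_gt0 p tf cons (h k) a _ (ltW (h0 k)) De a0.
have := bad k; rewrite /flow opprB.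
set l0 := Lap p (h k) a 0 in L0 *; set l1 := Lap p (h k) a _ in L1 *.
have ea := expR_gt0 (a i).
have l1b : ln l1 <= - a i + (l1 * expR (a i) - 1).
  have := @le_ln1Dx R (l1 * expR (a i) - 1); rewrite ltrBrDl subrr mulr_gt0// => /(_ isT).
  rewrite subrKC lnM ?posrE// expRK; lra.
have l0b : - ln l0 <= l0^-1 - 1.
  have := @le_ln1Dx R (l0^-1 - 1); rewrite ltrBrDl subrr invr_gt0 L0 => /(_ isT).
  by rewrite subrKC lnV ?posrE.
move=> b.
have : h k * (Ri + e) < (l1 * expR (a i) - 1) + (l0^-1 - 1) by lra.
rewrite mulrC -ltr_pdivlMr// => /lt_le_trans; apply.
rewrite le_eqVlt; apply/orP; left; apply/eqP.
have -> : expR (- a i) = (expR (a i))^-1 by rewrite expRN.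
by field; rewrite !gt_eqF.
Unshelve. all: by end_near. Qed.

End LaplaceDerivative.

(** * Comparison with solutions of the Riccati equation *)

Section Comparison.
Context {R : realType} {m n : nat}.
Local Notation vec := 'rV[R]_(m + n).
Local Notation Bv := (Bvec R m n).
Local Notation D := (@stateD R m n).
Variables (p : R -> vec -> {measure set Bv -> \bar R}).
Variables (psi0 : R -> ('I_(m + n) -> R[i]) -> R[i]).
Variables (psi : R -> ('I_(m + n) -> R[i]) -> 'I_(m + n) -> R[i]).
Hypotheses (tf : transition_function p) (aff : affine_with p psi0 psi).
Variables (alpha : 'I_(m + n).+1 -> 'M[R]_(m + n)) (beta : 'I_(m + n).+1 -> vec).
Variables (gamma : 'I_(m + n).+1 -> R) (kappa : 'I_(m + n).+1 -> {measure set Bv -> \bar R}).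
Hypothesis adm : admissible alpha beta gamma kappa.
Hypothesis ric : riccati alpha beta gamma kappa psi0 psi.
Local Notation Rf := (Rfun alpha beta gamma kappa).
Local Notation Rre i := (Rreal alpha beta gamma kappa (lift ord0 (lshift n i))).

Lemma psi_at0 : psi 0 (fun=> 0) = fun=> 0.
Proof. by apply/funext => k; have [-> _] := ric _ imag_vec0. Qed.

Section Conservative.
Hypothesis cons : conservative p.

Lemma conservative_psi t : 0 <= t ->
  complex.Re (psi0 t (fun=> 0)) = 0 /\ forall k, psi t (fun=> 0) k = 0.
Proof.
move=> t0.
have q0 x : D x -> complex.Re (psi0 t (fun=> 0)) + dotN (rep (psi t (fun=> 0))) x = 0.
  move=> Dx; have [] := mass_psi p psi0 psi aff t x t0 Dx; rewrite cons//=.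
  set q := _ + _; set th := _ + _ => h1 h2.
  (* Adding the squares of the two equations eliminates the unknown phase [th]. *)
  have e2 : expR q ^+ 2 = 1.
    have : (expR q * cos th) ^+ 2 + (expR q * sin th) ^+ 2 = 1 by rewrite -h1 -h2 expr1n expr0n addr0.
    by rewrite !exprMn -mulrDr cos2Dsin2 mulr1.
  have := congr1 (@ln R) e2; rewrite expr2 -expRD expRK ln1; lra.
have r0 : complex.Re (psi0 t (fun=> 0)) = 0.
  have := q0 _ (@stateD_zero R m n).
  by rewrite /dotN big1 ?addr0// => k _; rewrite mxE mulr0.
split => // k; apply/eqP; rewrite eq_complex; apply/andP; split; apply/eqP.
  have := q0 _ (stateD_unitv k).
  by rewrite r0 add0r -[unitv k]scale1r dotN_delta mul1r.
by have := Im_psi0 p psi0 psi aff t k t0.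
Qed.

Lemma conservative_gamma j : gamma j = 0.
Proof.
have [_ [_ /(_ 0 (lexx _)) [hk [h0 _]]]] := ric _ imag_vec0.
rewrite psi_at0 in hk h0; apply/eqP; rewrite -oppr_eq0; apply/eqP.
have [k ->|->] := unliftP ord0 j.
  have [h _] := hk k; rewrite Rfun0 in h; apply: deriv_within_cst0 h => // s s0.
  by have [_ ->] := conservative_psi s s0.
rewrite Rfun0 in h0; apply: deriv_within_cst0 h0 => // s s0.
by have [-> _] := conservative_psi s s0.
Qed.

Lemma flow_upper_derivative (a : 'I_m -> R) (t : R) (i : 'I_m) (e : R) :
  (forall i, 0 <= a i) -> 0 <= t -> 0 < e ->
  exists2 d : R, 0 < d & forall h, 0 < h < d ->
    - flow p (t + h) a i <= - flow p t a i + h * (Rre i (fun i => - flow p t a i) + e).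
Proof.
move=> a0 t0 e0; have f0 := flow_ge0 p psi0 psi tf aff cons t a t0 a0.
have [d d0 H] := flow_upper_derivative0 p psi0 psi tf aff cons _ _ _ _ adm ric
  (flow p t a) i e f0 e0.
exists d => // h hd; rewrite addrC (flow_semigroup p psi0 psi tf aff cons)//; first exact: H.
by case/andP: hd => /ltW.
Qed.

Lemma flow_continuous (a : 'I_m -> R) (t : R) (i : 'I_m) (e : R) :
  (forall i, 0 <= a i) -> 0 <= t -> 0 < e ->
  exists2 d : R, 0 < d & forall s, 0 <= s -> `|s - t| < d -> `|flow p s a i - flow p t a i| < e.
Proof.
move=> a0 t0 e0; apply: contrapT => nE.
have ex k : exists s : R, [/\ 0 <= s, `|s - t| < k.+1%:R^-1 & e <= `|flow p s a i - flow p t a i|].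
  apply: contrapT => nH; apply: nE; exists k.+1%:R^-1; first by rewrite invr_gt0.
  by move=> s s0 st; rewrite ltNge; apply/negP => bad; apply: nH; exists s.
pose s k := sval (cid (ex k)).
have sP k : [/\ 0 <= s k, `|s k - t| < k.+1%:R^-1 & e <= `|flow p (s k) a i - flow p t a i|].
  by rewrite /s; case: cid.
have s0 k : 0 <= s k by have [] := sP k.
have st : s k @[k --> \oo] --> t.
  have z : (s k - t) @[k --> \oo] --> (0 : R).
    apply: norm_cvg0; apply: (@squeeze_cvgr _ _ _ _ (fun=> 0) harmonic); last exact: cvg_harmonic.
      by near=> k; have [_ hk _] := sP k; rewrite normr_ge0 (ltW hk).
    exact: cvg_cst.
  have H : (s k - t) + t @[k --> \oo] --> 0 + t by apply: cvgD => //; exact: cvg_cst.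
  have sE : s = fun k => s k - t + t by apply/funext => k; rewrite subrK.
  by rewrite add0r in H; rewrite sE.
have := flow_cvg p psi0 psi tf aff cons _ _ _ _ ric t a i s t0 a0 s0 st.
move=> /cvgrPdist_lt /(_ e e0) fc.
near \oo => k.
have [_ _] := sP k; apply/negP; rewrite -ltNge distrC.
by near: k; exact: fc.
Unshelve. all: by end_near. Qed.

(* Quasi-monotonicity and superhomogeneity bound [Rre i (-Y)] by a multiple of [Y_i], so
   [eps * exp (-Ct)] is a lower barrier for the flow. *)
Lemma flow_gt0 (eps t : R) (i : 'I_m) : 0 < eps -> 0 <= t -> 0 < flow p t (fun=> eps) i.
Proof.
move=> eps0 t0; pose a (_ : 'I_m) := eps; rewrite -/a.
have a0 j : 0 <= a j by exact: ltW.
(* The largest nonpositive vector with [i]-th coordinate [- b], hence the extreme case for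
   quasi-monotonicity. *)
pose single (b : R) (j : 'I_m) : R := if j == i then - b else 0.
pose r := Num.max 0 (Rre i (single eps)).
have r0 : 0 <= r by rewrite le_max lexx.
(* The rate [r / eps] is the one found at contact; the extra 1 is slack, half of it for the
   derivative error [B / 2] and half for the remainder of [e^{-Ch}]. *)
pose C := r / eps + 1.
have C1 : 1 <= C by rewrite lerDr divr_ge0// ltW.
pose b s := eps * expR (- (C * s)).
have b0 s : 0 < b s by rewrite mulr_gt0// expR_gt0.
have bmono s s' : s <= s' -> b s' <= b s.
  move=> ss; rewrite ler_wpM2l ?(ltW eps0)// ler_expR lerN2 ler_wpM2l//; lra.
suff : b t <= flow p t a i by exact: lt_le_trans.
have tT : 0 <= t < t + 1 by rewrite t0 ltrDl ltr01.
apply: (real_induction R (t + 1) (fun t => b t <= flow p t a i)) tT.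
- by rewrite flow_time0// /b mulr0 oppr0 expR0 mulr1.
- move=> s /andP[s0 _] IH; rewrite leNgt; apply/negP => lt.
  have g0 : 0 < b s - flow p s a i by rewrite subr_gt0.
  have [d d0 H] := flow_continuous a s i _ a0 (ltW s0) g0.
  pose q := Num.min (d / 2) s.
  have q0 : 0 < q by rewrite lt_min divr_gt0.
  have qd : q <= d / 2 by rewrite ge_min lexx.
  have qs : q <= s by rewrite ge_min lexx orbT.
  have sq0 : 0 <= s - q by rewrite subr_ge0.
  have := H (s - q) sq0; rewrite addrAC subrr add0r normrN (gtr0_norm q0) => /(_ _)H'.
  have {H'} : `|flow p (s - q) a i - flow p s a i| < b s - flow p s a i by apply: H'; lra.
  have := IH (s - q); rewrite sq0 gtrBl q0 => /(_ isT) h1 h2.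
  have h3 := bmono (s - q) s; rewrite gerBl (ltW q0) in h3.
  have := h3 isT; have := ler_norm (flow p (s - q) a i - flow p s a i); lra.
move=> s /andP[s0 _] IH.
have := IH s; rewrite s0 lexx => /(_ isT); rewrite le_eqVlt => /orP[/eqP bs|bs]; last first.
  have g0 : 0 < flow p s a i - b s by rewrite subr_gt0.
  have [d d0 H] := flow_continuous a s i _ a0 s0 g0.
  exists d => // s' /andP[h1 h2] _.
  have := H s' (le_trans s0 (ltW h1)); rewrite (gtr0_norm (_ : 0 < s' - s)) ?subr_gt0//.
  rewrite ltrBlDl => /(_ h2); rewrite distrC => h3.
  have := ler_norm (flow p s a i - flow p s' a i); have := bmono _ _ (ltW h1); lra.
set B := b s in bs.
have B0 : 0 < B by exact: b0.
have Beps : B <= eps by rewrite /B /b ger_pMr// expR_le1 oppr_le0 mulr_ge0//; lra.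
have f0 := flow_ge0 p psi0 psi tf aff cons s a s0 a0.
(* [single B] lies above [- flow] and agrees with it at [i]; scaling by [eps / B >= 1] carries it to
   [single eps], where [R_i] is at most [r]. *)
have RB : Rre i (fun j => - flow p s a j) <= B * (C - 1).
  have h1 : Rre i (fun j => - flow p s a j) <= Rre i (single B).
    apply: (Rreal_quasimonotone _ _ _ _ adm).
    - by move=> j; rewrite /single; case: eqP => [->|_]; rewrite ?bs ?oppr_le0.
    - by move=> j; rewrite /single; case: eqP => _; rewrite ?oppr_le0// ltW.
    - by rewrite /single eqxx bs.
  have l1 : 1 <= eps / B by rewrite ler_pdivlMr// mul1r.
  have sn j : single B j <= 0 by rewrite /single; case: eqP => _; rewrite ?oppr_le0// ltW.
  have := Rreal_scale _ _ _ _ adm (lift ord0 (lshift n i)) (single B) (eps / B) sn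
    (conservative_gamma _) l1.
  rewrite (_ : (fun j => eps / B * single B j) = single eps); last first.
    by apply/funext => j; rewrite /single; case: eqP => _; rewrite ?mulr0// mulrN divfK// gt_eqF.
  have h3 : Rre i (single eps) <= r by rewrite /r le_max lexx orbT.
  move=> /le_trans /(_ h3); rewrite mulrC -ler_pdivlMr ?divr_gt0// => h2.
  rewrite (le_trans h1)// (le_trans h2)// /C addrK invf_div mulrCA//.
have e0 : 0 < B / 2 by rewrite divr_gt0.
have [d d0 H] := flow_upper_derivative a s i _ a0 s0 e0.
have C0 : 0 < C by rewrite (lt_le_trans ltr01).
have C20 : 0 < 2 * C ^+ 2 by rewrite mulr_gt0// exprn_gt0.
(* The second radius makes [(C h)^2 <= h / 2], which gives [e^{-Ch} <= 1 - C h + h / 2]. *)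
exists (Num.min d (2 * C ^+ 2)^-1); first by rewrite lt_min d0 invr_gt0.
move=> s' /andP[ss' s'd] _; pose h := s' - s.
have hE : s' = s + h by rewrite /h subrKC.
have h0 : 0 < h by rewrite subr_gt0.
have : h < Num.min d (2 * C ^+ 2)^-1 by rewrite ltrBlDl.
rewrite lt_min => /andP[hd hC].
have := H h; rewrite h0 hd -hE => /(_ isT); rewrite -bs => up.
have hC1 : 2 * (C * h) ^+ 2 <= h.
  have : h * (2 * C ^+ 2) <= 1 by rewrite -ler_pdivlMr// div1r ltW.
  rewrite exprMn; have := ltW h0; nra.
have Ch0 : 0 < C * h by rewrite mulr_gt0.
have be : b s' = B * expR (- (C * h)).
  by rewrite /b hE mulrDr opprD expRD mulrA.
have key : expR (- (C * h)) <= 1 - C * h + h / 2.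
  have h1 := expR_ge1Dx (C * h).
  have h2 : expR (C * h) * expR (- (C * h)) = 1 by rewrite -expRD subrr expR0.
  have h3 := expR_gt0 (- (C * h)); have h4 := expR_gt0 (C * h).
  have h5 : expR (- (C * h)) * (1 + C * h) <= 1 by nra.
  rewrite -(@ler_pM2r _ (1 + C * h)) ?addr_gt0// (le_trans h5)//.
  nra.
have k1 : B * expR (- (C * h)) <= B * (1 - C * h + h / 2) by rewrite ler_wpM2l// ltW.
have k2 : h * (Rre i (fun j => - flow p s a j) + B / 2) <= h * (B * (C - 1) + B / 2).
  by rewrite ler_wpM2l ?(ltW h0)// lerD2r.
rewrite be; lra.
Qed.

(** Where coordinate [i] touches the barrier, [g_i' >= R_i(-(1 + t) flow) >= (1 + t) R_i(- flow)],
    whereas the upper right derivative of [- (1 + t) flow_i] is at most the last term minus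
    [flow_i]. As the flow is positive, the gap is strict. *)
Lemma solution_lower_bound (T : R) (g : R -> 'I_m -> R) (eps : R) : 0 < eps ->
  (forall t, 0 <= t < T -> forall i, g t i <= 0) -> (forall i, g 0 i = 0) ->
  (forall t, 0 <= t < T -> forall i,
     deriv_within [set s | 0 <= s < T] (fun s => g s i) t (Rre i (g t))) ->
  forall t, 0 <= t < T -> forall i, - ((1 + t) * flow p t (fun=> eps) i) <= g t i.
Proof.
move=> eps0 gle g0 dg; pose a (_ : 'I_m) := eps.
have a0 j : 0 <= a j by exact: ltW.
have gc t i e : 0 <= t < T -> 0 < e -> exists2 d, 0 < d &
    forall s, 0 <= s < T -> `|s - t| < d -> `|g s i - g t i| < e.
  move=> tT e0; have [d d0 H] := deriv_within_step _ _ _ _ 1 (dg t tT i) ltr01.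
  set M := `|Rre i (g t)| + 1; have M0 : 0 < M by rewrite ltr_wpDl.
  exists (Num.min d (e / M)); first by rewrite lt_min d0 divr_gt0.
  move=> s sT; rewrite lt_min => /andP[h1]; rewrite ltr_pdivlMr// => h2.
  have := H s sT h1; rewrite mul1r => h3.
  rewrite (_ : g s i - g t i = (g s i - g t i - Rre i (g t) * (s - t)) + Rre i (g t) * (s - t)); last by ring.
  rewrite (le_lt_trans (ler_normD _ _))// normrM; rewrite /M in h2; lra.
apply: real_induction.
- by move=> i; rewrite g0 oppr_le0 mulr_ge0 ?addr0// flow_time0// ltW.
- move=> t /andP[t0 tT] IH i; rewrite leNgt; apply/negP => lt.
  pose f := flow p t a i; pose Dl := - ((1 + t) * f) - g t i.
  have D0 : 0 < Dl by rewrite subr_gt0.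
  have t1 : 0 < 1 + t by lra.
  have e0 : 0 < Dl / 2 / (1 + t) by rewrite !divr_gt0.
  have tT' : 0 <= t < T by rewrite ltW.
  have [d1 d10 H1] := flow_continuous a t i _ a0 (ltW t0) e0.
  have D20 : 0 < Dl / 2 by rewrite divr_gt0.
  have [d2 d20 H2] := gc t i _ tT' D20.
  pose q := Num.min (Num.min (d1 / 2) (d2 / 2)) t.
  have q0 : 0 < q by rewrite !lt_min !divr_gt0.
  have [qd1 qd2 qt] : [/\ q <= d1 / 2, q <= d2 / 2 & q <= t].
    by rewrite !ge_min !lexx ?orbT.
  have sq0 : 0 <= t - q by rewrite subr_ge0.
  have qn : `|t - q - t| = q by rewrite addrAC subrr add0r normrN gtr0_norm.
  have h3 := H1 (t - q) sq0; rewrite qn -/f in h3; have {}h3 := h3 ltac:(lra).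
  rewrite ltr_pdivlMr// in h3.
  have sT : 0 <= t - q < T by rewrite sq0/=; lra.
  have h2 := H2 (t - q) sT; rewrite qn in h2; have {}h2 := h2 ltac:(lra).
  have h1 := IH (t - q); rewrite sq0 gtrBl q0 -/a in h1; have {}h1 := h1 isT i.
  set f' := flow p (t - q) a i in h1 h3.
  have f'0 : 0 <= f' by exact: (flow_ge0 p psi0 psi tf aff cons).
  have h4 := ler_norm (g (t - q) i - g t i).
  have h5 : (f' - f) * (1 + t) < Dl / 2 by rewrite (le_lt_trans _ h3)// ler_wpM2r ?(ltW t1)// ler_norm.
  have h6 : (1 + (t - q)) * f' <= (1 + t) * f' by rewrite ler_wpM2r// lerD2l gerBl ltW.
  rewrite /Dl in h2 h5 *; lra.
move=> t /andP[t0 tT] IH.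
have tT' : 0 <= t < T by rewrite t0.
have t1 : 0 < 1 + t by lra.
have Pt : forall i, - ((1 + t) * flow p t a i) <= g t i by apply: IH; rewrite t0 lexx.
have f0 := flow_ge0 p psi0 psi tf aff cons t a t0 a0.
have step i : exists2 d, 0 < d & forall s, t < s < t + d -> s < T ->
    - ((1 + s) * flow p s a i) <= g s i.
  (* A strict inequality persists for a short time by continuity; only at equality are derivatives
     compared. *)
  have := Pt i; rewrite le_eqVlt => /orP[/eqP eq|lt]; last first.
    pose f := flow p t a i; pose Dl := g t i + (1 + t) * f.
    have D0 : 0 < Dl by rewrite /Dl /f; lra.
    have e0 : 0 < Dl / 2 / (1 + t) by rewrite !divr_gt0.
    have [d1 d10 H1] := flow_continuous a t i _ a0 t0 e0.
    have D20 : 0 < Dl / 2 by rewrite divr_gt0.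
    have [d2 d20 H2] := gc t i _ tT' D20.
    exists (Num.min d1 d2); first by rewrite lt_min d10.
    move=> s /andP[ts]; rewrite -ltrBlDl lt_min => /andP[sd1 sd2] sT.
    have s0 : 0 <= s by rewrite (le_trans t0)// ltW.
    have sn : `|s - t| = s - t by rewrite gtr0_norm// subr_gt0.
    have h1 := H1 s s0; rewrite sn -/f in h1; have {}h1 := h1 sd1.
    rewrite ltr_pdivlMr// distrC in h1.
    have sT' : 0 <= s < T by rewrite s0.
    have := H2 s sT'; rewrite sn distrC => /(_ sd2) h2.
    have h4 := ler_norm (g t i - g s i).
    set f' := flow p s a i in h1 *.
    have f'0 : 0 <= f' by exact: (flow_ge0 p psi0 psi tf aff cons).
    have h5 : (f - f') * (1 + t) < Dl / 2 by rewrite (le_lt_trans _ h1)// ler_wpM2r ?(ltW t1)// ler_norm.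
    have h6 : (1 + t) * f' <= (1 + s) * f' by rewrite ler_wpM2r// lerD2l ltW.
    rewrite /Dl in h2 h5 *; lra.
  set Y := flow p t a i in eq.
  have Y0 : 0 < Y by exact: flow_gt0.
  set r := Rre i (fun j => - flow p t a j).
  have Rg : (1 + t) * r <= Rre i (g t).
    have h1 := Rreal_scale _ _ _ _ adm (lift ord0 (lshift n i)) (fun j => - flow p t a j) (1 + t)
      (fun j => eq_ind_r (fun z => is_true z) (f0 j) (oppr_le0 _)) (conservative_gamma _).
    have {}h1 := h1 ltac:(rewrite lerDl; exact t0).
    rewrite (le_trans h1)//; apply: (Rreal_quasimonotone _ _ _ _ adm).
    - by move=> j; rewrite mulrN.
    - exact: gle.
    - by rewrite mulrN.
  (* The gap [Y] is spent in halves: [(2 + t) e = Y / 2] covers the errors of the two derivatives,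
     weighted by [1 + t] and 1, and the other half covers the second-order term [h (r + e)]. *)
  pose e := Y / (2 * (2 + t)).
  have t2 : 0 < 2 * (2 + t) by lra.
  have e0 : 0 < e by rewrite divr_gt0.
  have eY : e * (2 * (2 + t)) = Y by rewrite divfK// gt_eqF.
  have [d1 d10 H1] := flow_upper_derivative a t i e a0 t0 e0.
  have [d2 d20 H2] := deriv_within_step _ _ _ _ e (dg t tT' i) e0.
  pose M := `|r + e| + 1; have M0 : 0 < M by rewrite ltr_wpDl.
  exists (Num.min (Num.min d1 d2) (Y / (2 * M))).
    by rewrite !lt_min d10 d20 divr_gt0 ?mulr_gt0.
  move=> s /andP[ts]; rewrite -ltrBlDl; set h := s - t => hd sT.
  have h0 : 0 < h by rewrite subr_gt0.
  have sE : s = t + h by rewrite /h subrKC.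
  move: hd; rewrite !lt_min => /andP[/andP[hd1 hd2]]; rewrite ltr_pdivlMr ?mulr_gt0// => hM.
  have := H1 h; rewrite h0 hd1 -sE -/Y -/r => /(_ isT) up.
  have sT' : 0 <= s < T by rewrite sT andbT (le_trans t0)// ltW.
  have := H2 s sT'; rewrite -/h (gtr0_norm h0) => /(_ hd2) lo.
  have h1 := ler_norm (- (g s i - g t i - Rre i (g t) * h)); rewrite normrN in h1.
  have h2 : (1 + t) * r * h <= Rre i (g t) * h by rewrite ler_wpM2r// ltW.
  have s1 : 0 <= 1 + s by lra.
  have h3 := ler_wpM2l s1 up.
  have h4 : h * (r + e) <= Y / 2.
    have := ler_norm (r + e); rewrite /M in hM; nra.
  have h5 : h * (h * (r + e)) <= h * (Y / 2) by rewrite ler_wpM2l// ltW.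
  have h6 : (1 + s) * (- Y + h * (r + e)) = - ((1 + t) * Y) - h * Y + (1 + t) * (h * (r + e)) + h * (h * (r + e)).
    by rewrite sE; ring.
  rewrite -mulrN (le_trans h3)// h6 eq.
  have h7 : h * (e * (2 * (2 + t))) = h * Y by rewrite eY.
  lra.
pose dd i := projT1 (cid2 (step i)).
have dd0 i : 0 < dd i by rewrite /dd; case: cid2.
have ddP i s : t < s < t + dd i -> s < T -> - ((1 + s) * flow p s a i) <= g s i.
  by rewrite /dd; case: cid2 => d /= _; exact.
exists (\big[Num.min/1]_i dd i); first by rewrite lt_bigmin.
move=> s /andP[ts sd] sT i; apply: ddP => //.
by rewrite ts (lt_le_trans sd)// lerD2l bigmin_le_cond.
Qed.

Lemma flow_small (t : R) (i : 'I_m) : 0 <= t ->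
  flow p t (fun=> k.+1%:R^-1) i @[k --> \oo] --> (0 : R).
Proof.
move=> t0; have one (j : 'I_m) : 0 <= (1 : R) by [].
have S x Dx := Lap_small p tf cons (fun=> 1) t x t0 Dx one.
have L (x : vec) : D x -> ln (Lap p t (fun=> k.+1%:R^-1) x) @[k --> \oo] --> ln (1 : R).
  move=> Dx; apply: continuous_cvg; first exact: continuous_ln.
  have := S x Dx; under eq_fun do under [in X in Lap _ _ X _]eq_fun do rewrite mulr1.
  by [].
have H : flow p t (fun=> k.+1%:R^-1) i @[k --> \oo] --> ln (1 : R) - ln 1.
  by apply: cvgB; apply: L; [exact: stateD_zero|exact: stateD_unitv].
by rewrite subrr in H.
Qed.

Lemma conservative_no_solution : ~ nontrivial_local_solution alpha beta gamma kappa.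
Proof.
move=> [T [g [T0 [gle [g0 [dg [t [tT [i /negP]]]]]]]]]; apply; apply/eqP.
have t0 : 0 <= t by case/andP: tT.
have t1 : 0 < 1 + t by lra.
apply/eqP; rewrite eq_le gle//= leNgt; apply/negP => gn.
have q0 : 0 < - g t i / (1 + t) by rewrite divr_gt0// oppr_gt0.
have fs : \forall k \near \oo, flow p t (fun=> k.+1%:R^-1) i < - g t i / (1 + t).
  by apply: (cvgr_lt (0 : R)) => //; exact: flow_small.
near \oo => k.
have : flow p t (fun=> k.+1%:R^-1) i < - g t i / (1 + t) by near: k; exact: fs.
rewrite ltr_pdivlMr// mulrC; apply/negP; rewrite -leNgt lerNl.
apply: (solution_lower_bound T g _ _ gle g0) => //.
move=> s sT j; have [h _] := dg s sT j.
by rewrite -Re_Rfun_ext0.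
Unshelve. all: by end_near. Qed.

End Conservative.

(** The growth bound with [B = 0] allows an increment of at most [2 t]; a multiple of [f] scaled to
    have increment [2 t + 1] would violate it. *)
Lemma deriv_within_zero_eq (f : R -> R) :
  (forall t, 0 <= t -> deriv_within [set s | 0 <= s] f t 0) -> forall t, 0 <= t -> f t = f 0.
Proof.
move=> df t t0; apply/eqP; rewrite -subr_eq0 -normr_le0 leNgt; apply/negP => ft.
pose l := (2 * t + 1) / `|f t - f 0|.
have l0 : 0 < l by rewrite divr_gt0//; lra.
have tT : 0 <= t < t + 1 by rewrite t0 ltrDl ltr01.
have := deriv_growth unit (t + 1) 0 (fun _ s => l * f s) (fun _ _ => 0) (lexx _) _ _ t tT tt.
rewrite -mulrBr normrM (gtr0_norm l0) divfK ?gt_eqF// add0r mulr1 => H.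
have : 2 * t + 1 <= 2 * t; last by lra.
apply: H; last by move=> *; rewrite normr0.
move=> _ s s0 e e0; have el : 0 < e / l by rewrite divr_gt0.
have [d d0 H] := df s s0 _ el; exists d => // h h0 sh hd.
have hh := H h h0 sh hd; rewrite ltr_pdivlMr// subr0 in hh.
by rewrite subr0 -mulrBr -mulrA normrM (gtr0_norm l0) mulrC.
Qed.

Lemma no_solution_psi : ~ nontrivial_local_solution alpha beta gamma kappa ->
  forall t, 0 <= t -> psi t (fun=> 0) = fun=> 0.
Proof.
move=> ns; pose g t (i : 'I_m) := rep (psi t (fun=> 0)) (lshift n i).
have U s : 0 <= s -> in_U (psi s (fun=> 0)) by move=> s0; exact: (psi_in_U p psi0 psi tf aff).
have Im0 s k : 0 <= s -> complex.Im (psi s (fun=> 0) k) = 0.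
  by move=> s0; exact: (Im_psi0 p psi0 psi aff).
(* The last [n] coordinates vanish, their real parts by [in_U] and their imaginary parts because the
   mass is real; so the first [m] equations close up as [R_I(g, 0)]. *)
have E s : 0 <= s -> psi s (fun=> 0) = ext0 (g s).
  move=> s0; apply/funext => k; rewrite /ext0; case: (splitP k) => j kj.
    have -> : k = lshift n j by exact: val_inj.
    by apply/eqP; rewrite eq_complex Im0//= !eqxx.
  have [_ h] := U s s0 k; apply/eqP; rewrite eq_complex Im0//= eqxx andbT.
  by apply/eqP; apply: h; rewrite kj leq_addr.
move=> t t0; rewrite E//.
suff gz i : g t i = 0.
  by apply/funext => k; rewrite /ext0; case: fintype.split => // j; rewrite gz.
apply: contrapT => /eqP gn; apply: ns; exists (t + 1), g.
have tT : 0 <= t < t + 1 by rewrite t0 ltrDl ltr01.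
split; first by lra.
split; first by move=> s /andP[s0 _] j; have [] := U s s0 (lshift n j).
split; first by move=> j; rewrite /g psi_at0.
split; last by exists t; split => //; exists i.
move=> s sT j; have s0 : 0 <= s by case/andP: sT.
have [_ [_ /(_ s s0) [/(_ (lshift n j)) [h1 h2] _]]] := ric _ imag_vec0.
rewrite E// in h1 h2; split.
  by apply: deriv_within_sub h1 => // q /andP[].
by apply: deriv_within_sub h2 => // [q /andP[]|q /andP[q0 _]] //=; rewrite Im0.
Qed.

Lemma no_solution_conservative : Rf ord0 (fun=> 0) = 0 ->
  ~ nontrivial_local_solution alpha beta gamma kappa -> conservative p.
Proof.
move=> R0 ns t x t0 Dx; have psi_0 := no_solution_psi ns.
have [_ [p0 dp]] := ric _ imag_vec0.
have d0 s : 0 <= s -> cderiv_within [set s | 0 <= s] (fun s => psi0 s (fun=> 0)) s 0.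
  by move=> s0; have [_] := dp s s0; rewrite psi_0// R0.
have re : complex.Re (psi0 t (fun=> 0)) = 0.
  by rewrite (deriv_within_zero_eq (fun s => complex.Re (psi0 s _)) _ t t0) ?p0// => s /d0[].
have im : complex.Im (psi0 t (fun=> 0)) = 0.
  by rewrite (deriv_within_zero_eq (fun s => complex.Im (psi0 s _)) _ t t0) ?p0// => s /d0[].
have [h _] := mass_psi p psi0 psi aff t x t0 Dx.
have dz (c : 'I_(m + n) -> R) : (forall k, c k = 0) -> dotN c x = 0.
  by move=> c0; apply: big1 => k _; rewrite c0 mul0r.
move: h; rewrite re im psi_0// !dz// !addr0 expR0 cos0 mulr1 => h.
have [tf1 _] := tf.
have fin : p t x D \is a fin_num.
  rewrite ge0_fin_numE// (@le_lt_trans _ _ 1%E) ?ltry// (le_trans _ (tf1 t x t0 Dx))//.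
  apply: le_measure; rewrite ?inE//; exact: measurable_stateD.
by rewrite -(fineK fin) h.
Qed.

End Comparison.
Theorem theorem3p4 (R : realType) (m n : nat) (Hd : (0 < m + n)%N)
  (p : R -> 'rV[R]_(m + n) -> {measure set (Bvec R m n) -> \bar R})
  (psi0 : R -> ('I_(m + n) -> R[i]) -> R[i])
  (psi : R -> ('I_(m + n) -> R[i]) -> 'I_(m + n) -> R[i])
  (alpha : 'I_(m + n).+1 -> 'M[R]_(m + n))
  (beta : 'I_(m + n).+1 -> 'rV[R]_(m + n))
  (gamma : 'I_(m + n).+1 -> R)
  (kappa : 'I_(m + n).+1 -> {measure set (Bvec R m n) -> \bar R}) :
  transition_function p ->
  stoch_continuous p ->
  affine_with p psi0 psi ->
  admissible alpha beta gamma kappa ->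
  riccati alpha beta gamma kappa psi0 psi ->
  (conservative p <->
     (Rfun alpha beta gamma kappa ord0 (fun _ => 0) = 0 /\
      ~ nontrivial_local_solution alpha beta gamma kappa)) /\
  (conservative p ->
     (forall k : 'I_(m + n), Rfun alpha beta gamma kappa (lift ord0 k) (fun _ => 0) = 0) /\
     (forall j, gamma j = 0)).
Proof.
move=> tf sc aff adm ric; split; last first.
  move=> cons; have g0 := conservative_gamma p psi0 psi aff _ _ _ _ ric cons.
  by split => // k; rewrite Rfun0 g0 oppr0.
split.
  move=> cons; split; first by rewrite Rfun0 (conservative_gamma p psi0 psi aff _ _ _ _ ric cons) oppr0.
  exact: (conservative_no_solution p psi0 psi tf aff _ _ _ _ adm ric cons).
move=> [R0 ns]; exact: (no_solution_conservative p psi0 psi tf aff _ _ _ _ ric R0 ns).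
Qed.
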